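(* Let $p\ge2$ be an integer, $1\le j\le2p$, and $\sigma\in\mathrm{Aut}(\mathcal W(p))=PSL(2,\mathbb C)$. Then $\overline{R(j)}^\sigma$ is a $\sigma^{-1}\tau\sigma$-twisted $\mathcal W(p)$-module. Assume that $\mathcal W_0$ is a subalgebra of $\mathcal W(p)$ such that $\sigma^{-1}\tau\sigma=1$ on $\mathcal W_0$. Then $\overline{R(j)}^\sigma$ is an untwisted $\mathcal W_0$-module.
   Context: Let $L=\mathbb{Z}\alpha$ with $\langle\alpha,\alpha\rangle=2p$, $V_L$ the lattice vertex algebra with conformal vector $\omega=\frac{1}{4p}\alpha(-1)^2\mathbf 1+\frac{p-1}{2p}\alpha(-2)\mathbf 1$, $\widetilde Q=e^{-\alpha/p}_0:V_L\to V_{L-\alpha/p}$, and $\mathcal W(p)=\mathrm{Ker}_{V_L}\widetilde Q$ the triplet vertex algebra. $\tau=\exp[\frac{\pi i}{2p}\alpha(0)]$ is an automorphism of $\mathcal W(p)$ of order two, and $\overline{R(j)}=V_{L+\frac{3p-j-1/2}{2p}\alpha}$, $j=1,\dots,2p$, are $\tau$-twisted $\mathcal W(p)$-modules. For an automorphism $\sigma$ and a twisted module $(M,Y_M)$, $M^\sigma$ denotes the space $M$ with $Y_M^\sigma(v,z)=Y_M(\sigma v,z)$. *)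

(* Defs.v *)
From HB Require Import structures.
From mathcomp Require Import all_boot all_order all_algebra finmap multiset.
From mathcomp Require Import all_classical all_reals all_analysis.
From mathcomp Require Import complex.
(* The notations of monalg clash with those of MathComp-Analysis. *)
From mathcomp Require Import -(notations) monalg.

Set Implicit Arguments.
Unset Strict Implicit.
Unset Printing Implicit Defensive.

Import Order.TTheory GRing.Theory Num.Theory.

Local Open Scope classical_set_scope.
Local Open Scope ring_scope.
Local Open Scope complex_scope.

(* Infinite sums below are finitely supported sums [\sum_(i \in A) F i] of
   fsbigop: in every use only finitely many terms are nonzero. *)

Definition gbinom (K : fieldType) (x : K) (i : nat) : K :=
  (\prod_(k < i) (x - k%:R)) / i`!%:R.

Definition cexp (R : realType) (z : R[i]) : R[i] :=
  let: a +i* b := z in (expR a)%:C * (cos b +i* sin b).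

Section VertexAlgebra.
Variable R : realType.

(* [vmode u n v] is u_n v, where Y(u,z) v = \sum_n (u_n v) z^{-n-1}. Only the
   operations are recorded; the vertex algebras considered are subspaces
   [W : set V] of such a V, with the operations restricted to W. *)
Record vertexData := VertexData {
  vspace :> lmodType R[i];
  vvac : vspace;
  vmode : vspace -> int -> vspace -> vspace }.

Variable V : vertexData.
Implicit Types (W : set V) (g : V -> V) (u v : V).

Definition is_subspace W : Prop :=
  W 0 /\ forall (a : R[i]) u v, W u -> W v -> W (a *: u + v).

Definition is_subalgebra W : Prop :=
  [/\ is_subspace W, W (vvac V) &
      forall u v n, W u -> W v -> W (vmode u n v)].

Definition is_endomorphism W g : Prop :=
  [/\ forall v, W v -> W (g v),
      forall (a : R[i]) u v, W u -> W v -> g (a *: u + v) = a *: g u + g v,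
      g (vvac V) = vvac V &
      forall u v n, W u -> W v -> g (vmode u n v) = vmode (g u) n (g v)].

(* An automorphism of the vertex algebra W with conformal vector omega. The
   values of [aut] and [aut_inv] outside W are irrelevant. *)
Record automorphism W (omega : V) := Automorphism {
  aut :> V -> V;
  aut_inv : V -> V;
  aut_endo : is_endomorphism W aut;
  aut_inv_endo : is_endomorphism W aut_inv;
  autK : forall v, W v -> aut_inv (aut v) = v;
  aut_invK : forall v, W v -> aut (aut_inv v) = v;
  aut_conformal : aut omega = omega }.

Definition has_order W g (T : nat) : Prop :=
  [/\ (0 < T)%N, forall v, W v -> iter T g v = v &
      forall k, (0 < k < T)%N -> exists2 v, W v & iter k g v != v].

(* u belongs to V^r when g u = e^{-2 pi i r / T} u. *)
Definition eigenvector g (T r : nat) u : Prop :=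
  g u = cexp (0 +i* (- (2 * pi * r%:R / T%:R))) *: u.

(* [YM u n w] is u_n w, where Y_M(u,z) w = \sum_n (u_n w) z^{-n-1} with n
   ranging over rational numbers, and g is an automorphism of W of order T.
   The last clause is the twisted Jacobi identity
     z0^-1 delta((z1-z2)/z0) Y_M(u,z1) Y_M(v,z2)
     - z0^-1 delta((z2-z1)/(-z0)) Y_M(v,z2) Y_M(u,z1)
     = z2^-1 ((z1-z0)/z2)^(-r/T) delta((z1-z0)/z2) Y_M(Y(u,z0)v,z2),
   for u in V^r, in coefficient form: the two sides are those of
   z0^(-l-1) z1^(-m-1) z2^(-n-1), with m in r/T + Z (the other coefficients
   vanish by the third clause). *)
Definition twisted_module W g (T : nat) (M : lmodType R[i])
    (YM : V -> rat -> M -> M) : Prop :=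
  (is_endomorphism W g /\ has_order W g T) /\
  [/\ (forall (a : R[i]) u v n w, W u -> W v ->
         YM (a *: u + v) n w = a *: YM u n w + YM v n w) /\
      (forall (a : R[i]) u n w w', W u ->
         YM u n (a *: w + w') = a *: YM u n w + YM u n w'),
      forall u w, W u -> exists N : rat, forall n, N <= n -> YM u n w = 0,
      forall u r n w, W u -> eigenvector g T r u ->
        n - r%:R / T%:R \isn't a Num.int -> YM u n w = 0,
      forall n w, YM (vvac V) n w = if n == -1 then w else 0 &
      forall u v w r (l k : int) (n : rat), W u -> W v ->
        eigenvector g T r u ->
        let m : rat := r%:R / T%:R + k%:~R in
        \sum_(i \in [set: nat])
          ratr (gbinom m i) *: YM (vmode u (l + i%:Z) v) (m + n - i%:R) w =
        \sum_(i \in [set: nat])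
          ((-1) ^+ i * gbinom l%:~R i) *:
          (YM u (m + l%:~R - i%:R) (YM v (n + i%:R) w)
           - (-1) ^ l *: YM v (n + l%:~R - i%:R) (YM u (m + i%:R) w))].

Definition untwisted_module W (M : lmodType R[i]) (YM : V -> rat -> M -> M) :=
  twisted_module W idfun 1 YM.

Definition twist (M : lmodType R[i]) (sigma : V -> V) (YM : V -> rat -> M -> M)
  : V -> rat -> M -> M := fun v => YM (sigma v).

End VertexAlgebra.

Section Lattice.
Variables (R : realType) (p : nat).
Local Notation K := R[i].

(* Every coset space V_{L + mu alpha}, mu rational, is modelled on the same
   vector space: the basis vector (n, A) stands for
     (\prod_(j <- A) alpha(-j-1)) e^{(mu + n) alpha}.
   The coset is recorded by the parameters lam, mu of the operators below. *)
Definition latbasis : choiceType := (int * {mset nat}%mset)%type.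
Definition latspace : lmodType K := malg latbasis K.

Definition lattice_vector (n : int) (A : {mset nat}%mset) : latspace :=
  mkmalgU ((n, A) : latbasis) (1 : K).

Definition linext (f : latbasis -> latspace) (v : latspace) : latspace :=
  \sum_(b <- msupp v) mcoeff b v *: f b.

(* alpha(0) on the summand with index n of V_{L + mu alpha} *)
Definition alpha0 (mu : rat) (n : int) : K := ratr ((2 * p)%:R * (mu + n%:~R)).

(* alpha(k) on V_{L + mu alpha}:
   [alpha(k), alpha(l)] = 2p k delta_{k+l,0}; note Negz j = -(j+1). *)
Definition heis (mu : rat) (k : int) : latspace -> latspace :=
  linext (fun b =>
    match k with
    | Posz 0 => alpha0 mu b.1 *: lattice_vector b.1 b.2
    | Posz j.+1 =>
        (2 * p * j.+1 * b.2 j)%:R *: lattice_vector b.1 (b.2 `\ j)%mset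
    | Negz j => lattice_vector b.1 (j +` b.2)%mset
    end).

(* coefficient of x^k in (\sum_i X i x^i)^j, then in exp (\sum_i X i x^i)
   when X 0 = 0, for operators X i *)
Fixpoint pow_coef (X : nat -> latspace -> latspace) (j k : nat) (w : latspace)
    : latspace :=
  match j with
  | 0 => if k == 0%N then w else 0
  | j'.+1 => \sum_(i < k.+1) X i (pow_coef X j' (k - i) w)
  end.

Definition exp_coef (X : nat -> latspace -> latspace) (k : nat) (w : latspace)
    : latspace :=
  \sum_(j < k.+1) (j`!%:R : K)^-1 *: pow_coef X j k w.

(* coefficient of z^k in exp (\sum_(i > 0) a alpha(-i) z^i / i) *)
Definition exp_minus (a : rat) : nat -> latspace -> latspace :=
  exp_coef (fun i w =>
    if i is j.+1 then (ratr a / j.+1%:R) *: heis 0 (Negz j) w else 0).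

(* coefficient of z^-k in exp (- \sum_(i > 0) a alpha(i) z^-i / i) *)
Definition exp_plus (a : rat) : nat -> latspace -> latspace :=
  exp_coef (fun i w =>
    if i is j.+1 then - (ratr a / j.+1%:R) *: heis 0 (Posz j.+1) w else 0).

Definition shift (n : int) : latspace -> latspace :=
  linext (fun b => lattice_vector (n + b.1) b.2).

(* coefficient of z^(-m-1) in Y(e^{a alpha}, z) =
     exp(\sum_(i>0) a alpha(-i) z^i / i) exp(- \sum_(i>0) a alpha(i) z^-i / i)
     e^{a alpha} z^{a alpha(0)},  a = lam + n1,  acting on V_{L + mu alpha} *)
Definition exp_mode (lam mu : rat) (n1 : int) (m : rat)
    : latspace -> latspace :=
  let a : rat := lam + n1%:~R in
  linext (fun b =>
    \sum_(kl \in [set kl : nat * nat |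
        a * (2 * p)%:R * (mu + b.1%:~R) + kl.1%:R - kl.2%:R = - m - 1])
      shift n1 (exp_minus a kl.1 (exp_plus a kl.2 (lattice_vector b.1 b.2)))).

(* coefficient of z^(-m-1) in the normally ordered product
     : \prod_(j <- s) (1/j!) (d/dz)^j alpha(z)  Y(e^{a alpha}, z) :
   where (1/j!) (d/dz)^j alpha(z) = \sum_k C(-k-1, j) alpha(k) z^(-k-1-j) has
   its terms with k < 0 on the left and its terms with k >= 0 on the right *)
Fixpoint normal_mode (lam mu : rat) (n1 : int) (s : seq nat) (m : rat)
    (w : latspace) : latspace :=
  match s with
  | [::] => exp_mode lam mu n1 m w
  | j :: s' =>
      \sum_(k \in [set k : int | k < 0])
        gbinom ((- k - 1)%:~R : K) j *:
        heis (lam + mu) k (normal_mode lam mu n1 s' (m - k%:~R - j%:R - 1) w)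
      + \sum_(k \in [set k : int | 0 <= k])
        gbinom ((- k - 1)%:~R : K) j *:
        normal_mode lam mu n1 s' (m - k%:~R - j%:R - 1) (heis mu k w)
  end.

(* u_m w for u in V_{L + lam alpha} and w in V_{L + mu alpha}, a vector of
   V_{L + (lam + mu) alpha} *)
Definition lattice_mode (lam mu : rat) (u : latspace) (m : rat) (w : latspace)
    : latspace :=
  \sum_(b <- msupp u)
    mcoeff b u *: normal_mode lam mu b.1 (enum_mset b.2) m w.

Definition VL : vertexData R :=
  @VertexData R latspace (lattice_vector 0 mset0)
    (fun u n v => lattice_mode 0 0 u n%:~R v).

Definition omega : VL :=
  ((4 * p)%:R : K)^-1 *: heis 0 (-1) (heis 0 (-1) (vvac VL))
  + ((p%:R - 1) / (2 * p)%:R : K) *: heis 0 (-2) (vvac VL).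

(* Q~ = (e^{-alpha/p})_0 : V_L -> V_{L - alpha/p} *)
Definition Qtilde : VL -> latspace :=
  lattice_mode (- p%:R^-1) 0 (lattice_vector 0 mset0) 0.

Definition triplet : set VL := [set v | Qtilde v = 0].

(* exp (c alpha(0)) on V_L *)
Definition exp_alpha0 (c : K) : VL -> VL :=
  linext (fun b => cexp (c * alpha0 0 b.1) *: lattice_vector b.1 b.2).

(* tau = exp (pi i alpha(0) / (2p)) *)
Definition tau : VL -> VL := exp_alpha0 (0 +i* (pi / (2 * p)%:R)).

(* The V_L-action on R(j) = V_{L + mu alpha}, mu = (3p - j - 1/2) / (2p) *)
Definition Rj_weight (j : nat) : rat :=
  ((3 * p)%:R - j%:R - 2^-1) / (2 * p)%:R.

Definition Rj (j : nat) : VL -> rat -> latspace -> latspace :=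
  lattice_mode 0 (Rj_weight j).

End Lattice.

Arguments VL R p : clear implicits.
Arguments omega R p : clear implicits.
Arguments triplet R p _ : clear implicits.
Arguments tau R p _ : clear implicits.
Arguments Rj R p j _ _ _ : clear implicits.

(* Main.v *)
(* Conjugating by sigma reduces everything to tau, which acts on
   e^{n alpha} by (-1)^n, so it suffices to prove the Jacobi identity for V_L
   acting on V_{L + mu alpha}, where 2p mu lies in 1/2 + Z; the vectors of
   parity r then have modes in r/2 + Z. Let J_l(u, v) be the coefficient
   identities with a fixed exponent l.
   - Both sides of J_l(u, v) transform in the same way when a creation operator
     is applied to u, to v or to the vector w acted upon, so one may take
     u, v, w to be the exponentials e^{n1 alpha}, e^{n2 alpha},
     e^{(mu + n3) alpha}.
   - For l = - <u, v> - 1 the left side is a single mode of e^{(n1+n2) alpha},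
     and the identity says that the exponential series of
     (n1 + n2) alpha is the product of those of n1 alpha and n2 alpha.
   - J_l implies J_{l+1} by the Pascal rule, and J_{l-1} by covariance under
     translation (L(-1) e^{n alpha} = n alpha(-1) e^{n alpha}), where the factor
     <u, v> + l to be divided by is nonzero for l < - <u, v>.
   Finally e^{-alpha} lies in Ker Q~, because <-alpha/p, -alpha> = 2, and is
   negated by tau, so that the order is exactly two. *)

From HB Require Import structures.
From mathcomp Require Import all_boot all_order all_algebra finmap multiset.
From mathcomp Require Import all_classical all_reals all_analysis.
From mathcomp Require Import complex.
From mathcomp Require Import -(notations) monalg.
Require Import Defs.
From mathcomp Require Import ring lra zify.

Set Implicit Arguments.
Unset Strict Implicit.
Unset Printing Implicit Defensive.

Import Order.TTheory GRing.Theory Num.Theory.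
Local Open Scope classical_set_scope.
Local Open Scope ring_scope.

(** * Finitely supported sums and double sequences of modes *)

Section FiniteSums.
Variable M : zmodType.
Implicit Types F G : nat -> M.

Definition fin_supp F := exists N, forall i, (N <= i)%N -> F i = 0.
Definition fin_supp2 (F : nat -> nat -> M) :=
  exists N, forall i j, (N <= i)%N || (N <= j)%N -> F i j = 0.
Definition ssum F : M := \sum_(i \in [set: nat]) F i.

Lemma ssumE F N : (forall i, (N <= i)%N -> F i = 0) ->
  ssum F = \sum_(i < N) F i.
Proof.
move=> H; rewrite -(big_mkord xpredT F).
have -> : index_iota 0 N = iota 0 N by rewrite /index_iota subn0.
rewrite /ssum (fsbigE (iota 0 N)) ?iota_uniq//.
  by apply: eq_bigl => i; apply/mem_set.
by move=> i _; rewrite mem_iota add0n /= -leqNgt => /H.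
Qed.

Lemma eq_ssum F G : F =1 G -> ssum F = ssum G.
Proof. by move=> /funext->. Qed.

Lemma ssum0 : ssum (fun=> 0) = 0.
Proof. by rewrite (@ssumE _ 0) ?big_ord0. Qed.

Lemma ssumD F G : fin_supp F -> fin_supp G ->
  ssum (fun i => F i + G i) = ssum F + ssum G.
Proof.
move=> [N HN] [P HP].
rewrite !(@ssumE _ (maxn N P)) -?big_split //= => i; rewrite geq_max => /andP[??];
by rewrite ?HN ?HP ?addr0.
Qed.

Lemma fin_suppD F G : fin_supp F -> fin_supp G -> fin_supp (fun i => F i + G i).
Proof.
move=> [N HN] [P HP]; exists (maxn N P) => i.
by rewrite geq_max => /andP[??]; rewrite HN ?HP ?addr0.
Qed.

Lemma ssum_fs2 (F : nat -> nat -> M) N :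
  (forall i j, (N <= i)%N || (N <= j)%N -> F i j = 0) ->
  ssum (fun i => ssum (F i)) = \sum_(i < N) \sum_(j < N) F i j.
Proof.
move=> H; rewrite (@ssumE _ N); last first.
  by move=> i Hi; rewrite (@ssumE _ 0) ?big_ord0// => j _; rewrite H ?Hi.
by apply: eq_bigr => i _; rewrite (@ssumE _ N)// => j Hj; rewrite H ?Hj ?orbT.
Qed.

Lemma exchange_ssum (F : nat -> nat -> M) : fin_supp2 F ->
  ssum (fun i => ssum (F i)) = ssum (fun j => ssum (F ^~ j)).
Proof.
move=> [N H]; rewrite !(@ssum_fs2 _ N)//; first exact: exchange_big.
by move=> i j; rewrite orbC; apply: H.
Qed.

Lemma fin_supp2I (F : nat -> nat -> M) :
  (exists N, forall i j, (N <= i)%N -> F i j = 0) ->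
  (forall i, fin_supp (F i)) -> fin_supp2 F.
Proof.
move=> [N HN] H; have [B HB] := boolp.choice H.
exists (maxn N (\max_(i < N) B i)) => i j.
have [/HN-> //|iN] := leqP N i.
case/orP; rewrite geq_max => /andP[H1 H2]; first by rewrite HN.
by apply: HB; apply: leq_trans H2; rewrite (bigD1 (Ordinal iN)) //= leq_maxl.
Qed.

Lemma fin_supp2_sym (F : nat -> nat -> M) : fin_supp2 F ->
  fin_supp2 (fun j i => F i j).
Proof. by move=> [N H]; exists N => i j; rewrite orbC; apply: H. Qed.

Lemma fin_supp_ssum (F : nat -> nat -> M) : fin_supp2 F ->
  fin_supp (fun i => ssum (F i)).
Proof.
move=> [N H]; exists N => i Hi.
by rewrite (@ssumE _ 0) ?big_ord0// => j _; rewrite H ?Hi.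
Qed.

Lemma ssum_diag (F : nat -> nat -> M) : fin_supp2 F ->
  ssum (fun i => ssum (F i)) = ssum (fun k => \sum_(i < k.+1) F i (k - i)%N).
Proof.
move=> [N H]; rewrite (@ssum_fs2 _ N)// (@ssumE _ (N + N)%N); last first.
  move=> i Hi; rewrite big1// => k _; apply: H.
  by have [//|] := leqP N k => /= Hk; lia.
have Hw (P : nat) i : (N <= P)%N -> \sum_(j < N) F i j = \sum_(j < P) F i j.
  move=> HP; rewrite (big_ord_widen P (F i) HP) big_mkcond/=.
  by apply: eq_bigr => j _; case: ltnP => // Hj; rewrite H ?Hj ?orbT.
under [RHS]eq_bigr => k _.
  rewrite (big_ord_widen (N + N)%N (fun i => F i (k - i)%N)) ?big_mkcond//=; over.
rewrite [RHS]exchange_big/= [RHS](bigID (fun i : 'I__ => (i < N)%N))/= [X in _ + X]big1 ?addr0.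
  rewrite (big_ord_widen (N + N)%N (fun i => \sum_(j < N) F i j)); last lia.
  apply: eq_bigr => i Hi; rewrite (Hw (N + N - i)%N); last lia.
  have HN : (N + N = i + (N + N - i))%N by lia.
  rewrite -(big_mkord xpredT (fun k => if (i < k.+1)%N then F i (k - i)%N else 0)).
  rewrite (@big_cat_nat _ _ _ i)//=; last lia.
  rewrite big_nat [X in _ = X + _]big1 ?add0r; last by move=> k Hk; case: ifP => //; lia.
  rewrite -[in RHS](add0n (i : nat)) big_addn big_mkord.
  by apply: eq_bigr => j _; rewrite ltnS leq_addl addnK.
move=> i Hi; rewrite big1// => k _; case: ifP => // _; apply: H; lia.
Qed.

Lemma ssum_shift s F : (forall i, (i < s)%N -> F i = 0) -> fin_supp F ->
  ssum F = ssum (fun i => F (s + i)%N).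
Proof.
move=> H [N HN]; rewrite (@ssumE _ (s + N)%N) ?(@ssumE _ N).
- by rewrite big_split_ord/= big1 ?add0r// => i _; rewrite H.
- by move=> i Hi; apply: HN; lia.
- by move=> i Hi; apply: HN; lia.
Qed.

Lemma ssum1 s F : (forall i, i != s -> F i = 0) -> ssum F = F s.
Proof.
move=> H; rewrite (@ssumE _ s.+1); last by move=> i Hi; rewrite H//; lia.
rewrite big_ord_recr/= big1 ?add0r// => i _; apply: H.
by have := ltn_ord i; lia.
Qed.

Lemma fin_supp_sub F G : fin_supp F -> (forall i, F i = 0 -> G i = 0) ->
  fin_supp G.
Proof. by move=> [N H] HG; exists N => i /H /HG. Qed.

End FiniteSums.

Lemma fin_supp2_sub (M M' : zmodType) (F : nat -> nat -> M) (G : nat -> nat -> M') :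
  fin_supp2 F -> (forall i j, F i j = 0 -> G i j = 0) -> fin_supp2 G.
Proof. by move=> [N H] HG; exists N => i j /H /HG. Qed.

Section FiniteSumsLinear.
Variables (K : nzRingType) (M M' : lmodType K).

Lemma linear_ssum (T : {linear M -> M'}) (F : nat -> M) : fin_supp F ->
  T (ssum F) = ssum (fun i => T (F i)).
Proof.
move=> [N H]; rewrite !(@ssumE _ _ N) ?linear_sum//.
by move=> i Hi; rewrite H ?linear0.
Qed.

Lemma scaler_ssum c (F : nat -> M) : fin_supp F ->
  c *: ssum F = ssum (fun i => c *: F i).
Proof.
move=> [N H]; rewrite !(@ssumE _ _ N) ?scaler_sumr//.
by move=> i Hi; rewrite H ?scaler0.
Qed.

Lemma fin_suppZ (c : nat -> K) (F : nat -> M) : fin_supp F ->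
  fin_supp (fun i => c i *: F i).
Proof. by move=> [N H]; exists N => i /H->; rewrite scaler0. Qed.

End FiniteSumsLinear.

Section Binomial.
Variable K : numFieldType.
Implicit Types x y : K.

Lemma gbinom0 x : gbinom x 0 = 1.
Proof. by rewrite /gbinom big_ord0 fact0 divr1. Qed.

Lemma gbinomS x i : i.+1%:R * gbinom x i.+1 = (x - i%:R) * gbinom x i.
Proof.
rewrite /gbinom big_ord_recr/= factS natrM; field.
by rewrite nat1r !pnatr_eq0 -lt0n fact_gt0.
Qed.

Lemma gbinomSl x i : i.+1%:R * gbinom x i.+1 = x * gbinom (x - 1) i.
Proof.
rewrite /gbinom big_ord_recl/= subr0 factS natrM.
under eq_bigr do rewrite /bump/= natrD opprD addrA.
by field; rewrite nat1r !pnatr_eq0 -lt0n fact_gt0.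
Qed.

Lemma gbinom_nat (n k : nat) : gbinom (n%:R : K) k = 'C(n, k)%:R.
Proof.
elim: k => [|k IH]; first by rewrite gbinom0 bin0.
have Sk : k.+1%:R != 0 :> K by rewrite pnatr_eq0.
apply: (mulfI Sk); rewrite gbinomS IH -natrM mul_bin_left natrM.
have [kn|kn] := leqP k n; first by rewrite natrB.
by rewrite bin_small ?mulr0.
Qed.

Lemma gbinom_neg (n k : nat) : gbinom (- n%:R - 1 : K) k = (-1) ^+ k * 'C(n + k, k)%:R.
Proof.
elim: k => [|k IH]; first by rewrite gbinom0 bin0 mul1r.
have Sk : k.+1%:R != 0 :> K by rewrite pnatr_eq0.
apply: (mulfI Sk); rewrite gbinomS IH exprS.
have -> : k.+1%:R * (-1 * (-1) ^+ k * 'C(n + k.+1, k.+1)%:R) =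
   - ((-1) ^+ k * (k.+1 * 'C(n + k.+1, k.+1))%:R) :> K by rewrite natrM; ring.
by rewrite addnS -mul_bin_diag natrM /= -addn1 !natrD; ring.
Qed.

Lemma gbinom_addl x y k :
  \sum_(i < k.+1) gbinom x i * gbinom y (k - i) = gbinom (x + y) k.
Proof.
elim: k => [|k IH]; first by rewrite big_ord1 !gbinom0 mul1r.
have Sk : k.+1%:R != 0 :> K by rewrite pnatr_eq0.
apply: (mulfI Sk); rewrite gbinomS -IH mulr_sumr.
have -> : \sum_(i < k.+2) k.+1%:R * (gbinom x i * gbinom y (k.+1 - i)) =
   \sum_(i < k.+2) i%:R * gbinom x i * gbinom y (k.+1 - i) +
   \sum_(i < k.+2) gbinom x i * ((k.+1 - i)%:R * gbinom y (k.+1 - i)).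
  rewrite -big_split/=; apply: eq_bigr => i _.
  by rewrite natrB -1?ltnS//; ring.
rewrite big_ord_recl/= 2!mul0r add0r [X in _ + X]big_ord_recr/= subnn !mul0r mulr0 addr0.
rewrite -big_split/= mulr_sumr; apply: eq_bigr => i _.
rewrite /bump/= add1n subSS gbinomS subSn -1?ltnS// gbinomS natrB -1?ltnS//; ring.
Qed.

End Binomial.

Lemma ratr_gbinom (K : numFieldType) (x : rat) i :
  ratr (gbinom x i) = gbinom (ratr x : K) i.
Proof.
rewrite /gbinom fmorph_div rmorph_prod/= ratr_nat; congr (_ / _).
by apply: eq_bigr => k _; rewrite rmorphB/= ratr_nat.
Qed.

Section DoubleModes.
Variables (K : numFieldType) (M : lmodType K).
Implicit Types (f g : rat -> rat -> M) (a b x y : rat) (e : K).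

Definition truncated f := exists B, forall a b, B <= b -> f a b = 0.

(* With e = -1, the coefficients of (z1 - z2)^x times the series with
   coefficients f, expanded in nonnegative powers of z2. *)
Definition dsum (e : K) (x : rat) f (a b : rat) : M :=
  ssum (fun i => (e ^+ i * gbinom (ratr x) i) *: f (a + x - i%:R) (b + i%:R)).

Lemma rat_arch (B b : rat) : exists N : nat, forall i, (N <= i)%N -> B <= b + i%:R.
Proof.
exists (Num.bound `|B - b|) => i Hi.
rewrite -lerBlDl; apply: le_trans (ler_norm _) _.
apply: le_trans (ltW (archi_boundP (normr_ge0 _))) _.
by rewrite ler_nat.
Qed.

Lemma truncated_fin_suppZ (c : nat -> K) f (a' : nat -> rat) b : truncated f ->
  fin_supp (fun i => c i *: f (a' i) (b + i%:R)).
Proof.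
move=> [B H]; have [N HN] := rat_arch B b.
by exists N => i /HN /H->; rewrite scaler0.
Qed.

Lemma eq_dsum e x f g a b : (forall a b, f a b = g a b) -> dsum e x f a b = dsum e x g a b.
Proof. by move=> H; apply: eq_ssum => i; rewrite H. Qed.

Lemma dsum0 e x a b : dsum e x (fun _ _ => 0) a b = 0.
Proof. by rewrite /dsum -[RHS](ssum0 M); apply: eq_ssum => i; rewrite scaler0. Qed.

Lemma truncated_dsum e x f : truncated f -> truncated (dsum e x f).
Proof.
move=> [B H]; exists B => a b Hb; rewrite /dsum -[RHS](ssum0 M).
apply: eq_ssum => i; rewrite H ?scaler0//.
by apply: le_trans Hb _; rewrite lerDl.
Qed.

Lemma dsumD e x f g a b : truncated f -> truncated g ->
  dsum e x (fun a b => f a b + g a b) a b = dsum e x f a b + dsum e x g a b.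
Proof.
move=> Hf Hg; rewrite /dsum -ssumD; try exact: truncated_fin_suppZ.
by apply: eq_ssum => i; rewrite scalerDr.
Qed.

Lemma truncatedD f g : truncated f -> truncated g -> truncated (fun a b => f a b + g a b).
Proof.
move=> [B H] [B' H']; exists (Num.max B B') => a b.
by rewrite ge_max => /andP[??]; rewrite H ?H' ?addr0.
Qed.

Lemma truncatedZ c f : truncated f -> truncated (fun a b => c *: f a b).
Proof. by move=> [B H]; exists B => a b Hb; rewrite H ?scaler0. Qed.

Lemma dsumZ e x c f a b : truncated f ->
  dsum e x (fun a b => c *: f a b) a b = c *: dsum e x f a b.
Proof.
move=> Hf; rewrite /dsum scaler_ssum; last exact: truncated_fin_suppZ.
by apply: eq_ssum => i; rewrite !scalerA mulrC.
Qed.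

Lemma dsum_comp e x y f a b : truncated f ->
  dsum e x (dsum e y f) a b = dsum e (x + y) f a b.
Proof.
move=> Hf; rewrite /dsum.
have Hs i := @truncated_fin_suppZ (fun j => e ^+ j * gbinom (ratr y) j) f
  (fun j => a + x - i%:R + y - j%:R) (b + i%:R) Hf.
under eq_ssum => i do rewrite scaler_ssum//.
rewrite ssum_diag; last first.
  apply: fin_supp2I; last by move=> i; apply: fin_suppZ.
  case: Hf => B H; have [N HN] := rat_arch B b.
  exists N => i j Hi; rewrite H ?scaler0//.
  by apply: le_trans (HN _ Hi) _; rewrite lerDl.
apply: eq_ssum => k; rewrite rmorphD/= -gbinom_addl mulr_sumr scaler_suml.
apply: eq_bigr => i _; have ik : (i <= k)%N by rewrite -ltnS.
rewrite scalerA; congr (_ *: f _ _).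
- by rewrite mulrACA -exprD subnKC.
- by rewrite natrB//; ring.
- by rewrite natrB//; ring.
Qed.

End DoubleModes.

Section BinomialIdentities.
Variable K : numFieldType.

Lemma gbinom_small (n k : nat) : (n < k)%N -> gbinom (n%:R : K) k = 0.
Proof. by move=> nk; rewrite gbinom_nat bin_small. Qed.

Lemma gbinom_trinom (y : K) (j i : nat) :
  gbinom (j + i)%:R j * gbinom y (j + i) = gbinom y j * gbinom (y - j%:R) i.
Proof.
elim: i => [|i IH]; first by rewrite addn0 gbinom_nat binn gbinom0 mulr1 mul1r.
have Sk : i.+1%:R != 0 :> K by rewrite pnatr_eq0.
apply: (mulfI Sk); rewrite [RHS]mulrCA gbinomS.
transitivity ((y - j%:R - i%:R) * (gbinom y j * gbinom (y - j%:R) i)); last by ring.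
rewrite -IH !gbinom_nat.
have -> : i.+1%:R * ('C(j + i.+1, j)%:R * gbinom y (j + i.+1)) =
  'C(j + i, j)%:R * ((j + i).+1%:R * gbinom y (j + i).+1).
  rewrite addnS mulrA -natrM [RHS]mulrA -natrM; congr (_%:R * _).
  have := mul_bin_down (j + i).+1 j.
  by rewrite subSn ?leq_addr// addKn /= => <-; rewrite mulnC.
by rewrite gbinomS natrD; ring.
Qed.

Lemma gbinom_contract (s i j : nat) :
  gbinom (- (s + i)%:R - 1 : K) j * gbinom (s + i)%:R s =
  (-1) ^+ j * gbinom (s + j)%:R j * ((-1) ^+ i * gbinom (- s%:R - j%:R - 1) i).
Proof.
have -> : - s%:R - j%:R - 1 = - (s + j)%:R - 1 :> K by rewrite natrD; ring.
rewrite !gbinom_neg !gbinom_nat.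
transitivity ((-1) ^+ j * ('C(s + i + j, j) * 'C(s + i, s))%N%:R : K).
  by rewrite natrM mulrA.
transitivity ((-1) ^+ j * ('C(s + j, j) * 'C(s + j + i, i))%N%:R : K); last first.
  rewrite natrM [X in _ = _ * X]mulrA -expr2 sqrr_sign; ring.
congr (_ * _%:R).
apply/eqP; rewrite -(eqn_pmul2r (fact_gt0 s)) -(eqn_pmul2r (fact_gt0 i)) -(eqn_pmul2r (fact_gt0 j)).
have E n k : ('C(n + k, k) * (k`! * n`!) = (n + k)`!)%N.
  by have := @bin_fact (n + k) k (leq_addl _ _); rewrite addnK.
have E' n k : ('C(n + k, n) * (k`! * n`!) = (n + k)`!)%N.
  by have := E k n; rewrite addnC [(n`! * _)%N]mulnC.
have H1 := E (s + i)%N j; have H2 := E (s + j)%N i; have H3 := E' s i; have H4 := E s j.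
apply/eqP; transitivity ((s + i + j)`!).
  by rewrite -H1 -H3; ring.
by rewrite addnAC -H2 -H4; ring.
Qed.
End BinomialIdentities.

Section DoubleModeSums.
Variables (K : numFieldType) (M : lmodType K).
Implicit Types (a b x : rat) (e : K).

Definition truncated_family (F : nat -> rat -> rat -> M) :=
  exists B, forall t a b, B <= b -> F t a b = 0.

Lemma truncated_familyI (F : nat -> rat -> rat -> M) :
  (exists N, forall t a b, (N <= t)%N -> F t a b = 0) ->
  (forall t, truncated (F t)) -> truncated_family F.
Proof.
move=> [N HN] H; have [B HB] := boolp.choice H.
exists (\sum_(t < N) `|B t|) => t a b.
have [/HN->//|tN Hb] := leqP N t; apply: HB; apply: le_trans Hb.
rewrite (bigD1 (Ordinal tN))//=; apply: le_trans (ler_norm _) _.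
by rewrite lerDl sumr_ge0.
Qed.

Lemma truncated_ssum (F : nat -> rat -> rat -> M) :
  truncated_family F -> truncated (fun a b => ssum (fun t => F t a b)).
Proof.
move=> [B H]; exists B => a b Hb; rewrite -[RHS](ssum0 M).
by apply: eq_ssum => t; apply: H.
Qed.

Lemma dsum_family_fin_supp2 e x (F : nat -> rat -> rat -> M) a b :
  truncated_family F -> (forall a b, fin_supp (fun t => F t a b)) ->
  fin_supp2 (fun i t => (e ^+ i * gbinom (ratr x : K) i) *:
                        F t (a + x - i%:R) (b + i%:R)).
Proof.
move=> [B H] HF; apply: fin_supp2I.
  by have [N HN] := rat_arch B b; exists N => i t /HN /H->; rewrite scaler0.
by move=> i; apply: fin_suppZ.
Qed.

Lemma dsum_fin_supp e x (F : nat -> rat -> rat -> M) a b :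
  truncated_family F -> (forall a b, fin_supp (fun t => F t a b)) ->
  fin_supp (fun t => dsum e x (F t) a b).
Proof.
by move=> *; apply/fin_supp_ssum/fin_supp2_sym/dsum_family_fin_supp2.
Qed.

Lemma dsum_ssum e x (F : nat -> rat -> rat -> M) a b :
  truncated_family F -> (forall a b, fin_supp (fun t => F t a b)) ->
  dsum e x (fun a b => ssum (fun t => F t a b)) a b
  = ssum (fun t => dsum e x (F t) a b).
Proof.
move=> HB HF; rewrite [RHS]exchange_ssum; last first.
  exact/fin_supp2_sym/dsum_family_fin_supp2.
by apply: eq_ssum => i; rewrite scaler_ssum.
Qed.

Lemma linear_dsum (M' : lmodType K) (T : {linear M -> M'}) e x f a b :
  truncated f -> T (dsum e x f a b) = dsum e x (fun a b => T (f a b)) a b.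
Proof.
move=> Hf; rewrite linear_ssum; last exact: truncated_fin_suppZ.
by apply: eq_ssum => i; rewrite linearZ.
Qed.

End DoubleModeSums.

(** * Jacobi identity for fields covariant under a Heisenberg algebra *)

Section HeisenbergFields.
Variables (K : numFieldType) (V M : lmodType K).
Variables (a0 : int -> {linear V -> V}) (a : int -> {linear M -> M}).
Variable Y : V -> rat -> {linear M -> M}.

Record heisenberg_fields : Prop := HeisenbergFields {
  fieldsP : forall c u v m w, Y (c *: u + v) m w = c *: Y u m w + Y v m w;
  fields_trunc : forall u w, exists B, forall m, B <= m -> Y u m w = 0;
  heis_nil : forall w, exists N, forall k, (N <= k)%N -> a (Posz k) w = 0;
  fields_comm : forall k u m w, a k (Y u m w) = Y u m (a k w) +
    ssum (fun s => gbinom (k%:~R : K) s *: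
                   Y (a0 (Posz s) u) (m + k%:~R - s%:R) w);
  fields_normal : forall j u m w, Y (a0 (Negz j) u) m w =
    ssum (fun t => gbinom (t%:R : K) j *: a (Negz t) (Y u (m + t%:R - j%:R) w))
    + ssum (fun k => gbinom (- k%:R - 1 : K) j *:
                     Y u (m - k%:R - j%:R - 1) (a (Posz k) w)) }.

Hypothesis H : heisenberg_fields.

Lemma fields0 m w : Y 0 m w = 0.
Proof.
have := fieldsP H 1 0 0 m w; rewrite !scale1r addr0 => /esym/eqP.
by rewrite -subr_eq0 addrK => /eqP.
Qed.

Lemma fieldsZ c u m w : Y (c *: u) m w = c *: Y u m w.
Proof. by have := fieldsP H c u 0 m w; rewrite addr0 fields0 addr0. Qed.

Lemma fieldsD u v m w : Y (u + v) m w = Y u m w + Y v m w.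
Proof. by have := fieldsP H 1 u v m w; rewrite !scale1r. Qed.

Lemma fields_ssum (F : nat -> V) m w : fin_supp F ->
  Y (ssum F) m w = ssum (fun i => Y (F i) m w).
Proof.
move=> [N HN]; rewrite !(@ssumE _ _ N)//; last by move=> i /HN->; rewrite fields0.
elim: (N) => [|n IH]; first by rewrite !big_ord0 fields0.
by rewrite !big_ord_recr/= fieldsD IH.
Qed.

Lemma fields_fin_supp u w (f : nat -> rat) b : (forall i, f i = b + i%:R) ->
  fin_supp (fun i => Y u (f i) w).
Proof.
move=> Hf; have [B HB] := fields_trunc H u w; have [N HN] := rat_arch B b.
by exists N => i /HN Hi; apply: HB; rewrite Hf.
Qed.

End HeisenbergFields.

Section Jacobi.
Variables (K : numFieldType) (V M : lmodType K).
Variables (a0 : int -> {linear V -> V}) (a : int -> {linear M -> M}).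
Variables (Y0 : V -> rat -> {linear V -> V}) (Y : V -> rat -> {linear M -> M}).
Hypothesis H0 : heisenberg_fields a0 a0 Y0.
Hypothesis H : heisenberg_fields a0 a Y.

Definition iter_modes u v w q x := Y (Y0 u x v) q w.
Definition prod_modes u v w x y := Y u x (Y v y w).

Definition jacobi_lhs u (l : int) m n v w : M :=
  dsum 1 m (iter_modes u v w) n l%:~R.
Definition jacobi_rhs u (l : int) m n v w : M :=
  dsum (-1) l%:~R (prod_modes u v w) m n
  - (-1) ^ l *: dsum (-1) l%:~R (prod_modes v u w) n m.
Definition jacobi u l m n v w := jacobi_lhs u l m n v w = jacobi_rhs u l m n v w.

Lemma truncated_prod u v w : truncated (prod_modes u v w).
Proof.
have [B HB] := fields_trunc H v w; exists B => x y Hy.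
by rewrite /prod_modes HB// linear0.
Qed.

Lemma truncated_iter u v w : truncated (iter_modes u v w).
Proof.
have [B HB] := fields_trunc H0 u v; exists B => x y Hy.
by rewrite /iter_modes HB// (fields0 H).
Qed.

Lemma iter_modes_normal j u v w q x :
  iter_modes (a0 (Negz j) u) v w q x =
  ssum (fun t => gbinom (t%:R : K) j *:
    a (Negz t) (dsum 1 (t%:R - j%:R) (iter_modes u v w) q x))
  + ssum (fun k => gbinom (- k%:R - 1 : K) j *:
      dsum 1 (- k%:R - j%:R - 1) (iter_modes u v (a (Posz k) w)) q x)
  + ssum (fun s => ((-1) ^+ j * gbinom (s + j)%:R j) *:
      iter_modes u (a0 (Posz s) v) w q (x - s%:R - j%:R - 1)).
Proof.
have [S0 HS0] := heis_nil H0 v.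
have fsA : fin_supp (fun t => gbinom (t%:R : K) j *:
    a0 (Negz t) (Y0 u (x + t%:R - j%:R) v)).
  apply: fin_suppZ; apply: fin_supp_sub
    (fields_fin_supp H0 u v (b := x - j%:R) (f := fun t => x + t%:R - j%:R) _) _.
    by move=> i; ring.
  by move=> i ->; rewrite linear0.
have fsB : fin_supp (fun s => gbinom (- s%:R - 1 : K) j *:
    Y0 u (x - s%:R - j%:R - 1) (a0 (Posz s) v)).
  by exists S0 => s /HS0->; rewrite linear0 scaler0.
rewrite {1}/iter_modes (fields_normal H0) (fieldsD H) !(fields_ssum H)//.
congr (_ + _); last first.
  apply: eq_ssum => s; rewrite (fieldsZ H); congr (_ *: _).
  by rewrite gbinom_neg gbinom_nat.
under eq_ssum => t do rewrite (fieldsZ H) (fields_normal H) scalerDr.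
have Htrunc := truncated_iter u v w.
have fs2A : fin_supp2 (fun t y => gbinom (t%:R : K) j *: (gbinom y%:R t *:
    a (Negz y) (iter_modes u v w (q + y%:R - t%:R) (x + t%:R - j%:R)))).
  apply: fin_supp2I.
    case: Htrunc => B HB; have [N HN] := rat_arch B (x - j%:R).
    exists N => t y /HN Ht; rewrite HB ?linear0 ?scaler0//.
    by rewrite addrAC.
  move=> t; apply/fin_suppZ/fin_suppZ.
  apply: fin_supp_sub (fields_fin_supp H (Y0 u (x + t%:R - j%:R) v) w
    (b := q - t%:R) (f := fun y => q + y%:R - t%:R) _) _.
    by move=> i; ring.
  by move=> i Hi; rewrite /iter_modes Hi linear0.
have fs2B : fin_supp2 (fun t k => gbinom (t%:R : K) j *:
    (gbinom (- k%:R - 1) t *: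
    iter_modes u v (a (Posz k) w) (q - k%:R - t%:R - 1) (x + t%:R - j%:R))).
  apply: fin_supp2I.
    have [B HB] := fields_trunc H0 u v; have [N HN] := rat_arch B (x - j%:R).
    exists N => t y /HN Ht; rewrite /iter_modes HB ?(fields0 H) ?scaler0//.
    by rewrite addrAC.
  move=> t; have [N HN] := heis_nil H w.
  by exists N => k /HN->; rewrite /iter_modes linear0 !scaler0.
have E1 : forall t, gbinom (t%:R : K) j *: ssum (fun y => gbinom y%:R t *:
    a (Negz y) (Y (Y0 u (x + t%:R - j%:R) v) (q + y%:R - t%:R) w)) =
  ssum (fun y => gbinom (t%:R : K) j *: (gbinom y%:R t *:
    a (Negz y) (iter_modes u v w (q + y%:R - t%:R) (x + t%:R - j%:R)))).
  move=> t; rewrite scaler_ssum//; apply: fin_suppZ.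
  apply: fin_supp_sub (fields_fin_supp H (Y0 u (x + t%:R - j%:R) v) w
    (b := q - t%:R) (f := fun y => q + y%:R - t%:R) _) _.
    by move=> i; ring.
  by move=> i ->; rewrite linear0.
have E2 : forall t, gbinom (t%:R : K) j *: ssum (fun k => gbinom (- k%:R - 1) t *:
    Y (Y0 u (x + t%:R - j%:R) v) (q - k%:R - t%:R - 1) (a (Posz k) w)) =
  ssum (fun k => gbinom (t%:R : K) j *: (gbinom (- k%:R - 1) t *:
    iter_modes u v (a (Posz k) w) (q - k%:R - t%:R - 1) (x + t%:R - j%:R))).
  move=> t; rewrite scaler_ssum//; apply: fin_suppZ.
  have [N HN] := heis_nil H w.
  by exists N => k /HN->; rewrite linear0.
under eq_ssum => t do rewrite E1 E2.
rewrite ssumD; try exact: fin_supp_ssum.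
rewrite exchange_ssum// [X in _ + X]exchange_ssum//.
congr (_ + _); apply: eq_ssum => y.
  rewrite linear_dsum//.
  rewrite (ssum_shift (s := j)); first last.
  - by case: fs2A => N HN; exists N => t Ht; apply: HN; rewrite Ht.
  - by move=> t Ht; rewrite gbinom_small// scale0r.
  rewrite scaler_ssum; last first.
    apply: (@truncated_fin_suppZ _ _ _ (fun x y' => a (Negz y) (iter_modes u v w x y'))).
    by case: Htrunc => B HB; exists B => *; rewrite HB ?linear0.
  apply: eq_ssum => i; rewrite !scalerA gbinom_trinom expr1n mul1r.
  rewrite rmorphB/= !ratr_nat; congr (_ *: a _ (iter_modes _ _ _ _ _)).
    by rewrite natrD; ring.
  by rewrite natrD; ring.
rewrite (ssum_shift (s := j)); first last.
- by case: fs2B => N HN; exists N => t Ht; apply: HN; rewrite Ht.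
- by move=> t Ht; rewrite gbinom_small// scale0r.
rewrite scaler_ssum; last exact/truncated_fin_suppZ/truncated_iter.
apply: eq_ssum => i; rewrite !scalerA gbinom_trinom expr1n mul1r.
rewrite !rmorphB/= rmorphN/= !ratr_nat rmorph1.
congr (_ * gbinom _ _ *: (iter_modes _ _ _ _ _)).
- by ring.
- by rewrite natrD; ring.
- by rewrite natrD; ring.
Qed.

Lemma prod_modes_normal_l j u v w x y :
  prod_modes (a0 (Negz j) u) v w x y =
  ssum (fun t => gbinom (t%:R : K) j *:
    a (Negz t) (prod_modes u v w (x + t%:R - j%:R) y))
  + ssum (fun k => gbinom (- k%:R - 1 : K) j *:
      prod_modes u v (a (Posz k) w) (x - k%:R - j%:R - 1) y)
  + ssum (fun s => ((-1) ^+ j * gbinom (s + j)%:R j) *: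
      dsum (-1) (- s%:R - j%:R - 1) (prod_modes u (a0 (Posz s) v) w) x y).
Proof.
have [N HN] := heis_nil H w; have [N' HN'] := heis_nil H (Y v y w).
have [S0 HS0] := heis_nil H0 v.
have fsN (s : nat) : fin_supp (fun k : nat => gbinom (k%:R : K) s *:
    Y (a0 s v) (y + k%:R - s%:R) w).
  apply/fin_suppZ/(fields_fin_supp H _ _ (b := y - s%:R)) => k; ring.
have fs2 : fin_supp2 (fun k s : nat => gbinom (- k%:R - 1 : K) j *:
    (gbinom (k%:R : K) s *: prod_modes u (a0 s v) w
      (x - k%:R - j%:R - 1) (y + k%:R - s%:R))).
  apply/fin_supp2_sym/fin_supp2I.
    exists S0 => s k /HS0 Hs.
    by rewrite /prod_modes Hs (fields0 H) linear0 !scaler0.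
  move=> s; case: (fsN s) => P HP; exists P => k /HP.
  by rewrite /prod_modes => HE; rewrite -[X in _ *: X]linearZ HE linear0 scaler0.
have E k : gbinom (- k%:R - 1 : K) j *:
    Y u (x - k%:R - j%:R - 1) (a (Posz k) (Y v y w)) =
    gbinom (- k%:R - 1 : K) j *:
      prod_modes u v (a (Posz k) w) (x - k%:R - j%:R - 1) y +
    ssum (fun s => gbinom (- k%:R - 1 : K) j *:
    (gbinom (k%:R : K) s *: prod_modes u (a0 (Posz s) v) w
      (x - k%:R - j%:R - 1) (y + k%:R - s%:R))).
  have fs1 : fin_supp (fun s : nat => gbinom (k%:R : K) s *:
      Y (a0 s v) (y + k%:R - s%:R) w).
    by exists S0 => s /HS0->; rewrite (fields0 H) scaler0.
  rewrite (fields_comm H) linearD scalerDr; congr (_ + _).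
  rewrite linear_ssum// scaler_ssum; last first.
    by apply: fin_supp_sub fs1 _ => s ->; rewrite linear0.
  by apply: eq_ssum => s; rewrite linearZ.
rewrite {1}/prod_modes (fields_normal H); under [X in _ + X]eq_ssum => k do rewrite E.
rewrite ssumD; first last.
- exact: fin_supp_ssum.
- by exists N => k /HN->; rewrite /prod_modes !linear0 ?scaler0.
rewrite addrA; congr (_ + _ + _).
rewrite exchange_ssum//; apply: eq_ssum => s.
rewrite (ssum_shift (s := s)); first last.
- by case: fs2 => P HP; exists P => k Hk; apply: HP; rewrite Hk.
- by move=> k Hk; rewrite gbinom_small// scale0r scaler0.
rewrite scaler_ssum; last exact/truncated_fin_suppZ/truncated_prod.
apply: eq_ssum => i; rewrite !scalerA gbinom_contract !rmorphB/= rmorphN/= !ratr_nat rmorph1.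
by congr (_ *: prod_modes _ _ _ _ _); rewrite natrD; ring.
Qed.

Lemma intr_Negz (F : nzRingType) t : (Negz t)%:~R = - t%:R - 1 :> F.
Proof. by rewrite -[LHS]/(- t.+1%:R) -addn1 natrD opprD. Qed.
Lemma prod_modes_normal_r j u v w x y :
  prod_modes v (a0 (Negz j) u) w y x =
  ssum (fun t => gbinom (t%:R : K) j *:
    a (Negz t) (prod_modes v u w y (x + t%:R - j%:R)))
  + ssum (fun k => gbinom (- k%:R - 1 : K) j *:
      prod_modes v u (a (Posz k) w) y (x - k%:R - j%:R - 1))
  - ssum (fun s => ((-1) ^+ s * gbinom (s + j)%:R j) *:
      dsum (-1) (- s%:R - j%:R - 1) (prod_modes (a0 (Posz s) v) u w) y x).
Proof.
have [N HN] := heis_nil H w; have [S0 HS0] := heis_nil H0 v.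
have fsu : fin_supp (fun t => Y u (x + t%:R - j%:R) w).
  by apply: (fields_fin_supp H _ _ (b := x - j%:R)) => k; ring.
have fsk : fin_supp (fun k => gbinom (- k%:R - 1 : K) j *:
    Y u (x - k%:R - j%:R - 1) (a (Posz k) w)).
  by exists N => k /HN->; rewrite linear0 scaler0.
have fst : fin_supp (fun t => gbinom (t%:R : K) j *:
    a (Negz t) (Y u (x + t%:R - j%:R) w)).
  by apply: fin_suppZ; apply: fin_supp_sub fsu _ => t ->; rewrite linear0.
have fs2 : fin_supp2 (fun t s : nat => gbinom (t%:R : K) j *:
    (gbinom (- t%:R - 1 : K) s *: prod_modes (a0 s v) u w
      (y - t%:R - 1 - s%:R) (x + t%:R - j%:R))).
  apply: fin_supp2I.
    case: fsu => P HP; exists P => t s /HP.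
    by rewrite /prod_modes => ->; rewrite linear0 !scaler0.
  move=> t; exists S0 => s /HS0 Hs.
  by rewrite /prod_modes Hs (fields0 H) !scaler0.
have E t : gbinom (t%:R : K) j *: Y v y (a (Negz t) (Y u (x + t%:R - j%:R) w)) =
    gbinom (t%:R : K) j *: a (Negz t) (prod_modes v u w y (x + t%:R - j%:R)) +
    ssum (fun s => - (gbinom (t%:R : K) j *:
    (gbinom (- t%:R - 1 : K) s *: prod_modes (a0 (Posz s) v) u w
      (y - t%:R - 1 - s%:R) (x + t%:R - j%:R)))).
  have HC := fields_comm H (Negz t) v y (Y u (x + t%:R - j%:R) w).
  rewrite {1}/prod_modes HC scalerDr -[RHS]addrA -[LHS]addr0; congr (_ + _).
  rewrite scaler_ssum; last first.
    by exists S0 => s /HS0 ->; rewrite (fields0 H) scaler0.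
  rewrite -ssumD; first last.
  - by exists S0 => s /HS0 Hs; rewrite /prod_modes Hs (fields0 H) !scaler0 oppr0.
  - by exists S0 => s /HS0 Hs; rewrite Hs (fields0 H) !scaler0.
  rewrite -[LHS](ssum0 M); apply: eq_ssum => s.
  by rewrite !intr_Negz /prod_modes !addrA subrr.
rewrite {1}/prod_modes (fields_normal H) linearD (linear_ssum (Y v y) fst) (linear_ssum (Y v y) fsk).
under eq_ssum => t do rewrite linearZZ E.
rewrite ssumD; first last.
- apply: fin_supp_ssum; apply: fin_supp2_sub fs2 _ => t s ->; exact: oppr0.
- apply: fin_suppZ; apply: fin_supp_sub fsu _ => t.
  by rewrite /prod_modes => ->; rewrite !linear0.
rewrite addrAC; congr (_ + _ + _).
  by apply: eq_ssum => k; rewrite linearZ.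
rewrite exchange_ssum; last by apply: fin_supp2_sub fs2 _ => t s ->; exact: oppr0.
rewrite -[RHS]scaleN1r scaler_ssum; last first.
  exists S0 => s /HS0 Hs; rewrite (@eq_dsum _ _ _ _ _ (fun _ _ => 0)) ?dsum0 ?scaler0//.
  by move=> *; rewrite /prod_modes Hs (fields0 H).
apply: eq_ssum => s; rewrite scaleN1r.
rewrite (ssum_shift (s := j)); first last.
- by case: fs2 => P HP; exists P => k Hk; rewrite HP ?Hk// oppr0.
- by move=> k Hk; rewrite gbinom_small// scale0r oppr0.
rewrite -scaleN1r scalerA scaler_ssum; last exact/truncated_fin_suppZ/truncated_prod.
apply: eq_ssum => i; rewrite !scalerA.
have -> : gbinom (s + j)%:R j = gbinom (j + s)%:R s :> K.
  by rewrite !gbinom_nat addnC -bin_sub ?leq_addr// addKn.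
rewrite [gbinom _ j * _]mulrC gbinom_contract !rmorphB/= rmorphN/= !ratr_nat rmorph1.
rewrite -scaleNr.
have -> : - j%:R - s%:R - 1 = - s%:R - j%:R - 1 :> K by ring.
congr (_ *: prod_modes _ _ _ _ _).
- by ring.
- by rewrite natrD; ring.
- by rewrite natrD; ring.
Qed.
Lemma ssumB_scale c (F G : nat -> M) : fin_supp F -> fin_supp G ->
  ssum F - c *: ssum G = ssum (fun i => F i - c *: G i).
Proof.
move=> HF HG; rewrite -scaleNr scaler_ssum// -ssumD//; last exact: fin_suppZ.
by apply: eq_ssum => i; rewrite scaleNr.
Qed.
Lemma dsum_eq0 e x (B : rat) (f : rat -> rat -> M)
    (Hf : forall p q, B <= q -> f p q = 0) p q :
  B <= q -> dsum e x f p q = 0.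
Proof.
move=> Hq; rewrite -[RHS](ssum0 M); apply: eq_ssum => i.
by rewrite Hf ?scaler0// (le_trans Hq)// lerDl.
Qed.

Lemma dsum_shiftr e x (f : rat -> rat -> M) p q d :
  dsum e x (fun p q => f p (q + d)) p q = dsum e x f p (q + d).
Proof. by apply: eq_ssum => i; congr (_ *: f _ _); ring. Qed.

Lemma dsum_shiftl e x (f : rat -> rat -> M) p q d :
  dsum e x (fun p q => f (p + d) q) p q = dsum e x f (p + d) q.
Proof. by apply: eq_ssum => i; congr (_ *: f _ _); ring. Qed.

Definition normal_sum j (X : int -> rat -> rat -> V -> M -> M) l m n v w :=
  ssum (fun t => gbinom (t%:R : K) j *:
    a (Negz t) (X l (m + t%:R - j%:R) n v w))
  + ssum (fun k => gbinom (- k%:R - 1 : K) j *: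
      X l (m - k%:R - j%:R - 1) n v (a (Posz k) w))
  + ssum (fun s => ((-1) ^+ j * gbinom (s + j)%:R j) *:
      X (l - s%:Z - j%:Z - 1) m n (a0 (Posz s) v) w).

Lemma scalerB_comm (c d : K) (x y : M) : c *: x - d *: (c *: y) = c *: (x - d *: y).
Proof. by rewrite scalerBr !scalerA [d * c]mulrC. Qed.
Lemma jacobi_lhs_normal j u l m n v w :
  jacobi_lhs (a0 (Negz j) u) l m n v w = normal_sum j (jacobi_lhs u) l m n v w.
Proof.
have [N HN] := heis_nil H w; have [S0 HS0] := heis_nil H0 v.
have [B HB] := fields_trunc H0 u v.
have HB' w' q x : B <= x -> iter_modes u v w' q x = 0.
  by move=> Hx; rewrite /iter_modes HB// (fields0 H).
pose F1 t (q x : rat) := gbinom (t%:R : K) j *: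
    a (Negz t) (dsum 1 (t%:R - j%:R) (iter_modes u v w) q x).
pose F2 k (q x : rat) := gbinom (- k%:R - 1 : K) j *:
      dsum 1 (- k%:R - j%:R - 1) (iter_modes u v (a (Posz k) w)) q x.
pose F3 s (q x : rat) := ((-1) ^+ j * gbinom (s + j)%:R j) *:
      iter_modes u (a0 (Posz s) v) w q (x - s%:R - j%:R - 1).
have tf1 : truncated_family F1.
  by exists B => t q x Hx; rewrite /F1 (dsum_eq0 _ _ (HB' w))// linear0 scaler0.
have tf2 : truncated_family F2.
  by exists B => t q x Hx; rewrite /F2 (dsum_eq0 _ _ (HB' _))// scaler0.
have tf3 : truncated_family F3.
  apply: truncated_familyI.
    by exists S0 => s q x /HS0 Hs; rewrite /F3 /iter_modes Hs linear0 (fields0 H) scaler0.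
  move=> s; have [B' HB2] := truncated_iter u (a0 (Posz s) v) w.
  exists (B' + 1 + j%:R + s%:R) => q x Hx; rewrite /F3 HB2 ?scaler0//.
  by rewrite !lerBrDr.
have fs1 q x : fin_supp (fun t => F1 t q x).
  apply: fin_suppZ; apply: (@fin_supp_sub _
    (fun t => dsum 1 (t%:R - j%:R) (iter_modes u v w) q x)); last first.
    by move=> t ->; rewrite linear0.
  apply/fin_supp_ssum/fin_supp2_sym/fin_supp2I.
    have [P HP] := rat_arch B x.
    by exists P => i t /HP Hi; rewrite HB'// scaler0.
  move=> i; apply/fin_suppZ/(fields_fin_supp H _ _ (b := q - j%:R - i%:R)) => t.
  by ring.
have fs2 q x : fin_supp (fun t => F2 t q x).
  exists N => k /HN Hk; rewrite /F2 (@eq_dsum _ _ _ _ _ (fun _ _ => 0)) ?dsum0 ?scaler0//.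
  by move=> *; rewrite /iter_modes Hk linear0.
have fs3 q x : fin_supp (fun t => F3 t q x).
  by exists S0 => s /HS0 Hs; rewrite /F3 /iter_modes Hs linear0 (fields0 H) scaler0.
rewrite /jacobi_lhs (eq_dsum _ _ _ _ (@iter_modes_normal j u v w)).
rewrite dsumD ?dsumD; try exact: truncated_ssum;
  last by apply: truncatedD; apply: truncated_ssum.
rewrite !dsum_ssum//; congr (_ + _ + _); apply: eq_ssum => t.
- rewrite dsumZ; last first.
    by exists B => q x Hx; rewrite (dsum_eq0 _ _ (HB' w))// linear0.
  rewrite -linear_dsum; last by exists B => q x Hx; apply: (dsum_eq0 _ _ (HB' w)).
  by rewrite dsum_comp ?addrA//; exact: truncated_iter.
- rewrite dsumZ; last by exists B => q x Hx; apply: (dsum_eq0 _ _ (HB' _)).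
  by rewrite dsum_comp ?addrA//; exact: truncated_iter.
- rewrite dsumZ; last first.
    have [B' HB2] := truncated_iter u (a0 (Posz t) v) w.
    exists (B' + 1 + j%:R + t%:R) => q x Hx; rewrite HB2//.
    by rewrite !lerBrDr.
  congr (_ *: _); rewrite !rmorphB/=.
  transitivity (dsum 1 m (fun q x => iter_modes u (a0 t v) w q (x + (- t%:R - j%:R - 1))) n l%:~R).
    by apply: eq_dsum => q x; rewrite !addrA.
  by rewrite dsum_shiftr !addrA.
Qed.

Lemma jacobi_rhs_normal j u l m n v w :
  jacobi_rhs (a0 (Negz j) u) l m n v w = normal_sum j (jacobi_rhs u) l m n v w.
Proof.
have [N HN] := heis_nil H w; have [S0 HS0] := heis_nil H0 v.
pose F1 t (x y : rat) := gbinom (t%:R : K) j *: a (Negz t) (prod_modes u v w (x + t%:R - j%:R) y).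
pose F2 k (x y : rat) := gbinom (- k%:R - 1 : K) j *:
      prod_modes u v (a (Posz k) w) (x - k%:R - j%:R - 1) y.
pose F3 s (x y : rat) := ((-1) ^+ j * gbinom (s + j)%:R j) *:
      dsum (-1) (- s%:R - j%:R - 1) (prod_modes u (a0 (Posz s) v) w) x y.
pose G1 t (y x : rat) := gbinom (t%:R : K) j *: a (Negz t) (prod_modes v u w y (x + t%:R - j%:R)).
pose G2 k (y x : rat) := gbinom (- k%:R - 1 : K) j *:
      prod_modes v u (a (Posz k) w) y (x - k%:R - j%:R - 1).
pose G3 s (y x : rat) := ((-1) ^+ s * gbinom (s + j)%:R j) *:
      dsum (-1) (- s%:R - j%:R - 1) (prod_modes (a0 (Posz s) v) u w) y x.
have tF1 : truncated_family F1.
  have [B HB] := truncated_prod u v w.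
  by exists B => t x y Hy; rewrite /F1 HB// linear0 scaler0.
have tF2' k : truncated (fun x y => prod_modes u v (a (Posz k) w) (x - k%:R - j%:R - 1) y).
  have [B HB] := truncated_prod u v (a (Posz k) w).
  by exists B => x y Hy; rewrite HB.
have tF2 : truncated_family F2.
  apply: truncated_familyI; last by move=> k; apply: truncatedZ.
  by exists N => k x y /HN Hk; rewrite /F2 /prod_modes Hk !linear0 ?scaler0.
have tF3 : truncated_family F3.
  apply: truncated_familyI; last by move=> s; apply/truncatedZ/truncated_dsum/truncated_prod.
  exists S0 => s x y /HS0 Hs; rewrite /F3 (@eq_dsum _ _ _ _ _ (fun _ _ => 0)) ?dsum0 ?scaler0//.
  by move=> *; rewrite /prod_modes Hs (fields0 H) linear0.
have tG1 : truncated_family G1.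
  have [B HB] := truncated_prod v u w.
  exists (B + j%:R) => t y x Hx; rewrite /G1 HB ?linear0 ?scaler0//.
  by rewrite lerBrDr (le_trans Hx)// lerDl.
have tG2' k : truncated (fun y x => prod_modes v u (a (Posz k) w) y (x - k%:R - j%:R - 1)).
  have [B HB] := truncated_prod v u (a (Posz k) w).
  by exists (B + 1 + j%:R + k%:R) => y x Hx; rewrite HB// !lerBrDr.
have tG2 : truncated_family G2.
  apply: truncated_familyI; last by move=> k; apply: truncatedZ.
  by exists N => k x y /HN Hk; rewrite /G2 /prod_modes Hk !linear0 ?scaler0.
have tG3 : truncated_family G3.
  apply: truncated_familyI; last by move=> s; apply/truncatedZ/truncated_dsum/truncated_prod.
  exists S0 => s x y /HS0 Hs; rewrite /G3 (@eq_dsum _ _ _ _ _ (fun _ _ => 0)) ?dsum0 ?scaler0//.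
  by move=> *; rewrite /prod_modes Hs (fields0 H).
have fF1 x y : fin_supp (fun t => F1 t x y).
  apply: fin_suppZ; apply: fin_supp_sub
    (fields_fin_supp H u (Y v y w) (b := x - j%:R) (f := fun t => x + t%:R - j%:R) _) _.
    by move=> t; ring.
  by move=> t Ht; rewrite /prod_modes Ht linear0.
have fF2 x y : fin_supp (fun t => F2 t x y).
  by exists N => k /HN Hk; rewrite /F2 /prod_modes Hk !linear0 ?scaler0.
have fF3 x y : fin_supp (fun t => F3 t x y).
  exists S0 => s /HS0 Hs; rewrite /F3 (@eq_dsum _ _ _ _ _ (fun _ _ => 0)) ?dsum0 ?scaler0//.
  by move=> *; rewrite /prod_modes Hs (fields0 H) linear0.
have fG1 x y : fin_supp (fun t => G1 t x y).
  apply: fin_suppZ; apply: fin_supp_sub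
    (fields_fin_supp H u w (b := y - j%:R) (f := fun t => y + t%:R - j%:R) _) _.
    by move=> t; ring.
  by move=> t Ht; rewrite /prod_modes Ht !linear0.
have fG2 x y : fin_supp (fun t => G2 t x y).
  by exists N => k /HN Hk; rewrite /G2 /prod_modes Hk !linear0 ?scaler0.
have fG3 x y : fin_supp (fun t => G3 t x y).
  exists S0 => s /HS0 Hs; rewrite /G3 (@eq_dsum _ _ _ _ _ (fun _ _ => 0)) ?dsum0 ?scaler0//.
  by move=> *; rewrite /prod_modes Hs (fields0 H).
rewrite /jacobi_rhs (eq_dsum _ _ _ _ (@prod_modes_normal_l j u v w)).
have Eg y x : prod_modes v (a0 (Negz j) u) w y x =
    ssum (fun t => G1 t y x) + ssum (fun t => G2 t y x) + (-1) *: ssum (fun t => G3 t y x).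
  by rewrite scaleN1r; apply: prod_modes_normal_r.
rewrite (eq_dsum _ _ _ _ Eg).
have tS := @truncated_ssum K M.
rewrite !dsumD ?dsumZ; try (by do ?[apply: truncatedD|apply: truncatedZ|exact: tS]).
rewrite !dsum_ssum// !scalerDr !scalerA !opprD.
rewrite addrACA [X in X + _]addrACA.
congr (_ + _ + _).
- rewrite ssumB_scale; try exact: dsum_fin_supp.
  apply: eq_ssum => t; rewrite /jacobi_rhs.
  rewrite /F1 dsumZ; last first.
    by have [B HB] := truncated_prod u v w; exists B => *; rewrite HB ?linear0.
  rewrite /G1 dsumZ; last first.
    have [B HB] := truncated_prod v u w.
    exists (B + j%:R) => y x Hx; rewrite HB ?linear0 //.
    by rewrite lerBrDr (le_trans Hx)// lerDl.
  rewrite scalerB_comm; congr (_ *: _).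
  rewrite (linearB (a (Negz t))) (linearZZ (a (Negz t))) !(linear_dsum (a (Negz t))); try exact: truncated_prod.
  congr (_ - _ *: _).
    transitivity (dsum (-1) l%:~R (fun x y => a (Negz t) (prod_modes u v w (x + (t%:R - j%:R)) y)) m n).
      by apply: eq_dsum => x y; rewrite addrA.
    by rewrite (dsum_shiftl _ _ (fun x y => a (Negz t) (prod_modes u v w x y))) addrA.
  transitivity (dsum (-1) l%:~R (fun y x => a (Negz t) (prod_modes v u w y (x + (t%:R - j%:R)))) n m).
    by apply: eq_dsum => x y; rewrite addrA.
  by rewrite (dsum_shiftr _ _ (fun x y => a (Negz t) (prod_modes v u w x y))) addrA.
- rewrite ssumB_scale; try exact: dsum_fin_supp.
  apply: eq_ssum => k; rewrite /jacobi_rhs /F2 /G2 !dsumZ//.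
  rewrite scalerB_comm; congr (_ *: (_ - _ *: _)).
    transitivity (dsum (-1) l%:~R (fun x y => prod_modes u v (a (Posz k) w) (x + (- k%:R - j%:R - 1)) y) m n).
      by apply: eq_dsum => x y; rewrite !addrA.
    by rewrite dsum_shiftl !addrA.
  transitivity (dsum (-1) l%:~R (fun y x => prod_modes v u (a (Posz k) w) y (x + (- k%:R - j%:R - 1))) n m).
    by apply: eq_dsum => x y; rewrite !addrA.
  by rewrite dsum_shiftr !addrA.
- rewrite ssumB_scale; try exact: dsum_fin_supp.
  apply: eq_ssum => s; rewrite /jacobi_rhs /F3 /G3.
  rewrite !dsumZ; try exact/truncated_dsum/truncated_prod.
  rewrite !dsum_comp; try exact/truncated_prod.
  rewrite !rmorphB/= !addrA scalerBr scalerA; congr (_ - _).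
  rewrite scalerA; congr (_ *: _).
  rewrite !expfzDr ?oppr_eq0 ?oner_eq0//.
  have E (i : nat) : (-1 : K) ^ (- i%:Z) = (-1) ^+ i.
    by rewrite -invr_expz -[_ ^ i%:Z]/((-1) ^+ i) -exprVn invrN1.
  rewrite !E expr1; have := sqrr_sign K j; rewrite expr2 => Ej; ring: Ej.
Qed.
Definition shift_closed (P : rat -> Prop) := forall m (z : int), P m -> P (m + z%:~R).

Lemma jacobi_normal_l (P : rat -> Prop) j u : shift_closed P ->
  (forall l m n v w, P m -> jacobi u l m n v w) ->
  forall l m n v w, P m -> jacobi (a0 (Negz j) u) l m n v w.
Proof.
move=> Psh HP l m n v w Pm; rewrite /jacobi jacobi_lhs_normal jacobi_rhs_normal.
have HJ : forall l m n v w, P m -> jacobi_lhs u l m n v w = jacobi_rhs u l m n v w := HP.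
congr (_ + _ + _); apply: eq_ssum => i; rewrite HJ//.
- by rewrite -addrA; have := Psh _ (i%:Z - j%:Z) Pm; rewrite rmorphB.
- have := Psh _ (- i%:Z - j%:Z - 1) Pm.
  by rewrite !rmorphB rmorphN/= !addrA.
Qed.

Lemma jacobi_rhs_sym u l m n v w :
  jacobi_rhs u l m n v w = - (-1) ^ l *: jacobi_rhs v l n m u w.
Proof.
rewrite /jacobi_rhs scalerBr scalerA mulNr -expfzMl mulrNN mulr1 exp1rz.
by rewrite scaleNr scaleN1r opprK addrC.
Qed.

Definition highest (chi : K) u :=
  forall s : nat, a0 (Posz s) u = (if s == 0%N then chi else 0) *: u.

Lemma highest_comm chi u k m w : highest chi u ->
  a k (Y u m w) = Y u m (a k w) + chi *: Y u (m + k%:~R) w.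
Proof.
move=> Hu; rewrite (fields_comm H) (@ssum1 _ 0%N).
  by rewrite gbinom0 scale1r Hu/= (fieldsZ H) subr0.
by move=> i /negPf i0; rewrite Hu i0 scale0r (fields0 H) scaler0.
Qed.

Lemma highest_comm0 chi u k m w : highest chi u ->
  a0 k (Y0 u m w) = Y0 u m (a0 k w) + chi *: Y0 u (m + k%:~R) w.
Proof.
move=> Hu; rewrite (fields_comm H0) (@ssum1 _ 0%N).
  by rewrite gbinom0 scale1r Hu/= (fieldsZ H0) subr0.
by move=> i /negPf i0; rewrite Hu i0 scale0r (fields0 H0) scaler0.
Qed.

Definition normal_sum_r chi j (X : int -> rat -> rat -> V -> M -> M) l m n v w :=
  ssum (fun t => gbinom (t%:R : K) j *:
    a (Negz t) (X l m (n + t%:R - j%:R) v w))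
  + ssum (fun k => gbinom (- k%:R - 1 : K) j *:
      X l m (n - k%:R - j%:R - 1) v (a (Posz k) w))
  - chi *: X (l - j%:Z - 1) m n v w.

Lemma jacobi_rhs_normal_r chi j u l m n v w : highest chi u ->
  jacobi_rhs u l m n (a0 (Negz j) v) w = normal_sum_r chi j (jacobi_rhs u) l m n v w.
Proof.
move=> Hu; rewrite jacobi_rhs_sym jacobi_rhs_normal /normal_sum.
have [B HB] := fields_trunc H u w; have [B' HB'] := fields_trunc H v w.
have [N HN] := heis_nil H w.
have fs1 : fin_supp (fun t => gbinom (t%:R : K) j *:
    a (Negz t) (jacobi_rhs v l (n + t%:R - j%:R) m u w)).
  apply: fin_suppZ; apply: (@fin_supp_sub _
    (fun t => jacobi_rhs v l (n + t%:R - j%:R) m u w)); last by move=> t ->; rewrite linear0.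
  rewrite /jacobi_rhs; apply: fin_suppD.
    apply/fin_supp_ssum/fin_supp2_sym/fin_supp2I.
      have [P HP] := rat_arch B m.
      by exists P => i t /HP Hi; rewrite /prod_modes HB// linear0 scaler0.
    move=> i; apply/fin_suppZ/(fields_fin_supp H _ _ (b := n - j%:R + l%:~R - i%:R)) => t.
    by ring.
  have [P HP] := rat_arch B' (n - j%:R); exists P => t /HP Ht.
  have HB2 p q : B' <= q -> prod_modes u v w p q = 0.
    by move=> Hq; rewrite /prod_modes HB'// linear0.
  by rewrite (dsum_eq0 _ _ HB2) ?scaler0 ?oppr0// addrAC.
have fs2 : fin_supp (fun k => gbinom (- k%:R - 1 : K) j *:
      jacobi_rhs v l (n - k%:R - j%:R - 1) m u (a (Posz k) w)).
  exists N => k /HN Hk; rewrite Hk /jacobi_rhs.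
  by rewrite !(@eq_dsum _ _ _ _ _ (fun _ _ => 0)) ?dsum0 ?scaler0 ?subr0 ?scaler0//;
    move=> *; rewrite /prod_modes !linear0.
rewrite !scalerDr !scaler_ssum//; last first.
  exists 1%N => -[//|s] _; rewrite Hu scale0r /jacobi_rhs.
  by rewrite !(@eq_dsum _ _ _ _ _ (fun _ _ => 0)) ?dsum0 ?scaler0 ?subr0 ?scaler0//;
    move=> *; rewrite /prod_modes ?(fields0 H) ?linear0.
congr (_ + _ + _).
- apply: eq_ssum => t; rewrite [in RHS]jacobi_rhs_sym (linearZZ (a (Negz t))) !scalerA.
  by rewrite mulrC.
- apply: eq_ssum => t; rewrite [in RHS]jacobi_rhs_sym !scalerA.
  by rewrite mulrC.
rewrite (@ssum1 _ 0%N); last first.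
  move=> [//|s] _; rewrite Hu scale0r /jacobi_rhs.
  by rewrite !(@eq_dsum _ _ _ _ _ (fun _ _ => 0)) ?dsum0 ?scaler0 ?subr0 ?scaler0//;
    move=> *; rewrite /prod_modes ?(fields0 H) ?linear0.
rewrite subr0 [in RHS]jacobi_rhs_sym add0n gbinom_nat binn mulr1 Hu /=.
have -> : jacobi_rhs v (l - j%:Z - 1) n m (chi *: u) w =
    chi *: jacobi_rhs v (l - j%:Z - 1) n m u w.
  have E1 x p q : dsum (-1) x (prod_modes v (chi *: u) w) p q =
      chi *: dsum (-1) x (prod_modes v u w) p q.
    rewrite -dsumZ; last exact: truncated_prod.
    by apply: eq_dsum => *; rewrite /prod_modes (fieldsZ H) linearZZ.
  have E2 x p q : dsum (-1) x (prod_modes (chi *: u) v w) p q =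
      chi *: dsum (-1) x (prod_modes u v w) p q.
    rewrite -dsumZ; last exact: truncated_prod.
    by apply: eq_dsum => *; rewrite /prod_modes (fieldsZ H).
  by rewrite /jacobi_rhs E1 E2 scalerB_comm.
rewrite !scalerA -scaleNr; congr (_ *: _).
rewrite !expfzDr ?oppr_eq0 ?oner_eq0//.
have E (i : nat) : (-1 : K) ^ (- i%:Z) = (-1) ^+ i.
  by rewrite -invr_expz -[_ ^ i%:Z]/((-1) ^+ i) -exprVn invrN1.
by rewrite !E expr1; ring.
Qed.

Lemma iter_modes_normal_r chi j u v w q x : highest chi u ->
  iter_modes u (a0 (Negz j) v) w q x =
  ssum (fun t => gbinom (t%:R : K) j *:
    a (Negz t) (iter_modes u v w (q + t%:R - j%:R) x))
  + ssum (fun k => gbinom (- k%:R - 1 : K) j *: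
      iter_modes u v (a (Posz k) w) (q - k%:R - j%:R - 1) x)
  - chi *: iter_modes u v w q (x - j%:R - 1).
Proof.
move=> Hu; rewrite {1}/iter_modes.
have := highest_comm0 (Negz j) x v Hu; rewrite intr_Negz => /(congr1 (fun z => z - chi *: Y0 u (x + (- j%:R - 1)) v)).
rewrite addrK => <-.
rewrite (fieldsD H) (fields_normal H) -scaleNr (fieldsZ H) scaleNr addrA.
by [].
Qed.

Lemma jacobi_lhs_normal_r chi j u l m n v w : highest chi u ->
  jacobi_lhs u l m n (a0 (Negz j) v) w = normal_sum_r chi j (jacobi_lhs u) l m n v w.
Proof.
move=> Hu; have [N HN] := heis_nil H w; have [B HB] := fields_trunc H0 u v.
have HB' w' q x : B <= x -> iter_modes u v w' q x = 0.
  by move=> Hx; rewrite /iter_modes HB// (fields0 H).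
pose F1 t (q x : rat) := gbinom (t%:R : K) j *:
    a (Negz t) (iter_modes u v w (q + t%:R - j%:R) x).
pose F2 k (q x : rat) := gbinom (- k%:R - 1 : K) j *:
      iter_modes u v (a (Posz k) w) (q - k%:R - j%:R - 1) x.
have tF1 : truncated_family F1.
  by exists B => t x y Hy; rewrite /F1 HB'// linear0 scaler0.
have tF2 : truncated_family F2.
  by exists B => t x y Hy; rewrite /F2 HB'// scaler0.
have fF1 q x : fin_supp (fun t => F1 t q x).
  apply: fin_suppZ; apply: fin_supp_sub
    (fields_fin_supp H (Y0 u x v) w (b := q - j%:R) (f := fun t => q + t%:R - j%:R) _) _.
    by move=> t; ring.
  by move=> t Ht; rewrite /iter_modes Ht linear0.
have fF2 x y : fin_supp (fun t => F2 t x y).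
  by exists N => k /HN Hk; rewrite /F2 /iter_modes Hk !linear0 ?scaler0.
have E q x : iter_modes u (a0 (Negz j) v) w q x = ssum (fun t => F1 t q x) +
   ssum (fun t => F2 t q x) + (- chi) *: iter_modes u v w q (x + (- j%:R - 1)).
  by rewrite (iter_modes_normal_r _ _ _ _ _ Hu) scaleNr addrA.
have t3 : truncated (fun q x => iter_modes u v w q (x + (- j%:R - 1))).
  by exists (B - (- j%:R - 1)) => p q Hq; apply: HB'; rewrite -lerBlDr.
have tS := @truncated_ssum K M.
rewrite /jacobi_lhs (eq_dsum _ _ _ _ E).
rewrite !dsumD ?dsumZ; try (by do ?[apply: truncatedD|apply: truncatedZ|exact: tS]).
rewrite dsum_shiftr scaleNr !dsum_ssum// /normal_sum_r; congr (_ + _ - _ *: _).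
- apply: eq_ssum => t; rewrite dsumZ; last by exists B => *; rewrite HB' ?linear0.
  rewrite linear_dsum; last exact: truncated_iter.
  congr (_ *: _).
  transitivity (dsum 1 m (fun q x => a (Negz t) (iter_modes u v w (q + (t%:R - j%:R)) x)) n l%:~R).
    by apply: eq_dsum => *; rewrite addrA.
  by rewrite (dsum_shiftl _ _ (fun x y => a (Negz t) (iter_modes u v w x y))) addrA.
- apply: eq_ssum => t; rewrite dsumZ; last by exists B => *; rewrite HB'.
  congr (_ *: _).
  transitivity (dsum 1 m (fun q x => iter_modes u v (a (Posz t) w) (q + (- t%:R - j%:R - 1)) x) n l%:~R).
    by apply: eq_dsum => *; rewrite !addrA.
  by rewrite dsum_shiftl !addrA.
by rewrite !rmorphB/= addrA.
Qed.

Lemma jacobi_normal_r (P : rat -> Prop) chi j u v : highest chi u ->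
  (forall l m n w, P m -> jacobi u l m n v w) ->
  forall l m n w, P m -> jacobi u l m n (a0 (Negz j) v) w.
Proof.
move=> Hu HP l m n w Pm.
rewrite /jacobi (jacobi_lhs_normal_r _ _ _ _ _ _ Hu) (jacobi_rhs_normal_r _ _ _ _ _ _ Hu).
have HJ : forall l m n w, P m -> jacobi_lhs u l m n v w = jacobi_rhs u l m n v w := HP.
by rewrite /normal_sum_r HJ//; congr (_ + _ - _); apply: eq_ssum => i; rewrite HJ.
Qed.
Lemma jacobi_lhs_covariant chi1 chi2 u v k l m n w : highest chi1 u -> highest chi2 v ->
  a k (jacobi_lhs u l m n v w) = jacobi_lhs u l m n v (a k w) +
    chi1 *: jacobi_lhs u l (m + k%:~R) n v w + chi2 *: jacobi_lhs u l m (n + k%:~R) v w.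
Proof.
move=> Hu Hv; rewrite /jacobi_lhs linear_dsum; last exact: truncated_iter.
have E q x : a k (iter_modes u v w q x) = iter_modes u v (a k w) q x +
    chi1 *: dsum 1 k%:~R (iter_modes u v w) q x + chi2 *: iter_modes u v w (q + k%:~R) x.
  rewrite /iter_modes (fields_comm H) -addrA; congr (_ + _).
  have Es s : gbinom (k%:~R : K) s *: Y (a0 (Posz s) (Y0 u x v)) (q + k%:~R - s%:R) w =
     chi1 *: ((1 ^+ s * gbinom (ratr k%:~R) s) *:
       iter_modes u v w (q + k%:~R - s%:R) (x + s%:R)) +
     (if s == 0%N then chi2 *: iter_modes u v w (q + k%:~R) x else 0).
    rewrite (highest_comm0 _ _ _ Hu) Hv (fieldsD H) (fieldsZ H) linearZZ (fieldsZ H).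
    rewrite scalerDr addrC expr1n mul1r ratr_int; congr (_ + _).
      by rewrite !scalerA mulrC.
    case: eqP => [->|_]; first by rewrite gbinom0 scale1r subr0.
    by rewrite scale0r scaler0.
  rewrite (eq_ssum Es) ssumD; first last.
  - by exists 1%N => -[].
  - exact/fin_suppZ/truncated_fin_suppZ/truncated_iter.
  rewrite [X in _ + X](@ssum1 _ 0%N); last by move=> s /negPf->.
  rewrite -scaler_ssum//; exact/truncated_fin_suppZ/truncated_iter.
rewrite (eq_dsum _ _ _ _ E).
have tI := @truncated_iter u v.
have tI' : truncated (fun q x => iter_modes u v w (q + k%:~R) x).
  by have [B HB] := tI w; exists B => *; apply: HB.
rewrite !dsumD ?dsumZ; try (by do ?[apply: truncatedD|apply: truncatedZ|apply: truncated_dsum|exact: tI]).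
by rewrite dsum_comp// dsum_shiftl.
Qed.

Lemma jacobi_rhs_covariant chi1 chi2 u v k l m n w : highest chi1 u -> highest chi2 v ->
  a k (jacobi_rhs u l m n v w) = jacobi_rhs u l m n v (a k w) +
    chi1 *: jacobi_rhs u l (m + k%:~R) n v w + chi2 *: jacobi_rhs u l m (n + k%:~R) v w.
Proof.
have E c1 c2 u' v' p q : highest c1 u' -> highest c2 v' ->
   a k (dsum (-1) l%:~R (prod_modes u' v' w) p q) =
   dsum (-1) l%:~R (prod_modes u' v' (a k w)) p q +
   c1 *: dsum (-1) l%:~R (prod_modes u' v' w) (p + k%:~R) q +
   c2 *: dsum (-1) l%:~R (prod_modes u' v' w) p (q + k%:~R).
  move=> Hu Hv; rewrite linear_dsum; last exact: truncated_prod.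
  have F x y : a k (prod_modes u' v' w x y) = prod_modes u' v' (a k w) x y +
     c1 *: prod_modes u' v' w (x + k%:~R) y + c2 *: prod_modes u' v' w x (y + k%:~R).
    rewrite /prod_modes (highest_comm _ _ _ Hu) (highest_comm _ _ _ Hv).
    by rewrite linearD linearZZ addrAC.
  rewrite (eq_dsum _ _ _ _ F).
  have tI := @truncated_prod u' v'.
  have tI' : truncated (fun x y => prod_modes u' v' w (x + k%:~R) y).
    by have [B HB] := tI w; exists B => *; apply: HB.
  have tI2 : truncated (fun x y => prod_modes u' v' w x (y + k%:~R)).
    by have [B HB] := tI w; exists (B - k%:~R) => *; apply: HB; rewrite -lerBlDr.
  rewrite !dsumD ?dsumZ; try (by do ?[apply: truncatedD|apply: truncatedZ|exact: tI]).
  by rewrite dsum_shiftl dsum_shiftr.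
move=> Hu Hv; rewrite /jacobi_rhs (linearB (a k)) (linearZZ (a k)) !(E _ _ _ _ _ _ Hu Hv) (E _ _ _ _ _ _ Hv Hu).
rewrite !scalerDr !scalerN !scalerA ![_ * (-1) ^ l]mulrC.
set X1 := dsum _ _ _ _ _; set X2 := _ *: _; set X3 := _ *: _; set X4 := _ *: _.
set X5 := _ *: _; set X6 := _ *: _.
by rewrite (addrACA X1) [RHS]addrACA -!opprD [X4 + X6 + X5]addrAC.
Qed.

Lemma jacobi_covariant (P : rat -> Prop) chi1 chi2 u v l k w : shift_closed P ->
  highest chi1 u -> highest chi2 v ->
  (forall m n, P m -> jacobi u l m n v w) ->
  forall m n, P m -> jacobi u l m n v (a k w).
Proof.
move=> Psh Hu Hv HP m n Pm.
have HJ : forall m n, P m -> jacobi_lhs u l m n v w = jacobi_rhs u l m n v w := HP.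
have := jacobi_lhs_covariant k l m n w Hu Hv; rewrite !HJ//; last exact: Psh.
by rewrite (jacobi_rhs_covariant k l m n w Hu Hv) => /addIr /addIr E; exact: esym.
Qed.

Lemma dsum_1 e (f : rat -> rat -> M) p q :
  dsum e 1 f p q = f (p + 1) q + e *: f p (q + 1).
Proof.
rewrite /dsum (@ssumE _ _ 2); last first.
  move=> i Hi; rewrite rmorph1 -[1]/(1%:R) gbinom_nat bin_small ?mulr0 ?scale0r//.
rewrite big_ord_recr big_ord1/= rmorph1 -[X in gbinom X]/(1%:R) !gbinom_nat !bin1 expr0 mul1r scale1r.
by rewrite subr0 addr0 mulr1 addrK.
Qed.

Lemma jacobi_up (P : rat -> Prop) u v l w : shift_closed P ->
  (forall m n, P m -> jacobi u l m n v w) ->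
  forall m n, P m -> jacobi u (l + 1) m n v w.
Proof.
move=> Psh HP m n Pm.
have HJ : forall m n, P m -> jacobi_lhs u l m n v w = jacobi_rhs u l m n v w := HP.
have Pm1 : P (m + 1) by exact: Psh m 1 Pm.
have El : jacobi_lhs u (l + 1) m n v w = jacobi_lhs u l (m + 1) n v w - jacobi_lhs u l m (n + 1) v w.
  rewrite /jacobi_lhs rmorphD/= [m + 1]addrC -dsum_comp; last exact: truncated_iter.
  by rewrite dsum_1 scale1r addrAC subrr add0r.
have Er : jacobi_rhs u (l + 1) m n v w = jacobi_rhs u l (m + 1) n v w - jacobi_rhs u l m (n + 1) v w.
  rewrite /jacobi_rhs rmorphD/= addrC expfzDr ?oppr_eq0 ?oner_eq0// expr1z mulrC mulN1r.
  rewrite [l%:~R + 1]addrC -!dsum_comp; try exact: truncated_prod.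
  rewrite !dsum_1 !scaleN1r scaleNr opprK scalerBr opprB addrA addrC !addrA.
  set X1 := _ *: _; set X2 := _ *: _.
  set X3 := dsum _ _ _ _ _; rewrite addrC -[RHS]addrA -[RHS]addrA; congr (_ + _).
  by rewrite addrC [- X3 + _]addrC.
by rewrite /jacobi El Er !HJ.
Qed.

Lemma dsum_deriv_r e x (f : rat -> rat -> M) p q : truncated f ->
  dsum e x (fun p q => ratr q *: f p (q - 1)) p q =
  ratr q *: dsum e x f p (q - 1) + (e * ratr x) *: dsum e (x - 1) f p q.
Proof.
move=> Hf; rewrite /dsum.
have E i : (e ^+ i * gbinom (ratr x) i) *: (ratr (q + i%:R) *:
    f (p + x - i%:R) (q + i%:R - 1)) =
  ratr q *: ((e ^+ i * gbinom (ratr x) i) *: f (p + x - i%:R) (q - 1 + i%:R)) +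
  (i%:R * (e ^+ i * gbinom (ratr x) i)) *: f (p + x - i%:R) (q - 1 + i%:R).
  rewrite [q + _ - 1]addrAC rmorphD/= ratr_nat !scalerA -scalerDl; congr (_ *: _); ring.
have fsx (c : nat -> K) : fin_supp (fun i => c i *: f (p + x - i%:R) (q - 1 + i%:R)).
  exact: truncated_fin_suppZ.
rewrite (eq_ssum E) ssumD//; last exact: (fin_suppZ (fun=> ratr q)).
rewrite -scaler_ssum//; congr (_ + _).
rewrite (ssum_shift (s := 1%N))//; last by case=> // _; rewrite mul0r scale0r.
rewrite scaler_ssum; last exact: truncated_fin_suppZ.
apply: eq_ssum => i; rewrite scalerA rmorphB/= rmorph1; congr (_ *: f _ _).
- rewrite add1n mulrCA mulrA -mulrA gbinomSl exprS; ring.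
- by rewrite natrD; ring.
- by rewrite natrD; ring.
Qed.

Lemma dsum_deriv_l e x (f : rat -> rat -> M) p q : truncated f ->
  dsum e x (fun p q => ratr p *: f (p - 1) q) p q =
  ratr p *: dsum e x f (p - 1) q + ratr x *: dsum e (x - 1) f p q.
Proof.
move=> Hf; rewrite /dsum.
have E i : (e ^+ i * gbinom (ratr x) i) *: (ratr (p + x - i%:R) *:
    f (p + x - i%:R - 1) (q + i%:R)) =
  ratr p *: ((e ^+ i * gbinom (ratr x) i) *: f (p - 1 + x - i%:R) (q + i%:R)) +
  ratr x *: ((e ^+ i * gbinom (ratr (x - 1)) i) *: f (p + (x - 1) - i%:R) (q + i%:R)).
  have -> : p - 1 + x - i%:R = p + x - i%:R - 1 by ring.
  have -> : p + (x - 1) - i%:R = p + x - i%:R - 1 by ring.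
  rewrite !scalerA -scalerDl; congr (_ *: _).
  rewrite !rmorphB rmorphD/= rmorph1 ratr_nat.
  have := gbinomS (ratr x : K) i; rewrite gbinomSl => Ex.
  transitivity (e ^+ i * ((ratr p * gbinom (ratr x) i) + (ratr x - i%:R) * gbinom (ratr x) i)); first by ring.
  by rewrite -Ex; ring.
rewrite (eq_ssum E) ssumD; try exact/(fin_suppZ (fun=> _))/truncated_fin_suppZ.
by rewrite -!scaler_ssum//; exact/truncated_fin_suppZ.
Qed.
Definition translation c u :=
  (forall m v, c *: Y0 (a0 (Negz 0) u) m v = - ratr m *: Y0 u (m - 1) v) /\
  (forall m w, c *: Y (a0 (Negz 0) u) m w = - ratr m *: Y u (m - 1) w).

Lemma jacobi_lhs_translation c u l m n v w : translation c u ->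
  c *: jacobi_lhs (a0 (Negz 0) u) l m n v w =
  - (ratr m *: jacobi_lhs u l (m - 1) n v w + l%:~R *: jacobi_lhs u (l - 1) m n v w).
Proof.
move=> [T0 _]; rewrite /jacobi_lhs -dsumZ; last exact: truncated_iter.
transitivity (dsum 1 m (fun q x => (-1) *: (ratr x *: iter_modes u v w q (x - 1))) n l%:~R).
  by apply: eq_dsum => q x; rewrite /iter_modes -(fieldsZ H) T0 (fieldsZ H) scaleN1r scaleNr.
have tI := @truncated_iter u v w.
rewrite dsumZ; last first.
  have [B HB] := tI; exists (B + 1) => q x Hx; rewrite HB ?scaler0//.
  by rewrite lerBrDr.
rewrite dsum_deriv_r// scaleN1r mul1r ratr_int addrC.
by rewrite rmorphB.
Qed.

Lemma jacobi_rhs_translation c u l m n v w : translation c u ->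
  c *: jacobi_rhs (a0 (Negz 0) u) l m n v w =
  - (ratr m *: jacobi_rhs u l (m - 1) n v w + l%:~R *: jacobi_rhs u (l - 1) m n v w).
Proof.
move=> [_ T]; rewrite /jacobi_rhs; have tI := @truncated_prod.
have EA : c *: dsum (-1) l%:~R (prod_modes (a0 (Negz 0) u) v w) m n =
   - (ratr m *: dsum (-1) l%:~R (prod_modes u v w) (m - 1) n +
      l%:~R *: dsum (-1) (l - 1)%:~R (prod_modes u v w) m n).
  rewrite -dsumZ; last exact: tI.
  transitivity (dsum (-1) l%:~R (fun x y => (-1) *: (ratr x *: prod_modes u v w (x - 1) y)) m n).
    by apply: eq_dsum => x y; rewrite /prod_modes T scaleN1r scaleNr.
  rewrite dsumZ; last by have [B HB] := tI u v w; exists B => *; rewrite HB ?scaler0.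
  by rewrite dsum_deriv_l// scaleN1r ratr_int rmorphB.
have EB : c *: dsum (-1) l%:~R (prod_modes v (a0 (Negz 0) u) w) n m =
   - (ratr m *: dsum (-1) l%:~R (prod_modes v u w) n (m - 1) -
      l%:~R *: dsum (-1) (l - 1)%:~R (prod_modes v u w) n m).
  rewrite -dsumZ; last exact: tI.
  transitivity (dsum (-1) l%:~R (fun y x => (-1) *: (ratr x *: prod_modes v u w y (x - 1))) n m).
    by apply: eq_dsum => x y; rewrite /prod_modes -linearZZ T linearZZ scaleN1r scaleNr.
  rewrite dsumZ; last first.
    have [B HB] := tI v u w; exists (B + 1) => q x Hx; rewrite HB ?scaler0//.
    by rewrite lerBrDr.
  by rewrite dsum_deriv_r// scaleN1r ratr_int rmorphB mulN1r scaleNr.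
rewrite -scalerB_comm EA EB.
rewrite expfzDr ?oppr_eq0 ?oner_eq0// -[(-1) ^ (-1)]/((-1)^-1) invrN1 mulrN1 scaleNr opprK.
rewrite scalerN opprK scalerBr [in RHS]scalerBr [in RHS]scalerDr addrACA [in RHS]opprD.
by congr (_ + _); rewrite opprD opprK !scalerA ![_ * (-1) ^ l]mulrC.
Qed.

Lemma linear_fun0 (U W : lmodType K) (X : U -> W) :
  (forall c u u', X (c *: u + u') = c *: X u + X u') -> X 0 = 0.
Proof.
move=> HX; have := HX 1 0 0; rewrite !scale1r addr0 => /esym/eqP.
by rewrite -subr_eq0 addrK => /eqP.
Qed.

Lemma linear_funZ (U W : lmodType K) (X : U -> W) :
  (forall c u u', X (c *: u + u') = c *: X u + X u') ->
  forall c u, X (c *: u) = c *: X u.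
Proof. by move=> HX c u; rewrite -[c *: u]addr0 HX (linear_fun0 HX) addr0. Qed.

Lemma dsum_linear e x (c : K) (f g h : rat -> rat -> M) p q : truncated g -> truncated h ->
  (forall p q, f p q = c *: g p q + h p q) ->
  dsum e x f p q = c *: dsum e x g p q + dsum e x h p q.
Proof.
move=> tg th E; rewrite (eq_dsum _ _ _ _ E) dsumD//; last exact: truncatedZ.
by rewrite dsumZ.
Qed.

Lemma jacobi_lhs_linear_l c u u' l m n v w :
  jacobi_lhs (c *: u + u') l m n v w = c *: jacobi_lhs u l m n v w + jacobi_lhs u' l m n v w.
Proof.
apply: dsum_linear; try exact: truncated_iter.
by move=> *; rewrite /iter_modes (fieldsP H0) (fieldsP H).
Qed.

Lemma jacobi_lhs_linear_m c u l m n v v' w :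
  jacobi_lhs u l m n (c *: v + v') w = c *: jacobi_lhs u l m n v w + jacobi_lhs u l m n v' w.
Proof.
apply: dsum_linear; try exact: truncated_iter.
by move=> *; rewrite /iter_modes linearP (fieldsP H).
Qed.

Lemma jacobi_lhs_linear_r c u l m n v w w' :
  jacobi_lhs u l m n v (c *: w + w') = c *: jacobi_lhs u l m n v w + jacobi_lhs u l m n v w'.
Proof.
apply: dsum_linear; try exact: truncated_iter.
by move=> *; rewrite /iter_modes linearP.
Qed.

Lemma jacobi_rhs_combine (c s : K) (x y x' y' z t : M) :
  z = c *: x + x' -> t = c *: y + y' ->
  z - s *: t = c *: (x - s *: y) + (x' - s *: y').
Proof.
by move=> -> ->; rewrite scalerDr opprD addrACA scalerBr !scalerA [s * c]mulrC.
Qed.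

Lemma jacobi_rhs_linear_l c u u' l m n v w :
  jacobi_rhs (c *: u + u') l m n v w = c *: jacobi_rhs u l m n v w + jacobi_rhs u' l m n v w.
Proof.
apply: jacobi_rhs_combine; apply: dsum_linear; try exact: truncated_prod.
  by move=> *; rewrite /prod_modes (fieldsP H).
by move=> *; rewrite /prod_modes (fieldsP H) linearP.
Qed.

Lemma jacobi_rhs_linear_m c u l m n v v' w :
  jacobi_rhs u l m n (c *: v + v') w = c *: jacobi_rhs u l m n v w + jacobi_rhs u l m n v' w.
Proof.
apply: jacobi_rhs_combine; apply: dsum_linear; try exact: truncated_prod.
  by move=> *; rewrite /prod_modes (fieldsP H) linearP.
by move=> *; rewrite /prod_modes (fieldsP H).
Qed.

Lemma jacobi_rhs_linear_r c u l m n v w w' :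
  jacobi_rhs u l m n v (c *: w + w') = c *: jacobi_rhs u l m n v w + jacobi_rhs u l m n v w'.
Proof.
apply: jacobi_rhs_combine; apply: dsum_linear; try exact: truncated_prod.
  by move=> *; rewrite /prod_modes !linearP.
by move=> *; rewrite /prod_modes !linearP.
Qed.

Lemma jacobi_linear_l c u u' l m n v w : jacobi u l m n v w -> jacobi u' l m n v w ->
  jacobi (c *: u + u') l m n v w.
Proof. by rewrite /jacobi jacobi_lhs_linear_l jacobi_rhs_linear_l => -> ->. Qed.

Lemma jacobi_linear_m c u l m n v v' w : jacobi u l m n v w -> jacobi u l m n v' w ->
  jacobi u l m n (c *: v + v') w.
Proof. by rewrite /jacobi jacobi_lhs_linear_m jacobi_rhs_linear_m => -> ->. Qed.

Lemma jacobi_linear_r c u l m n v w w' : jacobi u l m n v w -> jacobi u l m n v w' ->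
  jacobi u l m n v (c *: w + w').
Proof. by rewrite /jacobi jacobi_lhs_linear_r jacobi_rhs_linear_r => -> ->. Qed.

Lemma scalerD_solve (c chi l : K) (S Q X : M) :
  c *: (S + chi *: X) = - (Q + l *: X) -> (c * chi + l) *: X = - Q - c *: S.
Proof.
rewrite scalerDl -scalerA scalerDr => E.
have -> : c *: (chi *: X) = - (c *: S) + - (Q + l *: X) by rewrite -E addKr.
by rewrite opprD !addrA subrK addrC.
Qed.

Lemma jacobi_down (P : rat -> Prop) c chi u v l : shift_closed P ->
  translation c u -> highest chi v -> c * chi + l%:~R != 0 ->
  (forall m n w, P m -> jacobi u l m n v w) ->
  forall m n w, P m -> jacobi u (l - 1) m n v w.
Proof.
move=> Psh T Hv Hl HP m n w Pm.
have HJ : forall m n w, P m -> jacobi_lhs u l m n v w = jacobi_rhs u l m n v w := HP.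
have := jacobi_lhs_translation l m n v w T; have := jacobi_rhs_translation l m n v w T.
rewrite jacobi_lhs_normal jacobi_rhs_normal /normal_sum.
have Pz (z : int) : P (m + z%:~R) by apply: Psh.
have E3 (X : int -> rat -> rat -> V -> M -> M) :
  (forall l m n w, X l m n 0 w = 0) ->
  (forall l m n c v w, X l m n (c *: v) w = c *: X l m n v w) ->
  ssum (fun s => ((-1) ^+ 0 * gbinom (s + 0)%:R 0) *:
      X (l - s%:Z - 0%:Z - 1) m n (a0 (Posz s) v) w) = chi *: X (l - 1) m n v w.
  move=> X0 XZ; rewrite (@ssum1 _ 0%N).
    by rewrite expr0 gbinom0 mulr1 scale1r Hv/= !subr0 XZ.
  by move=> s /negPf s0; rewrite Hv s0 scale0r X0 scaler0.
have ZL := fun l m n w => @linear_fun0 _ _ (fun v => jacobi_lhs u l m n v w)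
  (fun c v v' => jacobi_lhs_linear_m c u l m n v v' w).
have ZR := fun l m n w => @linear_fun0 _ _ (fun v => jacobi_rhs u l m n v w)
  (fun c v v' => jacobi_rhs_linear_m c u l m n v v' w).
have SL := fun l m n c v w => @linear_funZ _ _ (fun v => jacobi_lhs u l m n v w)
  (fun c v v' => jacobi_lhs_linear_m c u l m n v v' w) c v.
have SR := fun l m n c v w => @linear_funZ _ _ (fun v => jacobi_rhs u l m n v w)
  (fun c v v' => jacobi_rhs_linear_m c u l m n v v' w) c v.
rewrite (E3 _ ZL SL) (E3 _ ZR SR).
rewrite HJ; last by have := Pz (-1); rewrite rmorphN1.
have -> : ssum (fun t => gbinom (t%:R : K) 0 *: a (Negz t) (jacobi_lhs u l (m + t%:R - 0%:R) n v w))
   = ssum (fun t => gbinom (t%:R : K) 0 *: a (Negz t) (jacobi_rhs u l (m + t%:R - 0%:R) n v w)).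
  by apply: eq_ssum => t; rewrite HJ// subr0; apply: (Pz t).
have -> : ssum (fun k => gbinom (- k%:R - 1 : K) 0 *:
      jacobi_lhs u l (m - k%:R - 0%:R - 1) n v (a (Posz k) w))
   = ssum (fun k => gbinom (- k%:R - 1 : K) 0 *:
      jacobi_rhs u l (m - k%:R - 0%:R - 1) n v (a (Posz k) w)).
  apply: eq_ssum => k; rewrite HJ//; have := Pz (- k%:Z - 1).
  by rewrite rmorphB rmorphN/= subr0 addrA.
move=> /scalerD_solve ER /scalerD_solve; rewrite -ER.
exact: scalerI.
Qed.

End Jacobi.

(** * Normally ordered products *)

Section NormalOrder.
Variables (K : numFieldType) (M : lmodType K) (a : int -> {linear M -> M}).
Variable kappa : K.
Implicit Types m : rat.

Definition heisenberg_relations :=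
  (forall k l w, a k (a l w) =
     a l (a k w) + (if k + l == 0 then kappa * k%:~R else 0) *: w) /\
  (forall w, exists N, forall k, (N <= k)%N -> a (Posz k) w = 0).

Record mfield := MField {
  fmode :> rat -> {linear M -> M};
  ftrunc : forall w, exists B, forall m, B <= m -> fmode m w = 0 }.

Hypothesis Ha : heisenberg_relations.

Lemma heis_commN s t w : a (Negz s) (a (Negz t) w) = a (Negz t) (a (Negz s) w).
Proof. by rewrite Ha.1 scale0r addr0. Qed.

Lemma heis_commP (s t : nat) w : a (Posz s) (a (Posz t) w) = a (Posz t) (a (Posz s) w).
Proof.
rewrite Ha.1; case: s => [|s]; first by rewrite mulr0 if_same scale0r addr0.
by rewrite scale0r addr0.
Qed.

Definition normL j (phi : mfield) m w := ssum (fun t =>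
  gbinom (t%:R : K) j *: a (Negz t) (phi (m + t%:R - j%:R) w)).

Definition normR j (phi : mfield) m w := ssum (fun k =>
  gbinom (- k%:R - 1 : K) j *: phi (m - k%:R - j%:R - 1) (a (Posz k) w)).

Lemma mfield_fin_supp (phi : mfield) w (f : nat -> rat) b :
  (forall i, f i = b + i%:R) -> fin_supp (fun i => phi (f i) w).
Proof.
move=> Hf; have [B HB] := ftrunc phi w; have [N HN] := rat_arch B b.
by exists N => i /HN Hi; apply: HB; rewrite Hf.
Qed.

Lemma normL_fin_supp j (phi : mfield) m w : fin_supp (fun t =>
  gbinom (t%:R : K) j *: a (Negz t) (phi (m + t%:R - j%:R) w)).
Proof.
apply: fin_suppZ; apply: fin_supp_sub
  (mfield_fin_supp phi w (b := m - j%:R) (f := fun t => m + t%:R - j%:R) _) _.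
  by move=> i; ring.
by move=> i ->; rewrite linear0.
Qed.

Lemma normR_fin_supp j (phi : mfield) m w : fin_supp (fun k =>
  gbinom (- k%:R - 1 : K) j *: phi (m - k%:R - j%:R - 1) (a (Posz k) w)).
Proof.
have [N HN] := Ha.2 w.
by exists N => k /HN->; rewrite linear0 scaler0.
Qed.

Lemma normL_linear j phi m : linear (normL j phi m).
Proof.
move=> c u v; rewrite /normL scaler_ssum -?ssumD; try exact: normL_fin_supp.
  by apply: eq_ssum => t; rewrite !linearP !scalerA mulrC.
exact/(fin_suppZ (fun=> c))/normL_fin_supp.
Qed.

Lemma normR_linear j phi m : linear (normR j phi m).
Proof.
move=> c u v; rewrite /normR scaler_ssum -?ssumD; try exact: normR_fin_supp.
  by apply: eq_ssum => t; rewrite !linearP !scalerA mulrC.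
exact/(fin_suppZ (fun=> c))/normR_fin_supp.
Qed.

HB.instance Definition _ j phi m :=
  GRing.isLinear.Build K M M *:%R (normL j phi m) (normL_linear j phi m).
HB.instance Definition _ j phi m :=
  GRing.isLinear.Build K M M *:%R (normR j phi m) (normR_linear j phi m).

Lemma normL_trunc j phi w : exists B, forall m, B <= m -> normL j phi m w = 0.
Proof.
have [B HB] := ftrunc phi w; exists (B + j%:R) => m Hm.
rewrite -[RHS](ssum0 M); apply: eq_ssum => t; rewrite HB ?linear0//.
by rewrite lerBrDr (le_trans Hm)// lerDl.
Qed.

Lemma normR_trunc j phi w : exists B, forall m, B <= m -> normR j phi m w = 0.
Proof.
have [N HN] := Ha.2 w.
have [B HB] : truncated_family (fun k (_ q : rat) =>
    phi (q - k%:R - j%:R - 1) (a (Posz k) w)).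
  apply: truncated_familyI; first by exists N => k p q /HN->; rewrite linear0.
  move=> k; have [B HB] := ftrunc phi (a (Posz k) w).
  by exists (B + 1 + j%:R + k%:R) => _ q Hq; rewrite HB// !lerBrDr.
exists B => m Hm; rewrite -[RHS](ssum0 M); apply: eq_ssum => t.
by rewrite (HB _ 0)// scaler0.
Qed.

Definition normLf j phi := MField (normL_trunc j phi).
Definition normRf j phi := MField (normR_trunc j phi).

Definition normal j (phi : mfield) m w := normL j phi m w + normR j phi m w.

Lemma normal_linear j phi m : linear (normal j phi m).
Proof. by move=> c u v; rewrite /normal !linearP scalerDr addrACA. Qed.

HB.instance Definition _ j phi m :=
  GRing.isLinear.Build K M M *:%R (normal j phi m) (normal_linear j phi m).

Lemma normal_trunc j phi w : exists B, forall m, B <= m -> normal j phi m w = 0.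
Proof.
have [B HB] := normL_trunc j phi w; have [B' HB'] := normR_trunc j phi w.
by exists (Num.max B B') => m; rewrite ge_max /normal => /andP[/HB-> /HB'->]; rewrite addr0.
Qed.

Definition normalf j phi := MField (normal_trunc j phi).

Lemma normLD j (phi psi chi : mfield) m w : (forall m w, phi m w = psi m w + chi m w) ->
  normL j phi m w = normL j psi m w + normL j chi m w.
Proof.
move=> E; rewrite /normL -ssumD; try exact: normL_fin_supp.
by apply: eq_ssum => t; rewrite E linearD scalerDr.
Qed.

Lemma normRD j (phi psi chi : mfield) m w : (forall m w, phi m w = psi m w + chi m w) ->
  normR j phi m w = normR j psi m w + normR j chi m w.
Proof.
move=> E; rewrite /normR -ssumD; try exact: normR_fin_supp.
by apply: eq_ssum => t; rewrite E scalerDr.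
Qed.

Lemma normLL i j phi m w : normL i (normLf j phi) m w = normL j (normLf i phi) m w.
Proof.
rewrite {1}/normL [in RHS]/normL /=.
have E (c d : nat) t : gbinom (t%:R : K) c *: a (Negz t) (normL d phi (m + t%:R - c%:R) w) =
  ssum (fun s => gbinom (t%:R : K) c *: (gbinom (s%:R : K) d *:
    a (Negz t) (a (Negz s) (phi (m + t%:R - c%:R + s%:R - d%:R) w)))).
  have fs := @normL_fin_supp d phi (m + t%:R - c%:R) w.
  rewrite linear_ssum// scaler_ssum; last first.
    by apply: fin_supp_sub fs _ => s ->; rewrite linear0.
  by apply: eq_ssum => s; rewrite linearZZ.
under eq_ssum do rewrite E; under [RHS]eq_ssum do rewrite E.
rewrite exchange_ssum.
  apply: eq_ssum => s; apply: eq_ssum => t; rewrite !scalerA heis_commN mulrC.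
  by congr (_ *: a _ (a _ (phi _ _))); ring.
have [B HB] := ftrunc phi w; have [N HN] := rat_arch B (m - i%:R - j%:R).
exists N => t s Hts; rewrite HB ?linear0 ?scaler0//.
have -> : m + t%:R - i%:R + s%:R - j%:R = m - i%:R - j%:R + (t + s)%:R by rewrite natrD; ring.
by apply: HN; lia.
Qed.

Lemma normRR i j phi m w : normR i (normRf j phi) m w = normR j (normRf i phi) m w.
Proof.
rewrite {1}/normR [in RHS]/normR /=.
have E (c d : nat) k : gbinom (- k%:R - 1 : K) c *: normR d phi (m - k%:R - c%:R - 1) (a (Posz k) w) =
  ssum (fun s => gbinom (- k%:R - 1 : K) c *: (gbinom (- s%:R - 1 : K) d *:
    phi (m - k%:R - c%:R - 1 - s%:R - d%:R - 1) (a (Posz s) (a (Posz k) w)))).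
  by rewrite scaler_ssum//; exact: normR_fin_supp.
under eq_ssum do rewrite E; under [RHS]eq_ssum do rewrite E.
have [N HN] := Ha.2 w.
rewrite exchange_ssum.
  apply: eq_ssum => s; apply: eq_ssum => t; rewrite !scalerA heis_commP mulrC.
  by congr (_ *: phi _ _); ring.
exists N => k s /orP[] /HN Hk; last rewrite heis_commP; by rewrite Hk !linear0 ?scaler0.
Qed.

Lemma normLR i j phi m w : normL i (normRf j phi) m w = normR j (normLf i phi) m w.
Proof.
rewrite {1}/normL [in RHS]/normR /=.
have E t : gbinom (t%:R : K) i *: a (Negz t) (normR j phi (m + t%:R - i%:R) w) =
  ssum (fun k => gbinom (t%:R : K) i *: (gbinom (- k%:R - 1 : K) j *:
    a (Negz t) (phi (m + t%:R - i%:R - k%:R - j%:R - 1) (a (Posz k) w)))).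
  have fs := @normR_fin_supp j phi (m + t%:R - i%:R) w.
  rewrite linear_ssum// scaler_ssum; last first.
    by apply: fin_supp_sub fs _ => s ->; rewrite linear0.
  by apply: eq_ssum => s; rewrite linearZZ.
have E' k : gbinom (- k%:R - 1 : K) j *: normL i phi (m - k%:R - j%:R - 1) (a (Posz k) w) =
  ssum (fun t => gbinom (- k%:R - 1 : K) j *: (gbinom (t%:R : K) i *:
    a (Negz t) (phi (m - k%:R - j%:R - 1 + t%:R - i%:R) (a (Posz k) w)))).
  by rewrite scaler_ssum//; exact: normL_fin_supp.
under eq_ssum do rewrite E; under [RHS]eq_ssum do rewrite E'.
rewrite exchange_ssum.
  apply: eq_ssum => k; apply: eq_ssum => t; rewrite !scalerA mulrC.
  by congr (_ *: a _ (phi _ _)); ring.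
apply/fin_supp2_sym/fin_supp2I.
  by have [N HN] := Ha.2 w; exists N => k t /HN->; rewrite !linear0 ?scaler0.
move=> k; apply/fin_suppZ/fin_suppZ; apply: fin_supp_sub
  (mfield_fin_supp phi (a (Posz k) w) (b := m - i%:R - k%:R - j%:R - 1)
    (f := fun t => m + t%:R - i%:R - k%:R - j%:R - 1) _) _.
  by move=> t; ring.
by move=> t ->; rewrite linear0.
Qed.

Lemma normal_swap i j phi m w : normal i (normalf j phi) m w = normal j (normalf i phi) m w.
Proof.
rewrite /normal; set N1 := normL i (normalf j phi) m w.
rewrite {}/N1 (@normLD i (normalf j phi) (normLf j phi) (normRf j phi))//.
rewrite (@normRD i (normalf j phi) (normLf j phi) (normRf j phi))//.
rewrite (@normLD j (normalf i phi) (normLf i phi) (normRf i phi))//.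
rewrite (@normRD j (normalf i phi) (normLf i phi) (normRf i phi))//.
rewrite (normLL i j) (normRR i j) (normLR i j) (normLR j i).
exact: addrACA.
Qed.

Lemma eq_normal j (phi psi : mfield) m w : (forall m w, phi m w = psi m w) ->
  normal j phi m w = normal j psi m w.
Proof.
by move=> E; congr (_ + _); apply: eq_ssum => t; rewrite E.
Qed.

End NormalOrder.

Lemma ssum_eq0 (M : zmodType) (F : nat -> M) : (forall i, F i = 0) -> ssum F = 0.
Proof. by move=> E; rewrite (eq_ssum E) ssum0. Qed.

Section Commutator.
Variables (K : numFieldType) (V M : lmodType K) (kappa : K).
Variables (a0 : int -> {linear V -> V}) (a : int -> {linear M -> M}).
Variable Y : V -> mfield M.
Hypothesis Ha0 : heisenberg_relations a0 kappa.
Hypothesis Ha : heisenberg_relations a kappa.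
Hypothesis YP : forall c u v m w, Y (c *: u + v) m w = c *: Y u m w + Y v m w.
Hypothesis YN : forall j u m w, Y (a0 (Negz j) u) m w = normal a j (Y u) m w.

Definition heis_covariant u := forall k m w, a k (Y u m w) = Y u m (a k w) +
  ssum (fun s => gbinom (k%:~R : K) s *: Y (a0 (Posz s) u) (m + k%:~R - s%:R) w).

Lemma heis_covariant_correction j u k m w :
  ssum (fun t => gbinom (t%:R : K) j *:
    ((if k + Negz t == 0 then kappa * k%:~R else 0) *: Y u (m + t%:R - j%:R) w))
  + ssum (fun q => gbinom (- q%:R - 1 : K) j *:
    ((if k + Posz q == 0 then kappa * k%:~R else 0) *: Y u (m - q%:R - j%:R - 1) w))
  = (kappa * k%:~R * gbinom (k%:~R - 1) j) *: Y u (m + k%:~R - j%:R - 1) w.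
Proof.
case: k => [[|t]|t].
- by rewrite !ssum_eq0 => [|q|t]; rewrite mulr0 ?if_same ?mul0r ?scale0r ?scaler0 ?addr0.
- rewrite [X in _ + X]ssum_eq0 ?addr0; last by move=> q; rewrite scale0r scaler0.
  rewrite (@ssum1 _ t); last first.
    move=> s st; rewrite (_ : _ == 0 = false) ?scale0r ?scaler0//.
    by apply/negbTE; apply: contra st; rewrite NegzE subr_eq0 eqz_nat eqSS eq_sym.
  rewrite NegzE subrr eqxx scalerA mulrC.
  have -> : (t.+1)%:~R - 1 = t%:R :> K by rewrite -[t.+1%:~R]/(t.+1%:R) -natr1 addrK.
  congr (_ *: Y u _ _).
  have -> : (Posz t.+1)%:~R = t%:R + 1 :> rat by rewrite -[LHS]/(t.+1%:R) natr1.
  by ring.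
- rewrite [X in X + _]ssum_eq0 ?add0r; last by move=> q; rewrite scale0r scaler0.
  rewrite (@ssum1 _ t.+1); last first.
    move=> s st; rewrite (_ : _ == 0 = false) ?scale0r ?scaler0//.
    by apply/negbTE; apply: contra st; rewrite NegzE addrC subr_eq0 eqz_nat.
  rewrite NegzE addNr eqxx scalerA mulrC.
  by congr (_ *: Y u _ _); rewrite rmorphN.
Qed.

Lemma heis_covariant_step j u : heis_covariant u -> heis_covariant (a0 (Negz j) u).
Proof.
move=> Hu k m w.
have YZ c v x y : Y (c *: v) x y = c *: Y v x y.
  exact: (@linear_funZ _ _ _ (fun v => Y v x y) (fun c v v' => YP c v v' x y)).
have Y0 x y : Y 0 x y = 0.
  exact: (@linear_fun0 _ _ _ (fun v => Y v x y) (fun c v v' => YP c v v' x y)).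
have [S0 HS0] := Ha0.2 u; have [N HN] := Ha.2 w.
have fsS (x : nat -> rat) (y : M) : fin_supp (fun s => gbinom (k%:~R : K) s *:
    Y (a0 (Posz s) u) (x s) y).
  by exists S0 => s /HS0->; rewrite Y0 scaler0.
have EL : a k (normL a j (Y u) m w) = normL a j (Y u) m (a k w)
  + ssum (fun s => gbinom (k%:~R : K) s *: normL a j (Y (a0 (Posz s) u)) (m + k%:~R - s%:R) w)
  + ssum (fun t => gbinom (t%:R : K) j *:
    ((if k + Negz t == 0 then kappa * k%:~R else 0) *: Y u (m + t%:R - j%:R) w)).
  rewrite {1}/normL linear_ssum; last exact: normL_fin_supp.
  have E t : a k (gbinom (t%:R : K) j *: a (Negz t) (Y u (m + t%:R - j%:R) w)) =
     gbinom (t%:R : K) j *: a (Negz t) (Y u (m + t%:R - j%:R) (a k w)) +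
     ssum (fun s => gbinom (t%:R : K) j *: (gbinom (k%:~R : K) s *:
       a (Negz t) (Y (a0 (Posz s) u) (m + t%:R - j%:R + k%:~R - s%:R) w))) +
     gbinom (t%:R : K) j *:
    ((if k + Negz t == 0 then kappa * k%:~R else 0) *: Y u (m + t%:R - j%:R) w).
    rewrite linearZZ Ha.1 Hu (linearD (a (Negz t))) !scalerDr; congr (_ + _ + _).
    rewrite linear_ssum// scaler_ssum; last first.
      by apply: fin_supp_sub (fsS (fun s => m + t%:R - j%:R + k%:~R - s%:R) w) _ => s ->; rewrite linear0.
    by apply: eq_ssum => s; rewrite linearZZ.
  have fs2 : fin_supp2 (fun t s : nat => gbinom (t%:R : K) j *: (gbinom (k%:~R : K) s *:
       a (Negz t) (Y (a0 (Posz s) u) (m + t%:R - j%:R + k%:~R - s%:R) w))).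
    apply/fin_supp2_sym/fin_supp2I.
      by exists S0 => s t /HS0->; rewrite Y0 linear0 !scaler0.
    move=> s; apply/fin_suppZ/fin_suppZ; apply: fin_supp_sub
      (mfield_fin_supp (Y (a0 (Posz s) u)) w (b := m - j%:R + k%:~R - s%:R)
      (f := fun t => m + t%:R - j%:R + k%:~R - s%:R) _) _; first by move=> t; ring.
    by move=> t ->; rewrite linear0.
  have fsL : fin_supp (fun t => gbinom (t%:R : K) j *: a (Negz t) (Y u (m + t%:R - j%:R) (a k w))).
    exact: normL_fin_supp.
  rewrite (eq_ssum E) ssumD; first last.
  - apply/fin_suppZ/fin_suppZ/(mfield_fin_supp _ _ (b := m - j%:R)) => t; ring.
  - by apply: fin_suppD => //; exact: fin_supp_ssum.
  rewrite ssumD//; last exact: fin_supp_ssum.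
  congr (_ + _ + _); rewrite exchange_ssum//; apply: eq_ssum => s.
  rewrite scaler_ssum; last exact: normL_fin_supp.
  by apply: eq_ssum => t; rewrite !scalerA mulrC; congr (_ *: a _ (Y _ _ _)); ring.
have ER : a k (normR a j (Y u) m w) = normR a j (Y u) m (a k w)
  + ssum (fun s => gbinom (k%:~R : K) s *: normR a j (Y (a0 (Posz s) u)) (m + k%:~R - s%:R) w)
  + ssum (fun q => gbinom (- q%:R - 1 : K) j *:
    ((if k + Posz q == 0 then kappa * k%:~R else 0) *: Y u (m - q%:R - j%:R - 1) w)).
  rewrite {1}/normR linear_ssum; last exact: normR_fin_supp Ha _ _ _ _.
  have E q : a k (gbinom (- q%:R - 1 : K) j *: Y u (m - q%:R - j%:R - 1) (a (Posz q) w)) =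
     gbinom (- q%:R - 1 : K) j *: Y u (m - q%:R - j%:R - 1) (a (Posz q) (a k w)) +
     ssum (fun s => gbinom (- q%:R - 1 : K) j *: (gbinom (k%:~R : K) s *:
       Y (a0 (Posz s) u) (m - q%:R - j%:R - 1 + k%:~R - s%:R) (a (Posz q) w))) +
     gbinom (- q%:R - 1 : K) j *:
    ((if k + Posz q == 0 then kappa * k%:~R else 0) *: Y u (m - q%:R - j%:R - 1) w).
    rewrite linearZZ Hu Ha.1 (linearD (Y u _)) linearZZ !scalerDr addrAC; congr (_ + _ + _).
    by rewrite scaler_ssum.
  have fs2 : fin_supp2 (fun q s : nat => gbinom (- q%:R - 1 : K) j *: (gbinom (k%:~R : K) s *:
       Y (a0 (Posz s) u) (m - q%:R - j%:R - 1 + k%:~R - s%:R) (a (Posz q) w))).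
    apply/fin_supp2_sym/fin_supp2I.
      by exists S0 => s t /HS0->; rewrite Y0 !scaler0.
    by move=> s; exists N => q /HN->; rewrite linear0 !scaler0.
  have fsR : fin_supp (fun q => gbinom (- q%:R - 1 : K) j *: Y u (m - q%:R - j%:R - 1) (a (Posz q) (a k w))).
    exact: normR_fin_supp Ha _ _ _ _.
  rewrite (eq_ssum E) ssumD; first last.
  - exists `|k|.+1%N => q Hq; rewrite (_ : _ == 0 = false) ?scale0r ?scaler0//.
    by apply/negbTE/eqP => Hk; move: Hq; lia.
  - by apply: fin_suppD => //; exact: fin_supp_ssum.
  rewrite ssumD//; last exact: fin_supp_ssum.
  congr (_ + _ + _); rewrite exchange_ssum//; apply: eq_ssum => s.
  rewrite scaler_ssum; last exact: normR_fin_supp Ha _ _ _ _.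
  by apply: eq_ssum => t; rewrite !scalerA mulrC; congr (_ *: Y _ _ _); ring.
have fsL : fin_supp (fun s => gbinom (k%:~R : K) s *: normL a j (Y (a0 (Posz s) u)) (m + k%:~R - s%:R) w).
  exists S0 => s /HS0 Hs; rewrite /normL ssum_eq0 ?scaler0// => t.
  by rewrite Hs Y0 linear0 scaler0.
have fsR : fin_supp (fun s => gbinom (k%:~R : K) s *: normR a j (Y (a0 (Posz s) u)) (m + k%:~R - s%:R) w).
  exists S0 => s /HS0 Hs; rewrite /normR ssum_eq0 ?scaler0// => t.
  by rewrite Hs Y0 scaler0.
have ES s : gbinom (k%:~R : K) s *: Y (a0 (Posz s) (a0 (Negz j) u)) (m + k%:~R - s%:R) w =
    gbinom (k%:~R : K) s *: normL a j (Y (a0 (Posz s) u)) (m + k%:~R - s%:R) w +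
    gbinom (k%:~R : K) s *: normR a j (Y (a0 (Posz s) u)) (m + k%:~R - s%:R) w +
    (if s == j.+1 then gbinom (k%:~R : K) s * (kappa * s%:R) else 0) *:
      Y u (m + k%:~R - s%:R) w.
  rewrite Ha0.1 addrC YP YN !scalerDr addrC scalerA; congr (_ + _ *: _).
  by rewrite NegzE subr_eq0 eqz_nat; case: ifP; rewrite ?mulr0.
rewrite (eq_ssum ES) ssumD; first last.
- by exists j.+2 => s Hs; rewrite (_ : _ == _ = false) ?scale0r//; lia.
- exact: fin_suppD.
rewrite ssumD// (@ssum1 _ j.+1 (fun s => (if s == j.+1 then _ else _) *: _)); last first.
  by move=> s /negPf->; rewrite scale0r.
rewrite eqxx !YN /normal (linearD (a k)) EL ER.
set L1 := normL _ _ _ _ _; set R1 := normR _ _ _ _ _.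
set L2 := ssum _; set R2 := ssum (fun s => _ *: normR _ _ _ _ _).
set C1 := ssum _; set C2 := ssum _.
transitivity (L1 + R1 + (L2 + R2) + (C1 + C2)); last first.
  rewrite -addrA; congr (_ + (_ + _)); rewrite /C1 /C2 heis_covariant_correction.
  have := gbinomSl (k%:~R : K) j => Ej.
  have -> : gbinom (k%:~R : K) j.+1 * (kappa * j.+1%:R) =
      kappa * (j.+1%:R * gbinom (k%:~R : K) j.+1) by ring.
  rewrite Ej mulrA; congr (_ *: Y _ _ _).
  by rewrite -[in RHS]natr1; ring.
by rewrite addrACA [L1 + L2 + _]addrACA.
Qed.
End Commutator.

(** * Exponential series *)

Section ExponentialCoefficients.
Variables (K : numFieldType) (M : lmodType K).
Implicit Types (X : nat -> {linear M -> M}) (x : rat) (w : M).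

Definition commuting X X' := forall i j w, X i (X' j w) = X' j (X i w).

Fixpoint opow X j k w : M :=
  if j is j'.+1 then \sum_(i < k.+1) X i (opow X j' (k - i)%N w)
  else if k == 0%N then w else 0.

Definition oexp X k w : M := \sum_(j < k.+1) (j`!%:R : K)^-1 *: opow X j k w.

(* Indexed by a rational degree, and zero unless that degree is a natural
   number. *)
Definition powq X j x w := if x \is a Num.nat then opow X j (Num.truncn x) w else 0.
Definition expq X x w := if x \is a Num.nat then oexp X (Num.truncn x) w else 0.

Lemma powq_nat X j n w : powq X j n%:R w = opow X j n w.
Proof. by rewrite /powq natr_nat natrK. Qed.

Lemma expq_nat X n w : expq X n%:R w = oexp X n w.
Proof. by rewrite /expq natr_nat natrK. Qed.

Lemma powq_nnat X j x w : x \isn't a Num.nat -> powq X j x w = 0.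
Proof. by rewrite /powq => /negPf->. Qed.

Lemma expq_nnat X x w : x \isn't a Num.nat -> expq X x w = 0.
Proof. by rewrite /expq => /negPf->. Qed.

Lemma opow_linear X j n : linear (opow X j n).
Proof.
elim: j n => [|j IH] k c u v /=; first by case: (k == 0%N); rewrite ?scaler0 ?addr0.
rewrite scaler_sumr -big_split/=; apply: eq_bigr => i _.
by rewrite IH linearP.
Qed.

Lemma oexp_linear X n : linear (oexp X n).
Proof.
move=> c u v; rewrite /oexp scaler_sumr -big_split/=.
apply: eq_bigr => i _; rewrite opow_linear scalerDr.
by congr (_ + _); rewrite !scalerA mulrC.
Qed.

Lemma powq_linear X j x : linear (powq X j x).
Proof.
move=> c u v; have [/natrP[n ->]|xn] := boolP (x \is a Num.nat).
  by rewrite !powq_nat opow_linear.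
by rewrite !powq_nnat// scaler0 addr0.
Qed.

Lemma expq_linear X x : linear (expq X x).
Proof.
move=> c u v; have [/natrP[n ->]|xn] := boolP (x \is a Num.nat).
  by rewrite !expq_nat oexp_linear.
by rewrite !expq_nnat// scaler0 addr0.
Qed.

HB.instance Definition _ X j x :=
  GRing.isLinear.Build K M M *:%R (powq X j x) (powq_linear X j x).
HB.instance Definition _ X x :=
  GRing.isLinear.Build K M M *:%R (expq X x) (expq_linear X x).

Lemma nat_rat_ge0 x : x \is a Num.nat -> 0 <= x.
Proof. by move=> /natrP[n ->]. Qed.

Lemma nat_ratB x i : x - i%:R \is a Num.nat -> x \is a Num.nat.
Proof.
move=> /natrP[n xn]; apply/natrP; exists (n + i)%N.
by rewrite natrD -xn subrK.
Qed.

Lemma lt0_rat_nnat x : x < 0 -> x \isn't a Num.nat.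
Proof. by move=> x0; apply/negP => /nat_rat_ge0; rewrite leNgt x0. Qed.

Lemma powq_lt0 X j x w : x < 0 -> powq X j x w = 0.
Proof. by move=> /lt0_rat_nnat; exact: powq_nnat. Qed.

Lemma expq_lt0 X x w : x < 0 -> expq X x w = 0.
Proof. by move=> /lt0_rat_nnat; exact: expq_nnat. Qed.

Lemma rat_sub_lt0 x : exists N : nat, forall i, (N <= i)%N -> x - i%:R < 0.
Proof.
have [N HN] := rat_arch (x + 1) 0; exists N => i /HN.
by rewrite add0r subr_lt0 => /(lt_le_trans _); apply; rewrite ltrDl.
Qed.

Lemma rat_sub_lt0W x i k : x - i%:R < 0 -> x - i%:R - k%:R < 0.
Proof. by apply: le_lt_trans; rewrite lerBlDr lerDl. Qed.

Lemma powq0 X x w : powq X 0 x w = if x == 0 then w else 0.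
Proof.
have [/natrP[n ->]|xn] := boolP (x \is a Num.nat).
  by rewrite powq_nat/= pnatr_eq0.
rewrite powq_nnat//; case: eqP => // x0.
by rewrite x0 rpred0 in xn.
Qed.

Lemma powqS X j x w : powq X j.+1 x w = ssum (fun i => X i (powq X j (x - i%:R) w)).
Proof.
have [/natrP[n ->]|xn] := boolP (x \is a Num.nat); last first.
  rewrite powq_nnat// ssum_eq0// => i; rewrite powq_nnat ?linear0//.
  by apply: contra xn; apply: nat_ratB.
rewrite powq_nat /= (@ssumE _ _ n.+1); last first.
  by move=> i Hi; rewrite powq_lt0 ?linear0// subr_lt0 ltr_nat.
apply: eq_bigr => i _; have Hi : (i <= n)%N by rewrite -ltnS.
by rewrite -natrB// powq_nat.
Qed.

Lemma powq_fin_supp X j x w (c : nat -> K) :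
  fin_supp (fun i => c i *: X i (powq X j (x - i%:R) w)).
Proof.
have [N HN] := rat_sub_lt0 x; exists N => i /HN Hi.
by rewrite powq_lt0// linear0 scaler0.
Qed.

Lemma powq_fin_supp1 X j x w : fin_supp (fun i => X i (powq X j (x - i%:R) w)).
Proof.
by apply: fin_supp_sub (powq_fin_supp X j x w (fun=> 1)) _ => i; rewrite scale1r.
Qed.

Lemma powq_fin_supp2 X j x w (c c' : nat -> K) :
  fin_supp2 (fun i k => c i *: X i (c' k *: X k (powq X j (x - i%:R - k%:R) w))).
Proof.
have [N HN] := rat_sub_lt0 x; exists N => i k /orP[] /HN Hi.
  by rewrite powq_lt0 ?linear0 ?scaler0 ?linear0 ?scaler0//; exact: rat_sub_lt0W.
rewrite [x - _ - _]addrAC powq_lt0 ?linear0 ?scaler0 ?linear0 ?scaler0//.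
exact: rat_sub_lt0W.
Qed.

Lemma powq_deriv X j x w : commuting X X ->
  ratr x *: powq X j.+1 x w =
  j.+1%:R *: ssum (fun i => i%:R *: X i (powq X j (x - i%:R) w)).
Proof.
move=> XC; elim: j x => [|j IH] x.
  rewrite scale1r powqS scaler_ssum; last first.
    exact: powq_fin_supp1.
  apply: eq_ssum => i; rewrite powq0; case: eqP => [|_]; last by rewrite linear0 !scaler0.
  by move/eqP; rewrite subr_eq0 => /eqP->; rewrite ratr_nat.
rewrite powqS scaler_ssum; last first.
  exact: powq_fin_supp1.
have E i : ratr x *: X i (powq X j.+1 (x - i%:R) w) =
    i%:R *: X i (powq X j.+1 (x - i%:R) w) +
    ssum (fun k => j.+1%:R *: X i (k%:R *: X k (powq X j (x - i%:R - k%:R) w))).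
  have {1}-> : x = i%:R + (x - i%:R) by rewrite addrC subrK.
  rewrite rmorphD/= ratr_nat scalerDl -[ratr (x - _) *: _]linearZZ IH linearZZ.
  have fsk := powq_fin_supp X j (x - i%:R) w (fun k => k%:R).
  congr (_ + _); rewrite linear_ssum// scaler_ssum//.
  by apply: fin_supp_sub fsk _ => k ->; rewrite linear0.
have fs2 : fin_supp2 (fun i k => j.+1%:R *: X i (k%:R *: X k (powq X j (x - i%:R - k%:R) w))).
  exact: (powq_fin_supp2 X j x w (fun=> _) (fun k => k%:R)).
rewrite (eq_ssum E) ssumD; first last.
- exact: fin_supp_ssum.
- exact: powq_fin_supp.
rewrite exchange_ssum// -[j.+2]addn1 natrD scalerDl scale1r addrC; congr (_ + _).
rewrite scaler_ssum; last exact: powq_fin_supp.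
apply: eq_ssum => k; rewrite powqS [in RHS]linear_ssum; last first.
  exact: powq_fin_supp1.
have fsi : fin_supp (fun i => X k (X i (powq X j (x - k%:R - i%:R) w))).
  by apply: fin_supp_sub (powq_fin_supp1 X j (x - k%:R) w) _ => i ->; rewrite linear0.
rewrite (scaler_ssum _ fsi) (scaler_ssum _ (fin_suppZ (fun=> k%:R) fsi)).
apply: eq_ssum => i; rewrite (linearZZ (X i)) XC.
by rewrite [x - i%:R - k%:R]addrAC.
Qed.

Lemma powq_gt X j x w : (forall w, X 0%N w = 0) -> x < j%:R -> powq X j x w = 0.
Proof.
move=> X0; elim: j x => [|j IH] x xj; first by rewrite powq_lt0.
rewrite powqS ssum_eq0// => -[|i]; first by rewrite X0.
rewrite IH ?linear0//; apply: le_lt_trans (_ : x - 1 < _); first by rewrite lerB// ler1n.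
by rewrite ltrBlDr natr1.
Qed.

Lemma expqE X x w : (forall w, X 0%N w = 0) ->
  expq X x w = ssum (fun j => (j`!%:R : K)^-1 *: powq X j x w).
Proof.
move=> X0; have [/natrP[n ->]|xn] := boolP (x \is a Num.nat); last first.
  by rewrite expq_nnat// ssum_eq0// => j; rewrite powq_nnat// scaler0.
rewrite expq_nat /oexp (@ssumE _ _ n.+1); last first.
  by move=> i Hi; rewrite powq_gt ?scaler0// ltr_nat.
by apply: eq_bigr => i _; rewrite powq_nat.
Qed.

Lemma expq0 X w : expq X 0 w = w.
Proof.
rewrite -[0]/(0%:R) expq_nat /oexp big_ord1 fact0 invr1 scale1r.
by rewrite -powq_nat powq0 eqxx.
Qed.

Lemma expq_fin_supp X x w (c : nat -> K) :
  fin_supp (fun i => c i *: X i (expq X (x - i%:R) w)).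
Proof.
have [N HN] := rat_sub_lt0 x; exists N => i /HN Hi.
by rewrite expq_lt0// linear0 scaler0.
Qed.

Lemma expq_rec X x w : commuting X X -> (forall w, X 0%N w = 0) ->
  ratr x *: expq X x w = ssum (fun i => i%:R *: X i (expq X (x - i%:R) w)).
Proof.
move=> XC X0; rewrite expqE//.
have fsp y : fin_supp (fun j => (j`!%:R : K)^-1 *: powq X j y w).
  have [N HN] := rat_arch (y + 1) 0; exists N => j /HN.
  rewrite add0r => Hj; rewrite powq_gt ?scaler0//.
  by apply: lt_le_trans Hj; rewrite ltrDl.
rewrite scaler_ssum// (ssum_shift (s := 1%N)); first last.
- exact: (fin_suppZ (fun=> ratr x)).
- case=> // _; rewrite powq0; case: eqP => [->|_]; last by rewrite !scaler0.
  by rewrite rmorph0 scale0r.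
have E j : ratr x *: (((1 + j)`!%:R : K)^-1 *: powq X (1 + j) x w) =
   ssum (fun i => (j`!%:R : K)^-1 *: (i%:R *: X i (powq X j (x - i%:R) w))).
  rewrite add1n scalerA mulrC -scalerA powq_deriv// scalerA factS natrM.
  rewrite invfM mulrAC mulVf ?pnatr_eq0// mul1r scaler_ssum//.
  exact: powq_fin_supp.
rewrite (eq_ssum E) exchange_ssum; last first.
  apply/fin_supp2_sym/fin_supp2I.
    have [N HN] := rat_sub_lt0 x; exists N => i k /HN Hi.
    by rewrite powq_lt0 ?linear0 ?scaler0 ?linear0 ?scaler0.
  move=> i; apply: fin_supp_sub (fsp (x - i%:R)) _ => j Hj.
  by rewrite scalerA mulrC -scalerA -(linearZZ (X i)) Hj linear0 scaler0.
apply: eq_ssum => i; rewrite expqE// linear_ssum// scaler_ssum; last first.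
  by apply: fin_supp_sub (fsp (x - i%:R)) _ => j ->; rewrite linear0.
by apply: eq_ssum => j; rewrite (linearZZ (X i)) !scalerA mulrC.
Qed.

Lemma expq_comm X (Z : {linear M -> M}) (c : K) (k : nat) x w :
  commuting X X -> (forall w, X 0%N w = 0) -> (0 < k)%N ->
  (forall i w, Z (X i w) = X i (Z w) + (if i == k then c else 0) *: w) ->
  Z (expq X x w) = expq X x (Z w) + c *: expq X (x - k%:R) w.
Proof.
move=> XC X0 k0 ZX.
have [N] : exists N : nat, x < N%:R.
  have [N HN] := rat_arch (x + 1) 0; exists N; have := HN _ (leqnn _).
  by rewrite add0r; apply: lt_le_trans; rewrite ltrDl.
elim: N x => [|N IH] x xN.
  have xk : x - k%:R < 0 by rewrite ltrBlDr (lt_le_trans xN)// add0r ler0n.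
  by rewrite !expq_lt0// linear0 scaler0 addr0.
have [->|x0] := eqVneq x 0.
  by rewrite !expq0 sub0r expq_lt0 ?scaler0 ?addr0// oppr_lt0 ltr0n.
have rx0 : ratr x != 0 :> K by rewrite fmorph_eq0.
apply: (scalerI rx0); rewrite -(linearZZ Z) scalerDr !expq_rec//.
rewrite (linear_ssum Z); last exact: expq_fin_supp.
have E i : Z (i%:R *: X i (expq X (x - i%:R) w)) =
   i%:R *: X i (expq X (x - i%:R) (Z w)) + c *: (i%:R *: X i (expq X (x - k%:R - i%:R) w))
   + (if i == k then k%:R * c else 0) *: expq X (x - k%:R) w.
  rewrite (linearZZ Z) ZX; case: i => [|i]; first by rewrite !scale0r scaler0 !add0r eq_sym (gtn_eqF k0) scale0r.
  rewrite IH; last first.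
    by apply: le_lt_trans (_ : x - 1 < _); rewrite ?lerB ?ler1n// ltrBlDr natr1.
  rewrite (linearD (X i.+1)) (linearZZ (X i.+1)) !scalerDr !scalerA; congr (_ + _ + _).
    by rewrite mulrC addrAC.
  by case: eqP => [->//|_]; rewrite mulr0 !scale0r.
rewrite (eq_ssum E) ssumD; first last.
- by exists k.+1 => i Hi; rewrite gtn_eqF// scale0r.
- apply: fin_suppD; first exact: expq_fin_supp.
  exact/(fin_suppZ (fun=> c))/expq_fin_supp.
rewrite ssumD; first last.
- exact/(fin_suppZ (fun=> c))/expq_fin_supp.
- exact: expq_fin_supp.
rewrite -addrA; congr (_ + _).
rewrite -scaler_ssum; last exact: expq_fin_supp.
rewrite -expq_rec// (@ssum1 _ k); last by move=> i /negPf->; rewrite scale0r.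
rewrite eqxx !scalerA -scalerDl; congr (_ *: _).
by rewrite rmorphB/= ratr_nat; ring.
Qed.

Lemma expq_commute X (Z : {linear M -> M}) x w :
  commuting X X -> (forall w, X 0%N w = 0) ->
  (forall i w, Z (X i w) = X i (Z w)) -> Z (expq X x w) = expq X x (Z w).
Proof.
move=> XC X0 ZX; rewrite (@expq_comm X Z 0 1%N)// ?scale0r ?addr0//.
by move=> i v; rewrite if_same scale0r addr0.
Qed.

Lemma expq_add X X' X'' x w : commuting X X -> commuting X' X' -> commuting X X' ->
  (forall w, X 0%N w = 0) -> (forall w, X' 0%N w = 0) ->
  (forall i w, X'' i w = X i w + X' i w) ->
  expq X'' x w = ssum (fun r => expq X r%:R (expq X' (x - r%:R) w)).
Proof.
move=> C1 C2 C12 Z1 Z2 XE.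
have C3 : commuting X'' X''.
  move=> i j v; rewrite !XE !linearD/= C1 C2 C12 -!addrA; congr (_ + _).
  by rewrite C12 addrCA.
have Z3 v : X'' 0%N v = 0 by rewrite XE Z1 Z2 addr0.
have [N] : exists N : nat, x < N%:R.
  have [N HN] := rat_arch (x + 1) 0; exists N; have := HN _ (leqnn _).
  by rewrite add0r; apply: lt_le_trans; rewrite ltrDl.
elim: N x => [|N IH] x xN.
  rewrite expq_lt0// ssum_eq0// => r; rewrite (@expq_lt0 X') ?linear0//.
  by rewrite ltrBlDr (lt_le_trans xN)// add0r ler0n.
have [->|x0] := eqVneq x 0.
  rewrite expq0 (@ssum1 _ 0%N) ?subr0 ?expq0//.
  by move=> i i0; rewrite sub0r (@expq_lt0 X') ?linear0// oppr_lt0 ltr0n lt0n.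
have rx0 : ratr x != 0 :> K by rewrite fmorph_eq0.
apply: (scalerI rx0); rewrite expq_rec//.
have fsC y : fin_supp (fun r => expq X r%:R (expq X' (y - r%:R) w)).
  have [P HP] := rat_sub_lt0 y; exists P => i /HP Hi.
  by rewrite (@expq_lt0 X')// linear0.
rewrite scaler_ssum//.
have E r : ratr x *: expq X r%:R (expq X' (x - r%:R) w) =
   ssum (fun i => i%:R *: X i (expq X (r%:R - i%:R) (expq X' (x - r%:R) w))) +
   ssum (fun i => i%:R *: X' i (expq X r%:R (expq X' (x - r%:R - i%:R) w))).
  have {1}-> : x = r%:R + (x - r%:R) by rewrite addrC subrK.
  rewrite rmorphD/= scalerDl expq_rec//; congr (_ + _).
  rewrite -(linearZZ (expq X r%:R)) expq_rec// (linear_ssum (expq X r%:R)); last exact: expq_fin_supp.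
  apply: eq_ssum => i; rewrite (linearZZ (expq X r%:R)); congr (_ *: _).
  by rewrite (@expq_commute X (X' i))// => k v; rewrite C12.
have fsA : fin_supp2 (fun r i => i%:R *: X i (expq X (r%:R - i%:R) (expq X' (x - r%:R) w))).
  apply: fin_supp2I; last by move=> r; apply: expq_fin_supp.
  have [P HP] := rat_sub_lt0 x; exists P => r i /HP Hr.
  by rewrite (@expq_lt0 X')// !linear0 ?scaler0.
have fsB : fin_supp2 (fun r i => i%:R *: X' i (expq X r%:R (expq X' (x - r%:R - i%:R) w))).
  have [P HP] := rat_sub_lt0 x; exists P => r i /orP[] /HP Hr.
    by rewrite (@expq_lt0 X') ?linear0 ?scaler0//; exact: rat_sub_lt0W.
  rewrite [x - _ - _]addrAC (@expq_lt0 X') ?linear0 ?scaler0//.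
  exact: rat_sub_lt0W.
rewrite (eq_ssum E) ssumD; try exact: fin_supp_ssum.
rewrite exchange_ssum// [X in _ = _ + X]exchange_ssum// -ssumD; first last.
- exact/fin_supp_ssum/fin_supp2_sym.
- exact/fin_supp_ssum/fin_supp2_sym.
apply: eq_ssum => -[|i].
  by rewrite scale0r !ssum_eq0 ?addr0// => r; rewrite scale0r.
rewrite IH; last by apply: le_lt_trans (_ : x - 1 < _); rewrite ?lerB ?ler1n// ltrBlDr natr1.
rewrite XE scalerDr (linear_ssum (X i.+1))// (linear_ssum (X' i.+1))//; congr (_ + _); rewrite scaler_ssum; first last.
- by apply: fin_supp_sub (fsC (x - i.+1%:R)) _ => r ->; rewrite linear0.
- by apply: eq_ssum => r; rewrite addrAC.
- by apply: fin_supp_sub (fsC (x - i.+1%:R)) _ => r ->; rewrite linear0.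
rewrite [RHS](ssum_shift (s := i.+1)); first last.
- by have [P HP] := fsA; exists P => r Hr; apply: HP; rewrite Hr.
- by move=> r Hr; rewrite expq_lt0 ?linear0 ?scaler0// subr_lt0 ltr_nat.
apply: eq_ssum => r; congr (_ *: X _ (expq _ _ (expq _ _ _))).
  by rewrite [(_ + r)%:R]natrD; ring.
by rewrite [(_ + r)%:R]natrD; ring.
Qed.

End ExponentialCoefficients.

Lemma linearPZ (K : nzRingType) (M M' : lmodType K) (T : {linear M -> M'}) z u v :
  T (z *: u + v) = z *: T u + T v.
Proof. exact: linearP. Qed.

Section ExponentialField.
Variables (K : numFieldType) (M : lmodType K) (a : int -> {linear M -> M}).
Variable kappa : K.
Hypothesis Ha : heisenberg_relations a kappa.

Definition creation (c : rat) (i : nat) : {linear M -> M} :=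
  if i is j.+1 then (ratr c / j.+1%:R : K) \*: a (Negz j) else \0.

Definition annihilation (c : rat) (i : nat) : {linear M -> M} :=
  if i is j.+1 then (- (ratr c / j.+1%:R) : K) \*: a (Posz j.+1) else \0.

Lemma creation_commuting c c' : commuting (creation c) (creation c').
Proof.
move=> [|i] [|j] w //=; rewrite ?linear0 ?scaler0 ?linear0//.
by rewrite (linearZZ (a (Negz i))) (linearZZ (a (Negz j))) (heis_commN Ha) !scalerA mulrC.
Qed.

Lemma annihilation_commuting c c' : commuting (annihilation c) (annihilation c').
Proof.
move=> [|i] [|j] w //=; rewrite ?linear0 ?scaler0 ?linear0//.
by rewrite (linearZZ (a (Posz i.+1))) (linearZZ (a (Posz j.+1))) (heis_commP Ha) !scalerA mulrC.
Qed.

Definition expC c := expq (creation c).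
Definition expA c := expq (annihilation c).

HB.instance Definition _ c x := GRing.Linear.on (expC c x).
HB.instance Definition _ c x := GRing.Linear.on (expA c x).

Lemma expC_commN c j x w : a (Negz j) (expC c x w) = expC c x (a (Negz j) w).
Proof.
apply: expq_commute => [||[|i] v] /=; rewrite ?linear0//.
- exact: creation_commuting.
- by rewrite (linearZZ (a (Negz j))) (heis_commN Ha).
Qed.

Lemma expC_comm0 c x w : a (Posz 0) (expC c x w) = expC c x (a (Posz 0) w).
Proof.
apply: expq_commute => [||[|i] v] /=; rewrite ?linear0//.
- exact: creation_commuting.
- by rewrite (linearZZ (a (Posz 0))) Ha.1 scale0r addr0.
Qed.

Lemma expC_commP c k x w : a (Posz k.+1) (expC c x w) =
  expC c x (a (Posz k.+1) w) + (kappa * ratr c) *: expC c (x - k.+1%:R) w.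
Proof.
apply: expq_comm => [||//|[|i] v] /=.
- exact: creation_commuting.
- by [].
- by rewrite !linear0 scale0r addr0.
rewrite (linearZZ (a (Posz k.+1))) Ha.1 scalerDr scalerA; congr (_ + _ *: _).
rewrite NegzE subr_eq0 eqz_nat [k.+1 == _]eq_sym.
case: eqP => [[->]|_]; last by rewrite mulr0.
have Sk : k.+1%:R != 0 :> K by rewrite pnatr_eq0.
by rewrite mulrCA divfK.
Qed.

Lemma expA_commP c k x w : a (Posz k) (expA c x w) = expA c x (a (Posz k) w).
Proof.
apply: expq_commute => [||[|i] v] /=; rewrite ?linear0//.
- exact: annihilation_commuting.
- by rewrite (linearZZ (a (Posz k))) (heis_commP Ha).
Qed.

Lemma expA_commN c k x w : a (Negz k) (expA c x w) =
  expA c x (a (Negz k) w) + (kappa * ratr c) *: expA c (x - k.+1%:R) w.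
Proof.
apply: expq_comm => [||//|[|i] v] /=.
- exact: annihilation_commuting.
- by [].
- by rewrite !linear0 scale0r addr0.
rewrite (linearZZ (a (Negz k))) Ha.1 scalerDr scalerA; congr (_ + _ *: _).
rewrite NegzE [- _ + _]addrC subr_eq0 eqz_nat.
case: eqP => [[->]|_]; last by rewrite mulr0.
have Sk : k.+1%:R != 0 :> K by rewrite pnatr_eq0.
by rewrite rmorphN/= mulrN mulNr mulrN opprK mulrCA divfK.
Qed.

Definition expA_finite c w := fin_supp (fun l => expA c l%:R w).

Lemma expA_finite_step c k w : expA_finite c w -> expA_finite c (a (Negz k) w).
Proof.
move=> [N HN]; exists (N + k.+1)%N => l Hl.
have := expA_commN c k l%:R w; rewrite HN ?(leq_trans _ Hl) ?leq_addr// linear0.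
rewrite -natrB ?(leq_trans _ Hl) ?leq_addl//.
by rewrite HN ?scaler0 ?addr0// leq_subRL ?(leq_trans _ Hl) ?leq_addl// addnC.
Qed.

Definition vacuum_like w := forall k, a (Posz k.+1) w = 0.

Lemma expA_vacuum c w : vacuum_like w -> forall x, x != 0 -> expA c x w = 0.
Proof.
move=> Hw x x0; have rx0 : ratr x != 0 :> K by rewrite fmorph_eq0.
apply: (scalerI rx0); rewrite scaler0 expq_rec//; last exact: annihilation_commuting.
rewrite ssum_eq0// => -[|i]; first by rewrite scale0r.
rewrite /= (_ : a (Posz i.+1) (expq _ _ w) = 0) ?scaler0//.
by rewrite (expA_commP c) Hw linear0.
Qed.

Lemma expA_finite_vacuum c w : vacuum_like w -> expA_finite c w.
Proof.
move=> Hw; exists 1%N => l Hl; apply: expA_vacuum => //.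
by rewrite pnatr_eq0 -lt0n.
Qed.

Variables (c : rat) (T : {linear M -> M}) (E : mfield M).
Hypothesis T_comm : forall k w, a k (T w) =
  T (a k w) + (if k == 0 then kappa * ratr c else 0) *: T w.
Hypothesis expA_fin : forall w, expA_finite c w.
Hypothesis E_formula : forall w r m, a (Posz 0) w = ratr r *: w ->
  E m w = ssum (fun l => T (expC c (- m - 1 - c * r + l%:R) (expA c l%:R w))).
Hypothesis weight_span : forall P : M -> Prop, P 0 ->
  (forall z u v, P u -> P v -> P (z *: u + v)) ->
  (forall w r, a (Posz 0) w = ratr r *: w -> P w) -> forall w, P w.

Lemma exp_terms_fin_supp (f : nat -> rat) w : fin_supp (fun l =>
  T (expC c (f l) (expA c l%:R w))).
Proof. by apply: fin_supp_sub (expA_fin w) _ => l ->; rewrite !linear0. Qed.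

Lemma exp_covariant k m w : a k (E m w) =
  E m (a k w) + (kappa * ratr c) *: E (m + k%:~R) w.
Proof.
move: w; apply: weight_span => [|z u v Hu Hv|w r Hw].
- by rewrite !linear0 ?scaler0 addr0.
- rewrite (linearPZ (E m)) (linearPZ (a k)) Hu Hv (linearPZ (a k)) (linearPZ (E m)).
  rewrite (linearPZ (E (m + k%:~R))) !scalerDr addrACA; congr (_ + (_ + _)).
  by rewrite !scalerA mulrC.
have Hk : a (Posz 0) (a k w) = ratr r *: a k w.
  rewrite Ha.1 Hw (linearZZ (a k)); case: k => [k|k]; last by rewrite scale0r addr0.
  by rewrite mulr0 if_same scale0r addr0.
rewrite (E_formula _ Hw) (E_formula _ Hk) (E_formula (m + k%:~R) Hw).
rewrite linear_ssum; last exact: exp_terms_fin_supp.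
rewrite scaler_ssum; last exact: exp_terms_fin_supp.
case: k {Hk} => [[|k]|k].
- rewrite -ssumD; try by [exact: exp_terms_fin_supp|exact/(fin_suppZ (fun=> _))/exp_terms_fin_supp].
  by apply: eq_ssum => l; rewrite T_comm eqxx expC_comm0 expA_commP addr0.
- rewrite -ssumD; try by [exact: exp_terms_fin_supp|exact/(fin_suppZ (fun=> _))/exp_terms_fin_supp].
  apply: eq_ssum => l; rewrite T_comm scale0r addr0 expC_commP expA_commP.
  rewrite (linearD T) (linearZZ T); congr (_ + _ *: T (expC _ _ _)).
  by rewrite -[k.+1%:~R]/(k.+1%:R); ring.
have Ek l : a (Negz k) (T (expC c (- m - 1 - c * r + l%:R) (expA c l%:R w))) =
  T (expC c (- m - 1 - c * r + l%:R) (expA c l%:R (a (Negz k) w))) +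
  (kappa * ratr c) *: T (expC c (- m - 1 - c * r + l%:R) (expA c (l%:R - k.+1%:R) w)).
  rewrite T_comm scale0r addr0 expC_commN expA_commN.
  by rewrite (linearD (expC c _)) (linearD T) (linearZZ (expC c _)) (linearZZ T).
have fs : fin_supp (fun l => T (expC c (- m - 1 - c * r + l%:R) (expA c (l%:R - k.+1%:R) w))).
  have [N HN] := expA_fin w; exists (N + k.+1)%N => l Hl.
  rewrite -natrB ?(leq_trans _ Hl) ?leq_addl//.
  by rewrite HN ?linear0// leq_subRL ?(leq_trans _ Hl) ?leq_addl// addnC.
rewrite (eq_ssum Ek) ssumD; first last.
- exact/(fin_suppZ (fun=> _)).
- exact: exp_terms_fin_supp.
congr (_ + _); rewrite -!scaler_ssum//; last exact: exp_terms_fin_supp.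
congr (_ *: _); rewrite (ssum_shift (s := k.+1))//; last first.
  by move=> l Hl; rewrite [expA _ _ _]expq_lt0 ?linear0// subr_lt0 ltr_nat.
apply: eq_ssum => l; rewrite intr_Negz; congr (T (expC _ _ (expA _ _ _))).
  by rewrite natrD -[k.+1%:R]natr1; ring.
by rewrite [(_ + l)%:R]natrD; ring.
Qed.

Lemma exp_vacuum w r m : vacuum_like w -> a (Posz 0) w = ratr r *: w ->
  E m w = T (expC c (- m - 1 - c * r) w).
Proof.
move=> Hv Hw; rewrite (E_formula _ Hw) (@ssum1 _ 0%N).
  by rewrite addr0 [expA _ _ _]expq0.
by move=> l l0; rewrite expA_vacuum ?linear0// pnatr_eq0.
Qed.

Lemma exp_translation_vacuum w r m : vacuum_like w -> a (Posz 0) w = ratr r *: w ->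
  ratr c *: normal a 0 E m w = - ratr m *: E (m - 1) w.
Proof.
move=> Hv Hw; rewrite /normal /normR (@ssum1 _ 0%N); last first.
  by move=> [//|k] _; rewrite Hv linear0 scaler0.
rewrite gbinom0 scale1r !subr0 Hw (linearZZ (E _)).
apply: (@addIr _ (ratr m *: E (m - 1) w)).
rewrite -scalerDl addNr scale0r scalerDr scalerA -addrA -scalerDl -rmorphM -rmorphD/=.
rewrite (exp_vacuum (m - 1) Hv Hw).
have -> : - (m - 1) - 1 - c * r = - (c * r + m) by ring.
set x := - (c * r + m); have -> : c * r + m = - x by rewrite opprK.
rewrite rmorphN scaleNr -(linearZZ T) /expC expq_rec//; last exact: creation_commuting.
rewrite (ssum_shift (s := 1%N)); first last.
- exact: expq_fin_supp.
- by case=> // _; rewrite scale0r.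
rewrite (linear_ssum T); last first.
  have := expq_fin_supp (creation c) x w (fun i => i%:R) => -[N HN].
  by exists N => i Hi; rewrite HN// (leq_trans Hi)// leq_addl.
rewrite /normL scaler_ssum; last exact: normL_fin_supp.
apply/eqP; rewrite subr_eq0; apply/eqP/eq_ssum => i.
rewrite gbinom0 scale1r subr0 (exp_vacuum _ Hv Hw) add1n /= (linearZZ T).
have Si : i.+1%:R != 0 :> K by rewrite pnatr_eq0.
rewrite [T (_ *: _)]linearZZ scalerA mulrCA divff// mulr1; congr (_ *: _).
rewrite T_comm scale0r addr0; congr (T (a _ (expq _ _ _))).
by rewrite /x -[i.+1%:R]natr1; ring.
Qed.

End ExponentialField.

Lemma gbinom_alternating_sum (K : numFieldType) (y : K) k :
  - y * (\sum_(i < k.+1) (-1) ^+ (k - i) * gbinom y (k - i)) =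
  k.+1%:R * ((-1) ^+ k.+1 * gbinom y k.+1).
Proof.
have -> : \sum_(i < k.+1) (-1) ^+ (k - i) * gbinom y (k - i) = (-1) ^+ k * gbinom (-1 + y) k.
  rewrite -gbinom_addl mulr_sumr; apply: eq_bigr => i _.
  have Hi : (i <= k)%N by rewrite -ltnS.
  have -> : gbinom (-1 : K) i = (-1) ^+ i.
    by have := gbinom_neg K 0 i; rewrite oppr0 add0r add0n binn mulr1.
  rewrite [RHS]mulrA -exprD; congr (_ * _).
  rewrite -[in RHS]signr_odd -[LHS]signr_odd; congr (_ ^+ (nat_of_bool _)).
  by rewrite oddB// oddD.
by rewrite [RHS]mulrCA gbinomSl exprS [-1 + y]addrC; ring.
Qed.

(* Coefficient form of E(z1) E^-(z2) = (1 - z2/z1)^n12 E^-(z2) E(z1). *)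
Lemma exp_creation (K : numFieldType) (M : lmodType K) (a : int -> {linear M -> M}) (kappa : K)
    (E : rat -> {linear M -> M}) (c2 n12 : rat) (chi : K) y m x :
  heisenberg_relations a kappa ->
  (forall j m w, a (Negz j) (E m w) =
     E m (a (Negz j) w) + chi *: E (m - j.+1%:R) w) ->
  ratr n12 = ratr c2 * chi ->
  E m (expC a c2 x y) =
  ssum (fun s => ((-1) ^+ s * gbinom (ratr n12) s) *: expC a c2 (x - s%:R) (E (m - s%:R) y)).
Proof.
move=> Ha HE Hn.
have CC := creation_commuting Ha c2 c2.
pose cf s : K := (-1) ^+ s * gbinom (ratr n12) s.
have fsx z (g : nat -> M) (d : nat -> K) :
    fin_supp (fun s => d s *: expC a c2 (z - s%:R) (g s)).
  have [P HP] := rat_sub_lt0 z; exists P => s /HP Hs.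
  by rewrite [expC _ _ _ _]expq_lt0// scaler0.
have [N] : exists N : nat, x < N%:R.
  have [N HN] := rat_arch (x + 1) 0; exists N; have := HN _ (leqnn _).
  by rewrite add0r; apply: lt_le_trans; rewrite ltrDl.
elim: N x m => [|N IH] x m xN.
  rewrite [expC _ _ _ _]expq_lt0// linear0 ssum_eq0// => s.
  rewrite [expC _ _ _ _]expq_lt0 ?scaler0//.
  by rewrite ltrBlDr (lt_le_trans xN)// add0r ler0n.
have [->|x0] := eqVneq x 0.
  rewrite [expC _ _ _ _]expq0 (@ssum1 _ 0%N).
    by rewrite expr0 gbinom0 mulr1 scale1r !subr0 [expC _ _ _ _]expq0.
  move=> s s0; rewrite sub0r [expC _ _ _ _]expq_lt0 ?scaler0//.
  by rewrite oppr_lt0 ltr0n lt0n.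
have rx0 : ratr x != 0 :> K by rewrite fmorph_eq0.
apply: (scalerI rx0); rewrite -(linearZZ (E m)) expq_rec//.
rewrite (linear_ssum (E m)); last exact: expq_fin_supp.
pose F t := expC a c2 (x - t%:R) (E (m - t%:R) y).
have [P HP] := rat_sub_lt0 x.
have FP t : (P <= t)%N -> F t = 0 by move=> /HP Ht; rewrite /F [expC _ _ _ _]expq_lt0.
rewrite (ssum_shift (s := 1%N)); first last.
- have [Q HQ] := @expq_fin_supp _ _ (creation a c2) x y (fun i => i%:R).
  by exists Q => i Hi; rewrite HQ// linear0.
- by case=> // _; rewrite scale0r linear0.
have Ei j : E m ((1 + j)%:R *: creation a c2 (1 + j) (expq (creation a c2) (x - (1 + j)%:R) y)) =
   ssum (fun s => cf s *: (ratr c2 *: a (Negz j) (expC a c2 (x - s%:R - (1 + j)%:R) (E (m - s%:R) y)))) +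
   (- ratr n12) *: ssum (fun s => cf s *: F (1 + j + s)%N).
  rewrite add1n /=.
  have Sj : j.+1%:R != 0 :> K by rewrite pnatr_eq0.
  rewrite scalerA mulrCA divff// mulr1 (linearZZ (E m)).
  have := HE j m (expC a c2 (x - j.+1%:R) y) => /(canLR (addrK _)) <-.
  have xj : x - j.+1%:R < N%:R.
    by apply: le_lt_trans (_ : x - 1 < _); rewrite ?lerB ?ler1n// ltrBlDr natr1.
  rewrite scalerBr; congr (_ + _).
    rewrite (IH _ m xj) linear_ssum; last exact: fsx.
    rewrite scaler_ssum; last first.
      have [Q HQ] := fsx (x - j.+1%:R) (fun s => E (m - s%:R) y) cf.
      by exists Q => i /HQ; rewrite /cf => ->; rewrite linear0.
    apply: eq_ssum => s; rewrite (linearZZ (a (Negz j))) !scalerA mulrC.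
    by rewrite [x - _ - _]addrAC.
  rewrite scalerA -Hn -scaleNr (IH _ (m - j.+1%:R) xj); congr (_ *: _).
  apply: eq_ssum => s; rewrite /F; congr (_ *: expC _ _ _ (E _ _)).
    by rewrite natrD opprD addrA.
  by rewrite natrD opprD addrA.
rewrite (eq_ssum Ei) ssumD; first last.
- exists P => j Hj; rewrite ssum_eq0 ?scaler0// => s.
  by rewrite FP ?scaler0//; lia.
- exists P => j Hj; rewrite ssum_eq0// => s; rewrite addrAC [expC _ _ _ _]expq_lt0 ?linear0 ?scaler0 ?linear0 ?scaler0//.
  by apply: rat_sub_lt0W; apply: HP; lia.
have E1 : ssum (fun j => ssum (fun s => cf s *: (ratr c2 *: a (Negz j)
     (expC a c2 (x - s%:R - (1 + j)%:R) (E (m - s%:R) y))))) =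
   ssum (fun s => (cf s * ratr (x - s%:R)) *: F s).
  rewrite exchange_ssum; last first.
    exists P => j s Hjs; rewrite [expC _ _ _ _]expq_lt0 ?linear0 ?scaler0 ?linear0 ?scaler0//.
    case/orP: Hjs => Hj; last exact/rat_sub_lt0W/HP.
    by rewrite addrAC; apply/rat_sub_lt0W/HP; lia.
  apply: eq_ssum => s; rewrite -scalerA /F /expC expq_rec//.
  rewrite [in RHS](ssum_shift (s := 1%N)); first last.
  - exact: expq_fin_supp.
  - by case=> // _; rewrite scale0r.
  rewrite scaler_ssum; last first.
    have [Q HQ] := @expq_fin_supp _ _ (creation a c2) (x - s%:R) (E (m - s%:R) y) (fun i => i%:R).
    by exists Q => i Hi; rewrite HQ// (leq_trans Hi)// leq_addl.
  apply: eq_ssum => j; rewrite add1n /=.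
  have Sj : j.+1%:R != 0 :> K by rewrite pnatr_eq0.
  by congr (_ *: _); rewrite scalerA mulrCA divff// mulr1.
have E2 : ssum (fun j => (- ratr n12) *: ssum (fun s => cf s *: F (1 + j + s)%N)) =
   ssum (fun s => (s%:R * cf s) *: F s).
  rewrite -scaler_ssum; last first.
    exists P => j Hj; rewrite ssum_eq0// => s; rewrite FP ?scaler0//; lia.
  rewrite ssum_diag; last first.
    by exists P => j s Hjs; rewrite FP ?scaler0//; case/orP: Hjs => ?; lia.
  rewrite [RHS](ssum_shift (s := 1%N)); first last.
  - by exists P => s /FP->; rewrite scaler0.
  - by case=> // _; rewrite mul0r scale0r.
  rewrite scaler_ssum; last first.
    by exists P => k Hk; rewrite big1// => i _; rewrite FP ?scaler0//; lia.
  apply: eq_ssum => k; rewrite add1n -gbinom_alternating_sum -scalerA; congr (_ *: _).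
  rewrite scaler_suml; apply: eq_bigr => i _; congr (_ *: F _).
  by have := ltn_ord i; lia.
have fsF d : fin_supp (fun s => d s *: F s : M) by exists P => s /FP->; rewrite scaler0.
rewrite E1 E2 -ssumD; try exact: fsF.
rewrite scaler_ssum; last exact: (fsF (fun s => cf s)).
apply: eq_ssum => s; rewrite -scalerDl scalerA; congr (_ *: _).
by rewrite /cf rmorphB/= ratr_nat; ring.
Qed.

Lemma ssum_int_split (M : zmodType) (C : int -> M) (N : nat) (z : int) :
  (forall k : nat, C (Negz k) = 0) -> (forall k : nat, (N <= k)%N -> C (Posz k) = 0) ->
  ssum (fun i => C (z + 1 + i%:Z)) + ssum (fun i => C (z - i%:Z)) = ssum (fun k => C (Posz k)).
Proof.
move=> CN CP.
have fs1 (y : int) : fin_supp (fun i => C (y + i%:Z)).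
  exists (N + absz y)%N => i Hi.
  by rewrite (_ : y + i%:Z = (absz (y + i%:Z))%:Z) ?CP//; lia.
have fs2 (y : int) : fin_supp (fun i => C (y - i%:Z)).
  exists (absz y).+1 => i Hi.
  by rewrite (_ : y - i%:Z = Negz (absz (y - i%:Z)).-1) ?CN//; lia.
have S1 (y : int) : ssum (fun i => C (y + i%:Z)) = C y + ssum (fun i => C (y + 1 + i%:Z)).
  have [P HP] := fs1 y; rewrite (@ssumE _ _ P.+1); last by move=> i /ltnW /HP.
  rewrite big_ord_recl addr0 (@ssumE _ _ P).
    by congr (_ + _); apply: eq_bigr => i _; rewrite /bump/= -addrA.
  by move=> i Hi; rewrite -addrA -(HP i.+1) ?leqW//.
have S2 (y : int) : ssum (fun i => C (y - i%:Z)) = C y + ssum (fun i => C (y - 1 - i%:Z)).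
  have [P HP] := fs2 y; rewrite (@ssumE _ _ P.+1); last by move=> i /ltnW /HP.
  rewrite big_ord_recl subr0 (@ssumE _ _ P).
    by congr (_ + _); apply: eq_bigr => i _; rewrite /bump/= -addrA -opprD.
  by move=> i Hi; rewrite -addrA -opprD -(HP i.+1) ?leqW//.
have step (y : int) : ssum (fun i => C (y + 1 + i%:Z)) + ssum (fun i => C (y - i%:Z)) =
    ssum (fun i => C (y + i%:Z)) + ssum (fun i => C (y - 1 - i%:Z)).
  by rewrite (S2 y) (S1 y) addrCA addrA.
have base : ssum (fun i => C (0 + i%:Z)) + ssum (fun i => C (-1 - i%:Z)) = ssum (fun k => C (Posz k)).
  rewrite [X in _ + X]ssum_eq0 ?addr0; first by apply: eq_ssum => i; rewrite add0r.
  by move=> i; rewrite -(CN i) NegzE -addn1 PoszD opprD addrC.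
have base0 : ssum (fun i => C (0 + 1 + i%:Z)) + ssum (fun i => C (0 - i%:Z)) = ssum (fun k => C (Posz k)).
  by rewrite step base.
elim/int_rec: z => [|n IH|n IH].
- exact: base0.
- have E1 : n.+1%:Z = n%:Z + 1 by lia.
  by rewrite E1 step addrK IH.
- have E1 : - n.+1%:Z = - n%:Z - 1 by lia.
  by rewrite E1 subrK addrC -IH step addrC.
Qed.

Section ExponentialPair.
Variables (K : numFieldType) (M : lmodType K) (a : int -> {linear M -> M}).
Variables (k0 : rat).
Hypothesis Ha : heisenberg_relations a (ratr k0).

Definition charge_shift (c : rat) (T : {linear M -> M}) := forall k w,
  a k (T w) = T (a k w) + (if k == 0 then ratr k0 * ratr c else 0) *: T w.

Definition exp_on_vacuum (c : rat) (T : {linear M -> M}) (E : rat -> {linear M -> M}) :=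
  forall w r m, vacuum_like a w -> a (Posz 0) w = ratr r *: w ->
  E m w = T (expC a c (- m - 1 - c * r) w).

Definition lower_covariant (c : rat) (E : rat -> {linear M -> M}) := forall j m w,
  a (Negz j) (E m w) = E m (a (Negz j) w) + (ratr k0 * ratr c) *: E (m - j.+1%:R) w.

Lemma charge_shift_expC c T c' x w : charge_shift c T ->
  T (expC a c' x w) = expC a c' x (T w).
Proof.
move=> HT; apply: expq_commute => [||[|i] v] /=; rewrite ?linear0//.
  exact: creation_commuting Ha _ _.
by rewrite (linearZZ T) HT scale0r addr0.
Qed.

Lemma charge_shift_vacuum c T w : charge_shift c T -> vacuum_like a w -> vacuum_like a (T w).
Proof. by move=> HT Hw k; rewrite HT Hw linear0 scale0r addr0. Qed.

Lemma charge_shift_weight c T w r : charge_shift c T -> a (Posz 0) w = ratr r *: w ->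
  a (Posz 0) (T w) = ratr (r + k0 * c) *: T w.
Proof. by move=> HT Hw; rewrite HT Hw (linearZZ T) -scalerDl rmorphD rmorphM. Qed.

Definition exp_pair c1 c2 r (t : M) (x y : rat) : M :=
  expC a c2 (- y - 1 - c2 * r) (expC a c1 (- x - 1 - c1 * r) t).

Lemma exp_pairC c1 c2 r t x y : exp_pair c1 c2 r t x y = exp_pair c2 c1 r t y x.
Proof.
rewrite /exp_pair [RHS]expq_commute => [//|||[|i] v /=].
- exact: creation_commuting Ha _ _.
- by [].
- by rewrite linear0.
by rewrite (linearZZ (expC a c1 _)) (expC_commN Ha).
Qed.

Lemma truncated_exp_pair c1 c2 r t : truncated (exp_pair c1 c2 r t).
Proof.
exists (- c2 * r) => x y Hy; rewrite /exp_pair [expC _ _ _ _]expq_lt0//.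
by move: Hy; lra.
Qed.

Lemma exp_product c1 c2 T1 T2 E1 E2 w r x y : charge_shift c1 T1 -> charge_shift c2 T2 ->
  exp_on_vacuum c1 T1 E1 -> exp_on_vacuum c2 T2 E2 -> lower_covariant c1 E1 ->
  vacuum_like a w -> a (Posz 0) w = ratr r *: w ->
  E1 x (E2 y w) =
  dsum (-1) (k0 * c1 * c2) (exp_pair c1 c2 r (T1 (T2 w))) x y.
Proof.
move=> HT1 HT2 HE1 HE2 HC Hw Hr.
rewrite (HE2 _ _ _ Hw Hr) (charge_shift_expC _ _ _ HT2).
rewrite (exp_creation (n12 := k0 * c1 * c2) _ _ _ Ha HC); last by rewrite !rmorphM/=; ring.
apply: eq_ssum => s; congr (_ *: _); rewrite /exp_pair.
rewrite (HE1 _ _ _ (charge_shift_vacuum HT2 Hw) (charge_shift_weight HT2 Hr)).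
rewrite (charge_shift_expC _ _ _ HT1).
by congr (expC _ _ _ (expC _ _ _ _)); ring.
Qed.

Lemma gbinomN1 i : gbinom (-1 : K) i = (-1) ^+ i.
Proof. by have := gbinom_neg K 0 i; rewrite oppr0 add0r add0n binn mulr1. Qed.

Lemma exp_commutator c1 c2 T1 T2 E1 E2 w r (l : int) m n :
  charge_shift c1 T1 -> charge_shift c2 T2 ->
  exp_on_vacuum c1 T1 E1 -> exp_on_vacuum c2 T2 E2 ->
  lower_covariant c1 E1 -> lower_covariant c2 E2 ->
  vacuum_like a w -> a (Posz 0) w = ratr r *: w -> T1 (T2 w) = T2 (T1 w) ->
  k0 * c1 * c2 = - l%:~R - 1 -> (-1) ^ l = -1 :> K -> m + c1 * r \is a Num.int ->
  dsum (-1) l%:~R (fun x y => E1 x (E2 y w)) m n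
  - (-1) ^ l *: dsum (-1) l%:~R (fun x y => E2 x (E1 y w)) n m
  = T1 (T2 (expC a (c1 + c2) (- (m + n) - 1 - (c1 + c2) * r) w)).
Proof.
move=> HT1 HT2 HE1 HE2 HC1 HC2 Hw Hr T12 Hl Sl /intrP[z' Hz'].
pose z := - z' - 1; have Hz : z%:~R = - m - 1 - c1 * r :> rat.
  by rewrite rmorphB rmorphN/= -Hz'; ring.
have S1 c c' t x y : k0 * c * c' = - l%:~R - 1 ->
    dsum (-1) l%:~R (dsum (-1) (k0 * c * c') (exp_pair c c' r t)) x y =
    ssum (fun i => exp_pair c c' r t (x - 1 - i%:R) (y + i%:R)).
  move=> ->; rewrite dsum_comp; last exact: truncated_exp_pair.
  rewrite addrA subrr sub0r; apply: eq_ssum => i.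
  by rewrite rmorphN1 gbinomN1 -exprMn mulrNN mulr1 expr1n scale1r.
have P1 p q := exp_product p q HT1 HT2 HE1 HE2 HC1 Hw Hr.
have P2 p q := exp_product p q HT2 HT1 HE2 HE1 HC2 Hw Hr.
rewrite (eq_dsum _ _ _ _ P1) (eq_dsum _ _ _ _ P2) !S1//; last by rewrite mulrAC.
rewrite Sl scaleNr scale1r opprK -T12.
rewrite (charge_shift_expC _ _ _ HT2) (charge_shift_expC _ _ _ HT1).
set t := T1 (T2 w).
pose X := - (m + n) - 1 - (c1 + c2) * r.
pose C (k : int) := expC a c1 k%:~R (expC a c2 (X - k%:~R) t).
have [N HN] := rat_sub_lt0 X.
rewrite [RHS](expq_add (X := creation a c1) (X' := creation a c2)) => [|||||//|[|i] v /=]; try by [].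
- rewrite -[RHS](@ssum_int_split _ C N z).
  + congr (_ + _); apply: eq_ssum => i; rewrite ?[in LHS](exp_pairC c1 c2) /C /exp_pair.
    * rewrite (intrD _ _ i%:Z) (intrD _ z) Hz -[i%:Z%:~R]/(i%:R) -[1%:~R]/(1 : rat) /X.
      by congr (expC _ _ _ (expC _ _ _ _)); ring.
    * rewrite intrB Hz -[i%:Z%:~R]/(i%:R) /X.
      by congr (expC _ _ _ (expC _ _ _ _)); ring.
  + move=> k; have k_lt0 : (Negz k)%:~R < 0 :> rat by rewrite ltrz0.
    by rewrite /C [expC _ _ _ _]expq_lt0.
  + by move=> k Hk; rewrite /C [X in expC _ _ _ X]expq_lt0 ?linear0//; apply: HN.
- exact: creation_commuting Ha _ _.
- exact: creation_commuting Ha _ _.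
- exact: creation_commuting Ha _ _.
- by rewrite addr0.
by rewrite -scalerDl rmorphD mulrDl.
Qed.

End ExponentialPair.

(** * Lattice modules *)

Section LatticeSpace.
Variable R : realType.
Local Notation K := R[i].
Local Notation M := (latspace R).
Local Notation "''e' n A" := (lattice_vector R n A) (at level 10, n at level 8, A at level 8).

Lemma mcoeff_lattice_vector n A b :
  mcoeff b ('e n A) = (((n, A) : latbasis) == b)%:R :> K.
Proof. by rewrite /lattice_vector mcoeffU. Qed.

Lemma latspaceE (v : M) (d : {fset latbasis}) : (msupp v `<=` d)%fset ->
  v = \sum_(b <- d) mcoeff b v *: 'e b.1 b.2.
Proof.
move=> vd; rewrite {1}(monalgEw vd); apply: eq_bigr => b _.
by apply/malgP => c; rewrite mcoeffU mcoeffZ mcoeff_lattice_vector; case: b => b1 b2; rewrite mulr_natr.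
Qed.

Lemma linextEw (f : latbasis -> M) (v : M) (d : {fset latbasis}) :
  (msupp v `<=` d)%fset -> linext f v = \sum_(b <- d) mcoeff b v *: f b.
Proof.
move=> vd; rewrite /linext (big_fset_incl _ vd)// => b _ bv.
by rewrite mcoeff_outdom// scale0r.
Qed.

Lemma linext_linear (f : latbasis -> M) : linear (linext f).
Proof.
move=> c u v; pose d := (msupp (c *: u + v) `|` (msupp u `|` msupp v))%fset.
have du : (msupp u `<=` d)%fset by rewrite /d fsubsetU// fsubsetUl orbT.
have dv : (msupp v `<=` d)%fset by rewrite /d fsubsetU// fsubsetUr orbT.
rewrite (linextEw f du) (linextEw f dv) (@linextEw f _ d) ?fsubsetUl//.
rewrite scaler_sumr -big_split/=; apply: eq_bigr => b _.
by rewrite mcoeffD mcoeffZ scalerDl scalerA.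
Qed.

HB.instance Definition _ f :=
  GRing.isLinear.Build K M M *:%R (linext f) (linext_linear f).

Lemma linext_basis f n A : linext f ('e n A) = f (n, A).
Proof.
rewrite (@linextEw _ _ [fset ((n, A) : latbasis)]%fset) ?msuppU_le//.
by rewrite big_seq_fset1 mcoeff_lattice_vector eqxx scale1r.
Qed.

Local Opaque linext lattice_vector.

Lemma latspace_ind (P : M -> Prop) :
  (forall c u v, P u -> P v -> P (c *: u + v)) ->
  P 0 -> (forall n A, P ('e n A)) -> forall v, P v.
Proof.
move=> PD P0 Pe v; rewrite (latspaceE (fsubset_refl (msupp v))).
elim: (msupp v : seq _) => [|b s IH]; first by rewrite big_nil.
by rewrite big_cons; apply: PD.
Qed.

Lemma mset_ind (P : {mset nat}%mset -> Prop) : P mset0 ->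
  (forall j A, P A -> P (j +` A)%mset) -> forall A, P A.
Proof.
move=> P0 PS A; rewrite -(seq_mset_id A); elim: (A : seq nat) => [|j s IH].
  by rewrite (_ : seq_mset _ = mset0)//; apply/msetP => a; rewrite mset_seqE mset0E.
rewrite (_ : seq_mset _ = (j +` seq_mset s)%mset); first exact: PS.
by apply/msetP => a; rewrite mset1DE !mset_seqE /= eq_sym.
Qed.

Variable p : nat.

HB.instance Definition _ mu k := GRing.Linear.on (heis (R := R) p mu k).

Lemma heis0_basis mu n A : heis p mu (Posz 0) ('e n A) = alpha0 R p mu n *: 'e n A.
Proof. exact: linext_basis. Qed.

Lemma heisP_basis mu j n A : heis p mu (Posz j.+1) ('e n A) =
  (2 * p * j.+1 * A j)%:R *: 'e n (A `\ j)%mset.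
Proof. exact: linext_basis. Qed.

Lemma heisN_basis mu j n A : heis p mu (Negz j) ('e n A) = 'e n (j +` A)%mset.
Proof. exact: linext_basis. Qed.

Local Opaque heis.

Lemma heisZ mu k c w : heis p mu k (c *: w) = c *: heis p mu k w :> M.
Proof. exact: linearZZ. Qed.

Lemma heisD mu k w w' : heis p mu k (w + w') = heis p mu k w + heis p mu k w' :> M.
Proof. exact: linearD. Qed.

Lemma linear_eqP (f g : {linear M -> M}) :
  (forall n A, f ('e n A) = g ('e n A)) -> forall w, f w = g w.
Proof.
move=> E; apply: latspace_ind => [c u v Hu Hv||//]; last by rewrite !linear0.
by rewrite !linearP Hu Hv.
Qed.

Lemma heis_relations mu :
  heisenberg_relations (fun k => heis p mu k : {linear M -> M}) (2 * p)%:R.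
Proof.
have comm0 k (w : M) : heis p mu (Posz 0) (heis p mu k w) = heis p mu k (heis p mu (Posz 0) w).
  apply: (@linear_eqP (heis p mu (Posz 0) \o heis p mu k)%FUN (heis p mu k \o heis p mu (Posz 0))%FUN).
  move=> n A /=; case: k => [[|j]|j].
  - by [].
  - by rewrite heis0_basis heisP_basis !heisZ heisP_basis heis0_basis !scalerA mulrC.
  - by rewrite heis0_basis heisN_basis heisZ heisN_basis heis0_basis.
have commPN i j (w : M) : heis p mu (Posz i.+1) (heis p mu (Negz j) w) =
    heis p mu (Negz j) (heis p mu (Posz i.+1) w) +
    (if i == j then (2 * p)%:R * i.+1%:R else 0) *: w.
  pose f : {linear M -> M} := (heis p mu (Posz i.+1) \o heis p mu (Negz j))%FUN.
  pose g : {linear M -> M} := ((heis p mu (Negz j) \o heis p mu (Posz i.+1)) \+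
    ((if i == j then (2 * p)%:R * i.+1%:R else 0 : K) \*: idfun))%FUN.
  apply: (@linear_eqP f g) => n A /=.
  rewrite heisN_basis !heisP_basis heisZ heisN_basis mset1DE.
  have [->|ij] := eqVneq i j.
    rewrite msetD1K; have [Aj|Aj] := posnP (A j).
      by rewrite Aj muln0 scale0r add0r addn0 muln1 natrM.
    by rewrite msetB1K -?mset_gt0// -scalerDl mulnDr muln1 natrD natrM addrC.
  rewrite scale0r addr0 add0n (_ : ((j +` A) `\ i)%mset = (j +` (A `\ i))%mset)//.
  apply/msetP => x; rewrite !(msetB1E, mset1DE).
  by case: (eqVneq x i) => [->|]; rewrite ?(negPf ij) ?subn0 ?add0n.
have commPP i j (w : M) : heis p mu (Posz i.+1) (heis p mu (Posz j.+1) w) =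
    heis p mu (Posz j.+1) (heis p mu (Posz i.+1) w).
  apply: (@linear_eqP (heis p mu (Posz i.+1) \o heis p mu (Posz j.+1))%FUN
    (heis p mu (Posz j.+1) \o heis p mu (Posz i.+1))%FUN) => n A /=.
  rewrite !heisP_basis !heisZ !heisP_basis !scalerA.
  have [->//|ij] := eqVneq i j.
  rewrite !msetB1E (negPf ij) eq_sym (negPf ij) !subn0 -!msetBDA msetDC.
  by rewrite mulrC.
have commNN i j (w : M) : heis p mu (Negz i) (heis p mu (Negz j) w) =
    heis p mu (Negz j) (heis p mu (Negz i) w).
  apply: (@linear_eqP (heis p mu (Negz i) \o heis p mu (Negz j))%FUN
    (heis p mu (Negz j) \o heis p mu (Negz i))%FUN) => n A /=.
  by rewrite !heisN_basis msetDCA.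
split=> [k l w|w] /=.
  case: k l => [[|i]|i] [[|j]|j].
  - by rewrite mulr0 ?if_same scale0r addr0.
  - by rewrite mulr0 ?if_same scale0r addr0 comm0.
  - by rewrite mulr0 ?if_same scale0r addr0 comm0.
  - by rewrite ?scale0r ?addr0 comm0.
  - by rewrite ?scale0r ?addr0 commPP.
  - by rewrite commPN NegzE subr_eq0 eqz_nat eqSS.
  - by rewrite ?scale0r ?addr0 comm0.
  - rewrite commPN -addrA -scalerDl NegzE [- _ + _]addrC subr_eq0 eqz_nat eqSS.
    have [->|] := eqVneq j i; last by rewrite addr0 scale0r addr0.
    by rewrite rmorphN/= mulrN addrN scale0r addr0.
  - by rewrite ?scale0r ?addr0 commNN.
elim/latspace_ind: w.
- move=> c u v [N HN] [P HP]; exists (maxn N P) => k; rewrite geq_max => /andP[Hk Hk'].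
  by rewrite heisD heisZ HN// HP// scaler0 addr0.
- by exists 0%N => k _; rewrite linear0.
- move=> n A; exists (\max_(j <- finsupp A) j).+2 => -[//|k] Hk.
  rewrite heisP_basis (_ : A k = 0%N) ?muln0 ?scale0r//.
  apply/eqP; rewrite mset_eq0; apply/negP; rewrite -msuppE => kA.
  move: Hk; rewrite ltnS => /leq_trans/(_ (leqnn _)).
  by rewrite ltnNge (@leq_bigmax_seq _ _ _ id).
Qed.

End LatticeSpace.

Lemma fsbig_diag (K : fieldType) (M : lmodType K) (c d : rat) (F : nat -> nat -> M) :
  \sum_(kl \in [set kl : nat * nat | c + kl.1%:R - kl.2%:R = d]) F kl.1 kl.2 =
  ssum (fun l => if d - c + l%:R \is a Num.nat then F (Num.truncn (d - c + l%:R)) l else 0).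
Proof.
pose P := [set l : nat | d - c + l%:R \is a Num.nat].
rewrite (reindex_fsbig (fun l => (Num.truncn (d - c + l%:R), l)) P) /=; last first.
  split=> [l /= /truncnK Hl|l l' _ _ [_ ->]//|[k l] /= Hkl].
    by rewrite /= Hl; ring.
  by exists l; rewrite /P/= (_ : d - c + l%:R = k%:R) ?natrK// -Hkl; ring.
rewrite fsbig_mkcond /ssum; apply: eq_fsbigr => l _; rewrite /patch.
by case: ifP => [/set_mem ->//|/negbT]; rewrite notin_setE /P/= => /negP/negbTE ->.
Qed.

Lemma fsbig_neg_int (K : fieldType) (M : lmodType K) (F : int -> M) :
  \sum_(k \in [set k : int | k < 0]) F k = ssum (fun t => F (Negz t)).
Proof.
rewrite (reindex_fsbig Negz setT)//; split=> //[t t' _ _ []//|[k|k] //= _].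
by exists k.
Qed.

Lemma fsbig_nneg_int (K : fieldType) (M : lmodType K) (F : int -> M) :
  \sum_(k \in [set k : int | 0 <= k]) F k = ssum (fun t => F (Posz t)).
Proof.
rewrite (reindex_fsbig Posz setT)//; split=> //[t t' _ _ []//|[k|k] //= _].
by exists k.
Qed.

Lemma normal_linear_field (K : numFieldType) (M : lmodType K) (a : int -> {linear M -> M})
    (kappa : K) (Ha : heisenberg_relations a kappa) c j (phi psi chi : mfield M) m w :
  (forall m w, phi m w = c *: psi m w + chi m w) ->
  normal a j phi m w = c *: normal a j psi m w + normal a j chi m w.
Proof.
move=> H; rewrite /normal scalerDr addrACA; congr (_ + _).
  have fL phi0 := normL_fin_supp a j phi0 m w.
  rewrite /normL scaler_ssum// -ssumD//; last exact: (fin_suppZ (fun=> c)).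
  by apply: eq_ssum => i; rewrite H (linearPZ (a _)) scalerDr !scalerA mulrC.
have fR phi0 := normR_fin_supp Ha j phi0 m w.
rewrite /normR scaler_ssum// -ssumD//; last exact: (fin_suppZ (fun=> c)).
by apply: eq_ssum => i; rewrite H scalerDr !scalerA mulrC.
Qed.

Lemma commutation_linear (K : numFieldType) (M : lmodType K) (A T : {linear M -> M}) c z u v :
  A (T u) = T (A u) + c *: T u -> A (T v) = T (A v) + c *: T v ->
  A (T (z *: u + v)) = T (A (z *: u + v)) + c *: T (z *: u + v).
Proof.
move=> Hu Hv; rewrite (linearPZ T) !(linearPZ A) Hu Hv (linearPZ T).
by rewrite !scalerDr addrACA !scalerA [z * _]mulrC.
Qed.

Lemma linear_combination_eq0 (K : numFieldType) (M : lmodType K) (T : {linear M -> M}) z u v :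
  T u = 0 -> T v = 0 -> T (z *: u + v) = 0.
Proof. by move=> Hu Hv; rewrite (linearPZ T) Hu Hv scaler0 addr0. Qed.

(* V_L and its modules through their structure equations only: [e n A] stands for
   the basis, [hs mu] for alpha(k), [shf] for e^{n alpha} without its zero mode,
   [expm], [nmode] and [Y] for the modes of e^{n alpha}, of its normally ordered
   products and of an arbitrary vector, all on V_{L + mu alpha}. *)
Section LatticeModel.
Variables (K : numFieldType) (M : lmodType K) (p : nat).
Variables (e : int -> {mset nat}%mset -> M) (hs : rat -> int -> {linear M -> M}).
Variables (shf : int -> {linear M -> M}) (expm : rat -> int -> rat -> {linear M -> M}).
Variables (nmode : rat -> int -> seq nat -> rat -> M -> M) (Y : rat -> M -> rat -> M -> M).
Local Notation k0 := ((2 * p)%:R : rat).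
Definition weight mu (n : int) : rat := k0 * (mu + n%:~R).

Hypothesis span : forall P : M -> Prop, (forall c u v, P u -> P v -> P (c *: u + v)) ->
  P 0 -> (forall n A, P (e n A)) -> forall w, P w.
Hypothesis hs_rel : forall mu, heisenberg_relations (hs mu) (ratr k0).
Hypothesis hs0 : forall mu n A, hs mu (Posz 0) (e n A) = ratr (weight mu n) *: e n A.
Hypothesis hsN : forall mu j n A, hs mu (Negz j) (e n A) = e n (j +` A)%mset.
Hypothesis hsP : forall mu j n A,
  hs mu (Posz j.+1) (e n A) = (2 * p * j.+1 * A j)%:R *: e n (A `\ j)%mset.
Hypothesis hs_weight_sep : forall mu r (F G : {linear M -> M}) w,
  (forall n A, weight mu n = r -> F (e n A) = G (e n A)) ->
  hs mu (Posz 0) w = ratr r *: w -> F w = G w.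
Hypothesis shfE : forall n1 n A, shf n1 (e n A) = e (n1 + n) A.
Hypothesis expmE : forall mu n1 m n A, expm mu n1 m (e n A) =
  ssum (fun l => shf n1 (expC (hs mu) n1%:~R (- m - 1 - n1%:~R * weight mu n + l%:R)
                    (expA (hs mu) n1%:~R l%:R (e n A)))).
Hypothesis nmode0 : forall mu n m w, nmode mu n [::] m w = expm mu n m w.
Hypothesis nmodeS : forall mu n j s m w, nmode mu n (j :: s) m w =
  ssum (fun t => gbinom (t%:R : K) j *: hs mu (Negz t) (nmode mu n s (m + t%:R - j%:R) w))
  + ssum (fun k => gbinom (- k%:R - 1 : K) j *:
                   nmode mu n s (m - k%:R - j%:R - 1) (hs mu (Posz k) w)).
Hypothesis YE : forall mu n A m w, Y mu (e n A) m w = nmode mu n (enum_mset A) m w.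
Hypothesis YP : forall mu c u v m w, Y mu (c *: u + v) m w = c *: Y mu u m w + Y mu v m w.

Lemma hs_vacuum mu n : vacuum_like (hs mu) (e n mset0).
Proof. by move=> k; rewrite hsP mset0E muln0 scale0r. Qed.

Lemma heis_ind mu (P : M -> Prop) :
  (forall c u v, P u -> P v -> P (c *: u + v)) -> P 0 ->
  (forall n, P (e n mset0)) -> (forall j w, P w -> P (hs mu (Negz j) w)) -> forall w, P w.
Proof.
move=> PL P0 Pv Ph; apply: span => // n; elim/mset_ind => // j A /(Ph j).
by rewrite hsN.
Qed.

Lemma shf_charge mu n1 : charge_shift (hs mu) k0 n1%:~R (shf n1).
Proof.
move=> k; elim/span => [z u v Hu Hv||n A].
- exact: commutation_linear.
- by rewrite !linear0 ?scaler0 addr0.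
case: k => [[|j]|j]; rewrite shfE.
- rewrite !hs0 (linearZZ (shf n1)) shfE -scalerDl -rmorphM -rmorphD.
  by congr (ratr _ *: _); rewrite /weight intrD; ring.
- by rewrite !hsP (linearZZ (shf n1)) shfE scale0r addr0.
- by rewrite !hsN shfE scale0r addr0.
Qed.

Lemma hs_expA_fin mu c w : expA_finite (hs mu) c w.
Proof.
elim/(@heis_ind mu): w => [z u v [N HN] [N' HN']||n|j w].
- exists (maxn N N') => l; rewrite geq_max => /andP[Hl Hl'].
  by apply: linear_combination_eq0; [exact: HN|exact: HN'].
- by exists 0%N => l _; rewrite linear0.
- exact: (expA_finite_vacuum (hs_rel mu)) (@hs_vacuum mu n).
- exact: (expA_finite_step (hs_rel mu)).
Qed.

Lemma hs_weight_span mu (P : M -> Prop) : P 0 ->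
  (forall z u v, P u -> P v -> P (z *: u + v)) ->
  (forall w r, hs mu 0 w = ratr r *: w -> P w) -> forall w, P w.
Proof. by move=> P0 PL PW; apply: span => // n A; apply: PW (hs0 mu n A). Qed.

Definition exp_on_weight mu n1 r m w : M :=
  ssum (fun l => shf n1 (expC (hs mu) n1%:~R (- m - 1 - n1%:~R * r + l%:R)
                    (expA (hs mu) n1%:~R l%:R w))).

Lemma exp_on_weight_linear mu n1 r m : linear (exp_on_weight mu n1 r m).
Proof.
move=> z u v; have fs w := exp_terms_fin_supp (shf n1) (@hs_expA_fin mu n1%:~R)
  (fun l => - m - 1 - n1%:~R * r + l%:R) w.
rewrite /exp_on_weight scaler_ssum// -ssumD//; last exact: (fin_suppZ (fun=> z)).
by apply: eq_ssum => l; rewrite (linearPZ (expA _ _ _)) (linearPZ (expC _ _ _)) (linearPZ (shf n1)).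
Qed.

HB.instance Definition _ mu n1 r m :=
  GRing.isLinear.Build K M M *:%R (exp_on_weight mu n1 r m) (@exp_on_weight_linear mu n1 r m).

Lemma expm_formula mu n1 w r m : hs mu (Posz 0) w = ratr r *: w ->
  expm mu n1 m w = exp_on_weight mu n1 r m w.
Proof. by apply: hs_weight_sep => n A <-; exact: expmE. Qed.

Lemma expm_trunc mu n1 w : exists B, forall m, B <= m -> expm mu n1 m w = 0.
Proof.
elim/span: w => [z u v [B HB] [B' HB']||n A].
- exists (Num.max B B') => m; rewrite ge_max => /andP[Hm Hm'].
  by apply: linear_combination_eq0; [exact: HB|exact: HB'].
- by exists 0 => m _; rewrite linear0.
have [N HN] := @hs_expA_fin mu n1%:~R (e n A).
exists (N%:R - n1%:~R * weight mu n) => m Hm; rewrite expmE ssum_eq0// => l.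
have [/HN->|lN] := leqP N l; first by rewrite !linear0.
rewrite [expC _ _ _ _]expq_lt0 ?linear0//.
have : l%:R < N%:R :> rat by rewrite ltr_nat.
by move: Hm; lra.
Qed.

Definition expf mu n1 := MField (expm_trunc mu n1).

Lemma expf_covariant mu n1 k m w : hs mu k (expf mu n1 m w) =
  expf mu n1 m (hs mu k w) + (ratr k0 * ratr n1%:~R) *: expf mu n1 (m + k%:~R) w.
Proof.
apply: (exp_covariant (hs_rel mu) (T := shf n1)) => //.
- exact: shf_charge.
- exact: hs_expA_fin.
- move=> w' r m' Hw'; exact: expm_formula.
- exact: hs_weight_span.
Qed.

Lemma expf_vacuum mu n1 : exp_on_vacuum (hs mu) n1%:~R (shf n1) (expf mu n1).
Proof.
move=> w r m Hw Hr; apply: (exp_vacuum (hs_rel mu)) => // w' r' m' Hw'.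
exact: expm_formula.
Qed.

Definition nfield mu n1 s : mfield M := foldr (normalf (hs_rel mu)) (expf mu n1) s.

Lemma nmodeE mu n1 s m w : nmode mu n1 s m w = nfield mu n1 s m w.
Proof.
elim: s m w => [|j s IH] m w; first exact: nmode0.
by rewrite nmodeS; congr (_ + _); apply: eq_ssum => i; rewrite IH.
Qed.

Lemma nfield_perm mu n1 s s' m w : perm_eq s s' -> nfield mu n1 s m w = nfield mu n1 s' m w.
Proof.
have move_front s1 j s2 m' w' : nfield mu n1 (s1 ++ j :: s2) m' w' = nfield mu n1 (j :: s1 ++ s2) m' w'.
  elim: s1 m' w' => //= i s1 IH m' w'.
  rewrite -[RHS](normal_swap (hs_rel mu)); exact: eq_normal.
elim: s s' m w => [|j s IH] s' m w Hs.
  by have /perm_small_eq-> : perm_eq s' [::] by rewrite perm_sym.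
have js' : j \in s' by rewrite -(perm_mem Hs) mem_head.
case/splitPr: js' Hs => s1 s2 Hs; rewrite move_front.
by apply: eq_normal => m' w'; apply: IH; rewrite -(perm_cons j) (perm_trans Hs)// perm_catC /= perm_cons perm_catC.
Qed.

Lemma scaler_combine (c d r s chi : K) (x y z t : M) : c * d + r * chi = chi * s ->
  c *: (x + (chi *: y + d *: z)) + r *: (t + chi *: z) =
  c *: x + r *: t + chi *: (c *: y + s *: z).
Proof.
move=> H; rewrite !scalerDr !scalerA -H scalerDl -!addrA; congr (_ + _).
by rewrite [c * chi]mulrC [RHS]addrCA; congr (_ + _); rewrite addrCA.
Qed.

Lemma Y0l mu m w : Y mu 0 m w = 0.
Proof. exact: (linear_fun0 (X := fun u => Y mu u m w)) (fun c u v => YP mu c u v m w). Qed.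

Definition Yop mu u m w := Y mu u m w.

Lemma Yop_linear mu u m : linear (Yop mu u m).
Proof.
elim/span: u => [c u v Hu Hv z w w'||n A z w w']; rewrite /Yop.
- by rewrite !YP -!/(Yop _ _ _ _) Hu Hv !scalerDr addrACA !scalerA [c * z]mulrC.
- by move=> z w w'; rewrite !Y0l scaler0 addr0.
by rewrite !YE !nmodeE linearPZ.
Qed.

HB.instance Definition _ mu u m :=
  GRing.isLinear.Build K M M *:%R (Yop mu u m) (Yop_linear mu u m).

Lemma Yop_trunc mu u w : exists B, forall m, B <= m -> Yop mu u m w = 0.
Proof.
rewrite /Yop; elim/span: u => [c u v [B HB] [B' HB']||n A].
- exists (Num.max B B') => m; rewrite ge_max => /andP[Hm Hm'].
  by rewrite YP HB// HB'// scaler0 addr0.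
- by exists 0 => m _; rewrite Y0l.
have [B HB] := ftrunc (nfield mu n (enum_mset A)) w.
by exists B => m /HB; rewrite YE nmodeE.
Qed.

Definition Yf mu u := MField (Yop_trunc mu u).

Lemma Yf_vertex mu n m w : Yf mu (e n mset0) m w = expf mu n m w.
Proof. by rewrite /= /Yop YE nmodeE enum_mset0. Qed.

Lemma enum_mset1D (j : nat) (A : {mset nat}%mset) : perm_eq (enum_mset (j +` A)%mset) (j :: enum_mset A).
Proof.
apply/allP => x _ /=; rewrite !count_mem_mset mset1DE [j == x]eq_sym.
by case: (x == j).
Qed.

Lemma Yf_normal mu mu' j u m w :
  Yf mu (hs mu' (Negz j) u) m w = normal (hs mu) j (Yf mu u) m w.
Proof.
elim/span: u m w => [z u v Hu Hv m w|m w|n A m w].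
- have HY q x : Yf mu (z *: u + v) q x = z *: Yf mu u q x + Yf mu v q x by exact: YP.
  rewrite (normal_linear_field (hs_rel mu) _ _ _ HY) -Hu -Hv linearPZ; exact: YP.
- rewrite linear0 /= /Yop Y0l; apply/esym.
  have HY q x : Yf mu 0 q x = (-1) *: Yf mu 0 q x + Yf mu 0 q x.
    by rewrite /= /Yop Y0l scaler0 addr0.
  by rewrite (normal_linear_field (hs_rel mu) _ _ _ HY) scaleN1r addNr.
rewrite hsN /= /Yop YE nmodeE (nfield_perm _ _ _ _ (enum_mset1D j A)).
by apply: eq_normal => q x /=; rewrite /Yop YE nmodeE.
Qed.

Lemma Yf_covariant mu u : heis_covariant (hs 0) (hs mu) (Yf mu) u.
Proof.
have YfP c x y m w : Yf mu (c *: x + y) m w = c *: Yf mu x m w + Yf mu y m w by exact: YP.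
elim/(@heis_ind 0): u => [z u v Hu Hv k m w||n k m w|j u Hu].
- rewrite !YfP (linearPZ (hs mu k)) Hu Hv.
  have fs x : fin_supp (fun s => gbinom (k%:~R : K) s *: Yf mu (hs 0 (Posz s) x) (m + k%:~R - s%:R) w).
    have [N HN] := (hs_rel 0).2 x; exists N => s /HN->.
    by rewrite /= /Yop Y0l scaler0.
  rewrite [X in _ = _ + X](_ : _ = z *: ssum (fun s => gbinom (k%:~R : K) s *: Yf mu (hs 0 (Posz s) u) (m + k%:~R - s%:R) w)
     + ssum (fun s => gbinom (k%:~R : K) s *: Yf mu (hs 0 (Posz s) v) (m + k%:~R - s%:R) w)).
    by rewrite scalerDr addrACA.
  rewrite scaler_ssum// -ssumD//; last exact: (fin_suppZ (fun=> z)).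
  by apply: eq_ssum => s; rewrite linearPZ YfP scalerDr !scalerA mulrC.
- move=> k m w; rewrite /= /Yop !Y0l linear0 ssum_eq0 ?addr0// => s.
  by rewrite linear0 Y0l scaler0.
- rewrite !Yf_vertex expf_covariant; congr (_ + _).
  rewrite (@ssum1 _ 0%N); last first.
    by move=> [//|s] _; rewrite hs_vacuum /= /Yop Y0l scaler0.
  rewrite gbinom0 scale1r subr0 hs0 /= /Yop.
  rewrite (linear_funZ (fun c x y => YP mu c x y (m + k%:~R) w)) YE nmodeE enum_mset0.
  by rewrite /weight add0r rmorphM.
apply: (heis_covariant_step (hs_rel 0) (hs_rel mu) YfP) => //.
by move=> j' u' m w; exact: Yf_normal.
Qed.

Lemma Yf_fields mu : heisenberg_fields (hs 0) (hs mu) (fun u m => Yf mu u m).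
Proof.
split.
- by move=> *; exact: YP.
- exact: Yop_trunc.
- exact: (hs_rel mu).2.
- by move=> k u m w; exact: Yf_covariant.
- by move=> j u m w; exact: Yf_normal.
Qed.

Lemma highest_vertex n : highest (hs 0) (ratr (weight 0 n)) (e n mset0).
Proof. by move=> [|s]; rewrite ?hs0// hs_vacuum scale0r. Qed.

Lemma vertex_translation mu n m w :
  n%:~R *: Yf mu (hs 0 (Negz 0) (e n mset0)) m w = - ratr m *: Yf mu (e n mset0) (m - 1) w.
Proof.
set u := e n mset0; set u' := hs 0 (Negz 0) u; set chi : K := ratr (weight 0 n).
pose D q := n%:~R \*: Yf mu u' q + ratr q \*: Yf mu u (q - 1) : {linear M -> M}.
suff H : forall w q, D q w = 0.
  by apply/eqP; rewrite scaleNr -addr_eq0; apply/eqP; exact: H.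
have chiE : chi = ratr k0 * n%:~R by rewrite /chi /weight add0r rmorphM/= ratr_int.
have u'0 : hs 0 (Posz 0) u' = chi *: u'.
  by rewrite /u' (hs_rel 0).1 highest_vertex (linearZZ (hs 0 (Negz 0))) scale0r addr0.
have u'1 : hs 0 (Posz 1) u' = ratr k0 *: u.
  by rewrite /u' (hs_rel 0).1 highest_vertex scale0r linear0 add0r mulr1.
have u's s : hs 0 (Posz s.+2) u' = 0.
  by rewrite /u' (hs_rel 0).1 highest_vertex scale0r linear0 add0r.
have YZ c x q v : Yf mu (c *: x) q v = c *: Yf mu x q v.
  exact: (linear_funZ (fun c x y => YP mu c x y q v)).
have Dcomm k q v : hs mu k (D q v) = D q (hs mu k v) + chi *: D (q + k%:~R) v.
  rewrite /= (linearD (hs mu k)) !(linearZZ (hs mu k)).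
  have -> : hs mu k (Yf mu u' q v) = Yf mu u' q (hs mu k v) + (chi *: Yf mu u' (q + k%:~R) v
      + (k%:~R * ratr k0) *: Yf mu u (q + k%:~R - 1) v).
    rewrite Yf_covariant; congr (_ + _); rewrite (@ssumE _ _ 2); last first.
      by move=> [|[|s]]// _; rewrite u's /= /Yop Y0l scaler0.
    rewrite big_ord_recl big_ord1 /= u'0 u'1 !YZ gbinom0 scale1r subr0 scalerA.
    by congr (_ + (_ * _) *: _); have := gbinomS (k%:~R : K) 0; rewrite gbinom0 mulr1 subr0 mul1r.
  have -> : hs mu k (Yf mu u (q - 1) v) = Yf mu u (q - 1) (hs mu k v) +
      chi *: Yf mu u (q + k%:~R - 1) v.
    rewrite (highest_comm (Yf_fields mu) _ _ _ (highest_vertex n)).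
    by congr (_ + _ *: Yf mu u _ v); ring.
  have -> : ratr (q + k%:~R) = ratr q + k%:~R :> K by rewrite [LHS]rmorphD /= ratr_int.
  by apply: scaler_combine; rewrite chiE; ring.
elim/(@heis_ind mu) => [c x y Hx Hy q||n3 q|j x Hx q].
- by apply: linear_combination_eq0; [exact: Hx|exact: Hy].
- by move=> q; rewrite linear0.
- have HH : ratr n%:~R *: normal (hs mu) 0 (expf mu n) q (e n3 mset0) =
      - ratr q *: expf mu n (q - 1) (e n3 mset0).
    apply: (exp_translation_vacuum (hs_rel mu) (T := shf n)).
    + exact: shf_charge.
    + by move=> x r y; exact: expm_formula.
    + exact: hs_vacuum.
    + exact: hs0.
  rewrite /= -[Yop _ _ _ _]/(Yf mu u' q (e n3 mset0)) -[Yop _ _ (_ - _) _]/(Yf mu u (q - 1) (e n3 mset0)).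
  rewrite Yf_normal (@eq_normal _ _ _ _ _ (expf mu n)); last exact: Yf_vertex.
  by move: HH; rewrite ratr_int => ->; rewrite Yf_vertex -scalerDl addNr scale0r.
have := Dcomm (Negz j) q x; rewrite !Hx linear0 scaler0 addr0; exact: esym.
Qed.

Lemma vertex_translations mu n : translation (hs 0) (fun u m => Yf 0 u m) (fun u m => Yf mu u m) n%:~R (e n mset0).
Proof. by split=> m v; exact: vertex_translation. Qed.

Local Notation jac mu u l m n v w :=
  (jacobi (fun x q => Yf 0 x q) (fun x q => Yf mu x q) u l m n v w).

(* The modes of V_{n1 alpha} that act on V_{L + mu alpha}: m + <n1 alpha, mu alpha>
   must be an integer. *)
Definition integral_mode mu (n1 : int) (m : rat) := m + n1%:~R * (k0 * mu) \is a Num.int.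

Lemma integral_mode_shift mu n1 : shift_closed (integral_mode mu n1).
Proof. by move=> m z Hm; rewrite /integral_mode addrAC rpredD// intr_int. Qed.

Lemma vertex_on_vertex mu n1 n3 m : Yf mu (e n1 mset0) m (e n3 mset0) =
  shf n1 (expC (hs mu) n1%:~R (- m - 1 - n1%:~R * weight mu n3) (e n3 mset0)).
Proof. by rewrite Yf_vertex; apply: expf_vacuum; [exact: hs_vacuum|exact: hs0]. Qed.

Lemma jacobi_base mu (n1 n2 n3 l : int) m n : integral_mode mu n1 m ->
  l = - ((2 * p)%:Z * n1 * n2) - 1 ->
  jac mu (e n1 mset0) l m n (e n2 mset0) (e n3 mset0).
Proof.
move=> Hm Hl; have H0 := Yf_fields 0; have H := Yf_fields mu.
have Hn12 : k0 * n1%:~R * n2%:~R = - l%:~R - 1.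
  by rewrite Hl intrB intrN !intrM -[(2 * p)%:Z%:~R]/((2 * p)%:R) -[1%:~R]/(1 : rat); ring.
rewrite /jacobi /jacobi_rhs /prod_modes.
have low c1 : lower_covariant (hs mu) k0 c1%:~R (expf mu c1).
  by move=> j q x; rewrite expf_covariant intr_Negz -[j.+1%:R]natr1 opprD.
rewrite (eq_dsum _ _ _ _ (g := fun x y => expf mu n1 x (expf mu n2 y (e n3 mset0)))); last first.
  by move=> x y; rewrite !Yf_vertex.
rewrite (eq_dsum _ _ _ _ (f := fun x y => Yf mu (e n2 mset0) x _)
    (g := fun x y => expf mu n2 x (expf mu n1 y (e n3 mset0)))); last first.
  by move=> x y; rewrite !Yf_vertex.
rewrite (@exp_commutator _ _ _ _ (hs_rel mu) n1%:~R n2%:~R (shf n1) (shf n2)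
  (expf mu n1) (expf mu n2) (e n3 mset0) (weight mu n3) l m n (shf_charge mu n1)
  (shf_charge mu n2) (@expf_vacuum mu n1) (@expf_vacuum mu n2) (low n1) (low n2)
  (@hs_vacuum mu n3) (hs0 mu n3 mset0)) => [|||//|]; first last.
- rewrite /weight mulrDr mulrDr addrA rpredD//.
  have -> : n1%:~R * (k0 * n3%:~R) = (n1 * ((2 * p)%:Z * n3))%:~R by rewrite !intrM.
  exact: intr_int.
- rewrite Hl -[X in (-1) ^ X](_ : - ((p%:Z * n1 * n2) * 2 + 1) = _); last by lia.
  have S x : (-1) ^ (x * 2) = 1 :> K.
    by rewrite mulrC -exprz_exp -[(-1) ^ 2]/((-1) ^+ 2) sqrrN expr1n exp1rz.
  by rewrite -invr_expz expfzDr ?oppr_eq0 ?oner_eq0// S mul1r expr1z invrN1.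
- exact: Hn12.
- by rewrite !shfE addrCA.
rewrite /jacobi_lhs /dsum (@ssum1 _ 0%N); last first.
  move=> i i0; rewrite /iter_modes vertex_on_vertex.
  rewrite [expC _ _ _ _]expq_lt0 ?linear0 ?(fields0 H) ?scaler0//.
  have -> : - (l%:~R + i%:R) - 1 - n1%:~R * weight 0 n2 = - i%:R :> rat.
    by rewrite /weight add0r mulrCA mulrA Hn12; ring.
  by rewrite oppr_lt0 ltr0n lt0n.
rewrite expr0 gbinom0 mulr1 scale1r subr0 addr0 /iter_modes vertex_on_vertex.
have -> : - l%:~R - 1 - n1%:~R * weight 0 n2 = 0 :> rat.
  by rewrite /weight add0r mulrCA mulrA Hn12; ring.
rewrite [expC _ _ _ _]expq0 shfE vertex_on_vertex intrD [n + m]addrC.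
have HT w : shf (n1 + n2) w = shf n1 (shf n2 w).
  elim/span: w => [c u v Hu Hv||k A]; last by rewrite !shfE addrA.
  - by rewrite !linearPZ Hu Hv.
  - by rewrite !linear0.
exact: HT.
Qed.

Lemma jacobi_vertex mu (n1 n2 l : int) m n w : integral_mode mu n1 m ->
  jac mu (e n1 mset0) l m n (e n2 mset0) w.
Proof.
have H0 := Yf_fields 0; have H := Yf_fields mu; have Pcl := @integral_mode_shift mu n1.
have h1 := highest_vertex n1; have h2 := highest_vertex n2.
pose N : int := (2 * p)%:Z * n1 * n2.
have base : forall w m n, integral_mode mu n1 m ->
    jac mu (e n1 mset0) (- N - 1) m n (e n2 mset0) w.
  elim/(@heis_ind mu) => [c x y Hx Hy||n3|j x Hx] q q' Hq.
  - by apply: (jacobi_linear_r H0 H); [exact: Hx|exact: Hy].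
  - have -> : 0 = -1 *: e 0 mset0 + e 0 mset0 by rewrite scaleN1r addNr.
    by apply: (jacobi_linear_r H0 H); apply: jacobi_base.
  - exact: jacobi_base.
  - apply: (@jacobi_covariant _ _ _ _ _ _ _ H0 H _ _ _ _ _ _ _ _ Pcl h1 h2 Hx) Hq.
have up (i : nat) : forall m n w, integral_mode mu n1 m ->
    jac mu (e n1 mset0) (- N - 1 + i%:Z) m n (e n2 mset0) w.
  elim: i => [|i IH] q q' x Hq; first by rewrite addr0; apply: base.
  rewrite -addn1 PoszD addrA.
  by apply: (jacobi_up H0 H Pcl) Hq => *; apply: IH.
have down (i : nat) : forall m n w, integral_mode mu n1 m ->
    jac mu (e n1 mset0) (- N - 1 - i%:Z) m n (e n2 mset0) w.
  elim: i => [|i IH]; first by move=> *; rewrite subr0; apply: base.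
  rewrite -addn1 PoszD opprD addrA.
  apply: (jacobi_down H0 H Pcl (vertex_translations mu n1) h2) => //.
  have -> : n1%:~R * ratr (weight 0 n2) + (- N - 1 - i%:Z)%:~R = (- 1 - i%:Z)%:~R :> K.
    rewrite /weight add0r -[n1%:~R]ratr_int -rmorphM -[(- N - _ - _)%:~R]ratr_int -rmorphD/= -[RHS]ratr_int.
    congr ratr; rewrite /N !intrB !intrN !intrM -[(2 * p)%:Z%:~R]/((2 * p)%:R) -[i%:Z%:~R]/(i%:R).
    by rewrite -[1%:~R]/(1 : rat); ring.
  by rewrite intr_eq0; lia.
move=> Hm; have [Hl|Hl] := leP (- N - 1) l.
  rewrite -(subrK (- N - 1) l) -[l - _]gez0_abs ?subr_ge0// addrC.
  exact: up.
rewrite -(subKr (- N - 1) l) -[X in _ - X]gez0_abs ?subr_ge0 ?ltW//.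
exact: down.
Qed.

Lemma jacobi_basis mu (n1 l : int) A m n v w : integral_mode mu n1 m ->
  jac mu (e n1 A) l m n v w.
Proof.
have H0 := Yf_fields 0; have H := Yf_fields mu; have Pcl := @integral_mode_shift mu n1.
move=> Hm; elim/mset_ind: A l m n v w Hm => [|j A IH]; last first.
  move=> l m n v w; rewrite -(hsN 0); apply: (@jacobi_normal_l _ _ _ _ _ _ _ H0 H _ j _ Pcl IH).
move=> l m n v w; elim/(@heis_ind 0): v l m n w => [c x y Hx Hy||n3|j x Hx] l m n w Hm.
- by apply: (jacobi_linear_m H0 H); [exact: Hx|exact: Hy].
- have -> : 0 = -1 *: e 0 mset0 + e 0 mset0 by rewrite scaleN1r addNr.
  by apply: (jacobi_linear_m H0 H); apply: jacobi_vertex.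
- exact: jacobi_vertex.
- exact: (@jacobi_normal_r _ _ _ _ _ _ _ H0 H _ _ j _ _ (highest_vertex n1) Hx).
Qed.

Definition signz (n : int) : K := (-1) ^ n.

Lemma signzD m n : signz (m + n) = signz m * signz n.
Proof. by rewrite /signz expfzDr// oppr_eq0 oner_eq0. Qed.

Lemma signz_sqr n : signz n * signz n = 1.
Proof. by rewrite /signz -expfzMl mulrNN mulr1 exp1rz. Qed.

Variable T : {linear M -> M}.
Hypothesis TE : forall n A, T (e n A) = signz n *: e n A.

Lemma parity_ind (s : K) (P : M -> Prop) : s * s = 1 ->
  (forall c u v, P u -> P v -> P (c *: u + v)) -> P 0 ->
  (forall n A, signz n = s -> P (e n A)) -> forall u, T u = s *: u -> P u.
Proof.
move=> ss PL P0 Pe u Tu; pose pr := 2^-1 \*: (idfun + s \*: T) : {linear M -> M}.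
have two : (2 : K) != 0 by rewrite pnatr_eq0.
suff Ppr w : P (pr w).
  have := Ppr u; rewrite /= Tu scalerA ss scale1r -mulr2n -scaler_nat scalerA mulVf//.
  by rewrite scale1r.
elim/span: w => [c x y Hx Hy||n A]; first by rewrite (linearPZ pr); apply: PL.
  by rewrite linear0.
have [Hn|Hn] := eqVneq (signz n) s.
  rewrite /= TE scalerA Hn ss scale1r -mulr2n -scaler_nat scalerA mulVf// scale1r.
  exact: Pe.
suff -> : pr (e n A) = 0 by [].
rewrite /= TE scalerA -[X in X + _]scale1r -scalerDl (_ : 1 + s * signz n = 0) ?scale0r ?scaler0//.
have /eqP : (s - signz n) * (s + signz n) = 0.
  by rewrite -subr_sqr !expr2 ss signz_sqr subrr.
rewrite mulf_eq0 subr_eq0 eq_sym (negbTE Hn) orFb addr_eq0 => /eqP ->.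
by rewrite mulNr signz_sqr subrr.
Qed.

Lemma T_hs mu k w : T (hs mu k w) = hs mu k (T w).
Proof.
elim/span: w => [c u v Hu Hv||n A]; first by rewrite !linearPZ Hu Hv.
  by rewrite !linear0.
case: k => [[|j]|j]; rewrite TE linearZZ.
- by rewrite !hs0 linearZZ TE !scalerA mulrC.
- by rewrite !hsP linearZZ TE !scalerA mulrC.
- by rewrite !hsN TE.
Qed.

Lemma T_shf n1 w : T (shf n1 w) = signz n1 *: shf n1 (T w).
Proof.
elim/span: w => [c u v Hu Hv||n A].
- by rewrite (linearPZ (shf n1)) !(linearPZ T) Hu Hv (linearPZ (shf n1)) scalerDr !scalerA [c * _]mulrC.
- by rewrite !linear0 ?scaler0.
by rewrite TE (linearZZ (shf n1)) !shfE TE signzD scalerA.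
Qed.

Lemma T_expC mu c x w : T (expC (hs mu) c x w) = expC (hs mu) c x (T w).
Proof.
apply: expq_commute => [||[|i] v] /=; rewrite ?linear0//.
  exact: creation_commuting (hs_rel mu) _ _.
by rewrite (linearZZ T) T_hs.
Qed.

Lemma T_expA mu c x w : T (expA (hs mu) c x w) = expA (hs mu) c x (T w).
Proof.
apply: expq_commute => [||[|i] v] /=; rewrite ?linear0//.
  exact: annihilation_commuting (hs_rel mu) _ _.
by rewrite (linearZZ T) T_hs.
Qed.

Lemma T_exp_series mu c n1 (f : nat -> rat) w :
  T (ssum (fun l => shf n1 (expC (hs mu) c (f l) (expA (hs mu) c l%:R w)))) =
  signz n1 *: ssum (fun l => shf n1 (expC (hs mu) c (f l) (expA (hs mu) c l%:R (T w)))).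
Proof.
rewrite linear_ssum; last exact: exp_terms_fin_supp (@hs_expA_fin mu c) f w.
rewrite scaler_ssum; last exact: exp_terms_fin_supp (@hs_expA_fin mu c) f (T w).
by apply: eq_ssum => l; rewrite T_shf T_expC T_expA.
Qed.

Lemma T_exp_series_basis mu c n1 (f : nat -> rat) n A :
  let w := ssum (fun l => shf n1 (expC (hs mu) c (f l) (expA (hs mu) c l%:R (e n A)))) in
  T w = signz (n1 + n) *: w.
Proof.
move=> w; rewrite /w T_exp_series signzD -scalerA; congr (_ *: _).
rewrite scaler_ssum; last exact: exp_terms_fin_supp (@hs_expA_fin mu c) f _.
apply: eq_ssum => l.
by rewrite TE (linearZZ (expA _ _ _)) (linearZZ (expC _ _ _)) (linearZZ (shf n1)).
Qed.

Lemma T_expm mu n1 m w : T (expm mu n1 m w) = signz n1 *: expm mu n1 m (T w).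
Proof.
elim/span: w => [c u v Hu Hv||n A].
- by rewrite (linearPZ (expm _ _ _)) !(linearPZ T) Hu Hv (linearPZ (expm _ _ _)) scalerDr !scalerA [c * _]mulrC.
- by rewrite !linear0 ?scaler0.
by rewrite expmE T_exp_series_basis TE (linearZZ (expm _ _ _)) expmE scalerA -signzD.
Qed.

Lemma T_nfield mu n1 s m w : T (nfield mu n1 s m w) = signz n1 *: nfield mu n1 s m (T w).
Proof.
elim: s m w => [|j s IH] m w; first exact: T_expm.
have fL := normL_fin_supp (hs mu) j (nfield mu n1 s).
have fR := normR_fin_supp (hs_rel mu) j (nfield mu n1 s).
rewrite /= /normal (linearD T) scalerDr /normL /normR !(linear_ssum T)// !scaler_ssum//.
congr (_ + _); apply: eq_ssum => i; rewrite (linearZZ T) ?T_hs IH ?T_hs ?(linearZZ (hs mu _)).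
  by rewrite !scalerA mulrC.
by rewrite !scalerA mulrC.
Qed.

Lemma T_Y mu u m w : T (Yop mu u m w) = Yop mu (T u) m (T w).
Proof.
rewrite /Yop; elim/span: u => [c u v Hu Hv||n A].
- by rewrite YP linearPZ Hu Hv linearPZ YP.
- by rewrite linear0 !Y0l linear0.
rewrite TE (linear_funZ (fun c x y => YP mu c x y m (T w))) !YE !nmodeE.
exact: T_nfield.
Qed.

Lemma nfield_eq0 mu n1 s m w : ~ integral_mode mu n1 m -> nfield mu n1 s m w = 0.
Proof.
elim: s m w => [|j s IH] m w Hm.
  elim/span: w => [c u v Hu Hv||n A]; rewrite ?linear0//.
    by rewrite linearPZ Hu Hv scaler0 addr0.
  rewrite /= expmE ssum_eq0// => l; rewrite [expC _ _ _ _]expq_nnat ?linear0//.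
  apply: contra_notN Hm => Hm; rewrite /integral_mode.
  set x := (X in X \is a Num.nat) in Hm.
  rewrite (_ : m + _ = - x - 1 + l%:R - (n1 * ((2 * p)%:Z * n))%:~R); last first.
    by rewrite /x /weight !intrM -[(2 * p)%:Z%:~R]/((2 * p)%:R); ring.
  have xint : x \is a Num.int by have /natrP[k ->] := Hm; exact: natr_int.
  by rewrite rpredB ?intr_int// rpredD ?natr_int// rpredB// rpredN.
have Hs (k : int) : ~ integral_mode mu n1 (m + k%:~R).
  move=> /(@integral_mode_shift mu n1 _ (- k)); rewrite intrN addrK; exact: Hm.
rewrite /= /normal /normL /normR !ssum_eq0 ?addr0// => i; rewrite IH ?linear0 ?scaler0//.
- by have := Hs (- i%:Z - j%:Z - 1); rewrite !intrB intrN !addrA.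
- by have := Hs (i%:Z - j%:Z); rewrite !intrB addrA.
Qed.

Lemma signz_inj n m : signz n = signz m -> exists q, n = m + (q + q).
Proof.
move=> H; have [q [Hq|Hq]] : exists q, n - m = q + q \/ n - m = q + q + 1.
- by exists ((n - m) %/ 2)%Z; lia.
- by exists q; lia.
exfalso; have /eqP : signz n = - signz m.
  have -> : n = m + (q + q) + 1 by lia.
  by rewrite !signzD signz_sqr mulr1 /signz expr1z mulrN1.
rewrite H -subr_eq0 opprK -mulr2n -mulr_natr mulf_eq0 pnatr_eq0 orbF => /eqP H0.
by have := signz_sqr m; rewrite H0 mul0r => /esym/eqP; rewrite oner_eq0.
Qed.

Lemma parity_integral mu r n m : 2 * (k0 * mu) \is a Num.int -> signz n = signz r ->
  integral_mode mu n m = integral_mode mu r m.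
Proof.
move=> Hmu /signz_inj[q ->]; rewrite /integral_mode.
have -> : m + (r + (q + q))%:~R * (k0 * mu) = m + r%:~R * (k0 * mu) + q%:~R * (2 * (k0 * mu)).
  by rewrite !intrD; ring.
by rewrite rpredDr// rpredM// intr_int.
Qed.

Lemma parity_Y_eq0 mu r m w u : 2 * (k0 * mu) \is a Num.int ->
  T u = signz r *: u -> ~ integral_mode mu r m -> Yop mu u m w = 0.
Proof.
move=> Hmu + Hm; move: u; apply: (@parity_ind (signz r) _ (signz_sqr r)) => [c x y Hx Hy||n A Hn].
- by rewrite /Yop YP -!/(Yop _ _ _ _) Hx Hy scaler0 addr0.
- exact: Y0l.
rewrite /Yop YE nmodeE; apply: nfield_eq0.
by rewrite (parity_integral _ Hmu Hn).
Qed.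

Lemma parity_jacobi mu r u l m n v w : 2 * (k0 * mu) \is a Num.int ->
  T u = signz r *: u -> integral_mode mu r m -> jac mu u l m n v w.
Proof.
move=> Hmu + Hm; have H0 := Yf_fields 0; have H := Yf_fields mu.
move: u; apply: (@parity_ind (signz r) _ (signz_sqr r)) => [c x y Hx Hy||n1 A Hn].
- exact: (jacobi_linear_l H0 H).
- have -> : 0 = -1 *: e r mset0 + e r mset0 by rewrite scaleN1r addNr.
  by apply: (jacobi_linear_l H0 H); apply: jacobi_basis.
by apply: jacobi_basis; rewrite (parity_integral _ Hmu Hn).
Qed.

Lemma twisted_jacobi mu r u (l : int) m n v w : 2 * (k0 * mu) \is a Num.int ->
  T u = signz r *: u -> integral_mode mu r m ->
  ssum (fun i => ratr (gbinom m i) *: Y mu (Y 0 u (l + i%:Z)%:~R v) (m + n - i%:R) w) =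
  ssum (fun i => ((-1) ^+ i * gbinom l%:~R i) *:
    (Y mu u (m + l%:~R - i%:R) (Y mu v (n + i%:R) w)
     - (-1) ^ l *: Y mu v (n + l%:~R - i%:R) (Y mu u (m + i%:R) w))).
Proof.
move=> Hmu Hu Hm; have := parity_jacobi l n v w Hmu Hu Hm.
have H := Yf_fields mu; rewrite /jacobi /jacobi_lhs /jacobi_rhs /dsum.
set L := ssum _; set S := ssum _; set S' := ssum _ => HL.
transitivity L.
  apply: eq_ssum => i; rewrite expr1n mul1r ratr_gbinom intrD [n + m]addrC.
  by [].
rewrite HL ssumB_scale; last 2 first.
- exact: (truncated_fin_suppZ _ _ _ (truncated_prod H u v w)).
- exact: (truncated_fin_suppZ _ _ _ (truncated_prod H v u w)).
apply: eq_ssum => i; rewrite ratr_int scalerB_comm.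
by [].
Qed.

Lemma Y_vacuum mu m w : Yop mu (e 0 mset0) m w = if m == -1 then w else 0.
Proof.
rewrite -[Yop _ _ _ _]/(Yf mu (e 0 mset0) m w).
elim/(@heis_ind mu): w => [c x y Hx Hy||n|j x Hx].
- by rewrite linearPZ Hx Hy; case: eqP => // _; rewrite scaler0 addr0.
- by rewrite linear0 if_same.
- rewrite vertex_on_vertex mul0r subr0; set x := - m - 1.
  have [m1|m1] := eqVneq m (-1).
    by rewrite /x m1 opprK subrr [expC _ _ _ _]expq0 shfE add0r.
  have rx0 : ratr x != 0 :> K by rewrite fmorph_eq0 /x subr_eq0 eqr_oppLR.
  rewrite (_ : expC _ _ _ _ = 0) ?linear0//; apply: (scalerI rx0).
  rewrite scaler0 [ratr x *: _]expq_rec//; last exact: creation_commuting (hs_rel mu) _ _.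
  rewrite ssum_eq0// => -[|i]; first by rewrite scale0r.
  by rewrite /= rmorph0 mul0r scale0r scaler0.
have := highest_comm (Yf_fields mu) (Negz j) m x (highest_vertex 0).
rewrite /weight addr0 mulr0 rmorph0 scale0r addr0 Hx => <-.
by case: ifP => // _; rewrite linear0.
Qed.

(* For e^{-alpha} only the term l = 0 can survive, and its exponent x is
   negative. *)
Lemma screening_vertex c x : x < 0 ->
  ssum (fun l => shf 0 (expC (hs 0) c (x + l%:R) (expA (hs 0) c l%:R (e (-1) mset0)))) = 0.
Proof.
move=> x0; rewrite ssum_eq0// => -[|l].
  by rewrite addr0 [expC _ _ _ _]expq_lt0// linear0.
rewrite (expA_vacuum (hs_rel 0)) ?linear0//; exact: hs_vacuum.
Qed.

End LatticeModel.

Lemma mulr_combination (K : comNzRingType) (a c x y x' y' : K) :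
  x' = a * x -> y' = a * y -> c * x' + y' = a * (c * x + y).
Proof. by move=> -> ->; rewrite mulrDr mulrCA. Qed.

Section Concrete.
Variables (R : realType) (p : nat).
Local Notation K := R[i].
Local Notation M := (latspace R).
Local Notation "''e' n A" := (lattice_vector R n A) (at level 10, n at level 8, A at level 8).
Local Notation k0 := ((2 * p)%:R : rat).
Local Opaque linext lattice_vector heis.

Definition hsc mu (k : int) : {linear M -> M} := heis p mu k.

Lemma hsc_relations mu : heisenberg_relations (hsc mu) (ratr k0).
Proof. by rewrite ratr_nat; exact: heis_relations. Qed.

Lemma hsc0 mu n A : hsc mu (Posz 0) ('e n A) = ratr (weight p mu n) *: 'e n A.
Proof. exact: heis0_basis. Qed.

Lemma mcoeff_heis0 mu b w : mcoeff b (heis p mu (Posz 0) w) = alpha0 R p mu b.1 * mcoeff b w.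
Proof.
elim/latspace_ind: w => [c u v Hu Hv||n A].
- have lin (x y : M) : mcoeff b (c *: x + y) = c * mcoeff b x + mcoeff b y.
    by rewrite (mcoeffD b (c *: x) y) (mcoeffZ c x b).
  rewrite heisD heisZ (lin u v) (lin (heis p mu 0 u) (heis p mu 0 v)).
  exact: mulr_combination.
- by rewrite linear0 !mcoeff0 mulr0.
rewrite heis0_basis mcoeffZ mcoeff_lattice_vector.
by case: eqP => [<-//|_]; rewrite !mulr0.
Qed.

Lemma hsc_weight_sep mu r (F G : {linear M -> M}) w :
  (forall n A, weight p mu n = r -> F ('e n A) = G ('e n A)) ->
  hsc mu (Posz 0) w = ratr r *: w -> F w = G w.
Proof.
move=> FG Hw; rewrite (latspaceE (fsubset_refl (msupp w))) (linear_sum F) (linear_sum G).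
apply: eq_big_seq => b Hb; rewrite (linearZZ F) (linearZZ G); congr (_ *: _).
apply: FG; have := congr1 (mcoeff b) Hw; rewrite mcoeff_heis0 mcoeffZ => /mulIf H.
have /H : mcoeff b w != 0 by rewrite mcoeff_neq0.
exact: fmorph_inj.
Qed.

Lemma shiftc_linear n : linear (shift (R := R) n).
Proof. exact: linext_linear. Qed.
HB.instance Definition _ n := GRing.isLinear.Build K M M *:%R (shift n) (shiftc_linear n).
Definition shc n1 : {linear M -> M} := shift n1.

Lemma shiftc_basis n1 n A : shift n1 ('e n A) = 'e (n1 + n) A.
Proof. exact: linext_basis. Qed.

Lemma exp_coefE (X : nat -> M -> M) (X' : nat -> {linear M -> M}) k w :
  (forall i w, X i w = X' i w) -> exp_coef X k w = oexp X' k w.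
Proof.
move=> H; rewrite /exp_coef /oexp; apply: eq_bigr => j _; congr (_ *: _).
have {}IH : forall j k w, pow_coef X j k w = opow X' j k w.
  by elim=> //= i IH k' w'; apply: eq_bigr => i' _; rewrite H IH.
exact: IH.
Qed.

Lemma exp_minusE mu (c : rat) k w : exp_minus p c k w = expC (hsc mu) c k%:R w.
Proof. by rewrite /expC expq_nat; apply: exp_coefE => -[|i] v //=. Qed.

Lemma exp_plusE mu (c : rat) k w : exp_plus p c k w = expA (hsc mu) c k%:R w.
Proof. by rewrite /expA expq_nat; apply: exp_coefE => -[|i] v //=. Qed.

Lemma exp_modec_linear lam mu n1 m : linear (exp_mode (R := R) p lam mu n1 m).
Proof. exact: linext_linear. Qed.
HB.instance Definition _ lam mu n1 m :=
  GRing.isLinear.Build K M M *:%R (exp_mode p lam mu n1 m) (exp_modec_linear lam mu n1 m).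
Definition exc mu n1 m : {linear M -> M} := exp_mode p 0 mu n1 m.

Lemma exp_mode_basis lam mu n1 m n A (c := lam + n1%:~R) :
  exp_mode p lam mu n1 m ('e n A) =
  ssum (fun l => shc n1 (expC (hsc mu) c (- m - 1 - c * weight p mu n + l%:R)
                    (expA (hsc mu) c l%:R ('e n A)))).
Proof.
rewrite [LHS]linext_basis.
rewrite (fsbig_diag _ _ (fun k l => shift n1 (exp_minus p c k (exp_plus p c l ('e n A))))).
apply: eq_ssum => l; rewrite (exp_plusE mu).
set x := (X in X \is a Num.nat).
have -> : - m - 1 - c * weight p mu n + l%:R = x by rewrite /x /c /weight /=; ring.
case: ifPn => [/truncnK Hx|Hx].
  by rewrite (exp_minusE mu) Hx.
by rewrite [expC _ _ _ _]expq_nnat// linear0.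
Qed.

Lemma excE mu n1 m n A : exc mu n1 m ('e n A) =
  ssum (fun l => shc n1 (expC (hsc mu) n1%:~R (- m - 1 - n1%:~R * weight p mu n + l%:R)
                    (expA (hsc mu) n1%:~R l%:R ('e n A)))).
Proof. by rewrite [LHS]exp_mode_basis add0r. Qed.

Lemma normal_modeS mu n j s m w : normal_mode p 0 mu n (j :: s) m w =
  ssum (fun t => gbinom (t%:R : K) j *: hsc mu (Negz t) (normal_mode p 0 mu n s (m + t%:R - j%:R) w))
  + ssum (fun k => gbinom (- k%:R - 1 : K) j *:
                   normal_mode p 0 mu n s (m - k%:R - j%:R - 1) (hsc mu (Posz k) w)).
Proof.
pose nm (q : int) (v : M) : M := normal_mode p 0 mu n s (m - q%:~R - j%:R - 1) v.
have E : normal_mode p 0 mu n (j :: s) m w =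
  \sum_(k \in [set k : int | (k < 0)%R]) gbinom ((- k - 1)%:~R : K) j *: heis p (0 + mu) k (nm k w)
  + \sum_(k \in [set k : int | (0 <= k)%R]) gbinom ((- k - 1)%:~R : K) j *: nm k (heis p mu k w).
  reflexivity.
have E1 := fsbig_neg_int (M := M)
  (fun k => gbinom ((- k - 1)%:~R : K) j *: heis p (0 + mu) k (nm k w)).
have E2 := fsbig_nneg_int (M := M)
  (fun k => gbinom ((- k - 1)%:~R : K) j *: nm k (heis p mu k w)).
refine (etrans E (congr2 +%R (etrans E1 _) (etrans E2 _))); apply: eq_ssum => i; rewrite /nm.
  have -> : (- Negz i - 1)%:~R = i%:R :> K by rewrite NegzE opprK -addn1 PoszD addrK.
  have -> : m - (Negz i)%:~R - j%:R - 1 = m + i%:R - j%:R by rewrite intr_Negz; ring.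
  by rewrite add0r.
by have -> : (- i%:Z - 1)%:~R = - i%:R - 1 :> K by rewrite intrB intrN.
Qed.

Lemma lattice_mode_basis mu n A m w :
  lattice_mode p 0 mu ('e n A) m w = normal_mode p 0 mu n (enum_mset A) m w.
Proof. exact: (linext_basis (fun b => normal_mode p 0 mu b.1 (enum_mset b.2) m w)). Qed.

Lemma lattice_mode_linear_l lam mu (c : K) (u v : M) m w :
  lattice_mode p lam mu (c *: u + v) m w =
  c *: lattice_mode p lam mu u m w + lattice_mode p lam mu v m w.
Proof. exact: (linext_linear (fun b => normal_mode p lam mu b.1 (enum_mset b.2) m w)). Qed.

End Concrete.

Lemma exprzN1 (F : fieldType) (n : int) : (-1) ^ n = (-1) ^+ odd (absz n) :> F.
Proof.
case: n => n; first by rewrite signr_odd.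
by rewrite NegzE -invr_expz -exprVn invrN1 abszN signr_odd.
Qed.

Section LatticeInstance.
Variables (R : realType) (p : nat).
Local Notation K := R[i].
Local Notation M := (latspace R).
Local Notation "''e' n A" := (lattice_vector R n A) (at level 10, n at level 8, A at level 8).

Lemma cos_sin_nat_pi (n : nat) : cos (n%:R * pi) = (-1) ^+ n :> R /\ sin (n%:R * pi) = 0 :> R.
Proof.
elim: n => [|n [IHc IHs]]; first by rewrite mul0r cos0 sin0.
by rewrite -natr1 mulrDl mul1r cosDpi sinDpi IHc IHs oppr0 exprS mulN1r.
Qed.

Lemma cexp_int_pi (n : int) : cexp (0 +i* (n%:~R * pi))%C = (-1) ^ n :> K.
Proof.
have [c s] : cos (n%:~R * pi) = (-1) ^ n :> R /\ sin (n%:~R * pi) = 0 :> R.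
  case: n => n; first exact: cos_sin_nat_pi.
  have [c s] := cos_sin_nat_pi n.+1.
  by rewrite NegzE intrN mulNr cosN sinN c s oppr0 -invr_expz -exprVn invrN1.
rewrite /cexp c s expR0 mul1r.
rewrite !exprzN1; case: odd; rewrite ?expr0 ?expr1//.
by apply/eqP; rewrite eq_complex /= oppr0 !eqxx.
Qed.

Lemma hsN_basis mu j n A : hsc R p mu (Negz j) ('e n A) = 'e n (j +` A)%mset.
Proof. exact: heisN_basis. Qed.

Lemma hsP_basis mu j n A : hsc R p mu (Posz j.+1) ('e n A) =
  (2 * p * j.+1 * A j)%:R *: 'e n (A `\ j)%mset.
Proof. exact: heisP_basis. Qed.

Lemma normal_mode0 mu n m w : normal_mode p 0 mu n [::] m w = exc R p mu n m w.
Proof. by []. Qed.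

Lemma tau_linear : linear (tau R p : M -> M).
Proof. exact: linext_linear. Qed.
Definition tauc : {linear M -> M} :=
  HB.pack (tau R p : M -> M) (GRing.isLinear.Build K M M *:%R (tau R p : M -> M) tau_linear).

Hypothesis p_gt0 : (0 < p)%N.

Lemma tau_basis n A : tauc ('e n A) = signz K n *: 'e n A.
Proof.
rewrite [LHS]linext_basis /= /signz -cexp_int_pi; congr (cexp _ *: _).
have -> : alpha0 R p 0 n = (((2 * p)%:Z * n)%:~R : R)%:C%C.
  rewrite /alpha0 add0r (_ : _ * _ = ((2 * p)%:Z * n)%:~R); last by rewrite intrM.
  by rewrite ratr_int; apply/esym/(rmorph_int (real_complex R)).
apply/eqP; rewrite eq_complex /= !mul0r mulr0 subrr add0r eqxx /=.
have p0 : (2 * p)%:R != 0 :> R by rewrite pnatr_eq0 muln_eq0 /= -lt0n.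
rewrite intrM -[(2 * p)%:Z%:~R]/((2 * p)%:R).
by rewrite mulrA divfK// mulrC.
Qed.

Lemma VL_twisted_jacobi mu r (u v w : M) (l : int) (m n : rat) :
  2 * ((2 * p)%:R * mu) \is a Num.int -> tau R p u = (-1) ^ r *: u ->
  integral_mode p mu r m ->
  ssum (fun i => ratr (gbinom m i) *: lattice_mode p 0 mu (lattice_mode p 0 0 u (l + i%:Z)%:~R v) (m + n - i%:R) w) =
  ssum (fun i => ((-1) ^+ i * gbinom (l%:~R : K) i) *:
    (lattice_mode p 0 mu u (m + l%:~R - i%:R) (lattice_mode p 0 mu v (n + i%:R) w)
     - (-1) ^ l *: lattice_mode p 0 mu v (n + l%:~R - i%:R) (lattice_mode p 0 mu u (m + i%:R) w))).
Proof.
exact: (twisted_jacobi (@latspace_ind R) (hsc_relations R p) (@hsc0 R p) hsN_basis hsP_basis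
  (@hsc_weight_sep R p) (@shiftc_basis R) (@excE R p) normal_mode0 (@normal_modeS R p)
  (@lattice_mode_basis R p) (fun mu => @lattice_mode_linear_l R p 0 mu) tau_basis).
Qed.

Lemma lattice_mode_eq0 mu r m (u w : M) :
  2 * ((2 * p)%:R * mu) \is a Num.int -> tau R p u = (-1) ^ r *: u ->
  ~ integral_mode p mu r m -> lattice_mode p 0 mu u m w = 0.
Proof.
exact: (parity_Y_eq0 (@latspace_ind R) (hsc_relations R p) hsN_basis hsP_basis
  (@excE R p) normal_mode0 (@normal_modeS R p)
  (@lattice_mode_basis R p) (fun mu => @lattice_mode_linear_l R p 0 mu) tau_basis).
Qed.

Lemma lattice_mode_vacuum mu m (w : M) :
  lattice_mode p 0 mu ('e 0 mset0) m w = if m == -1 then w else 0.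
Proof.
exact: (Y_vacuum (@latspace_ind R) (hsc_relations R p) (@hsc0 R p) hsN_basis hsP_basis
  (@hsc_weight_sep R p) (@shiftc_basis R) (@excE R p) normal_mode0 (@normal_modeS R p)
  (@lattice_mode_basis R p) (fun mu => @lattice_mode_linear_l R p 0 mu)).
Qed.

Lemma lattice_mode_linear_r mu (u : M) m (c : K) (w w' : M) :
  lattice_mode p 0 mu u m (c *: w + w') =
  c *: lattice_mode p 0 mu u m w + lattice_mode p 0 mu u m w'.
Proof.
exact: (Yop_linear (@latspace_ind R) (hsc_relations R p) hsN_basis hsP_basis
  (@excE R p) normal_mode0 (@normal_modeS R p)
  (@lattice_mode_basis R p) (fun mu => @lattice_mode_linear_l R p 0 mu)).
Qed.

Lemma lattice_mode_trunc mu (u w : M) :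
  exists B : rat, forall m, B <= m -> lattice_mode p 0 mu u m w = 0.
Proof.
exact: (Yop_trunc (@latspace_ind R) (hsc_relations R p) hsN_basis hsP_basis
  (@excE R p) normal_mode0 (@normal_modeS R p)
  (@lattice_mode_basis R p) (fun mu => @lattice_mode_linear_l R p 0 mu)).
Qed.

Lemma tau_lattice_mode mu (u w : M) m :
  tau R p (lattice_mode p 0 mu u m w) = lattice_mode p 0 mu (tau R p u) m (tau R p w).
Proof.
exact: (T_Y (@latspace_ind R) (hsc_relations R p) (@hsc0 R p) hsN_basis hsP_basis
  (@shiftc_basis R) (@excE R p) normal_mode0 (@normal_modeS R p)
  (@lattice_mode_basis R p) (fun mu => @lattice_mode_linear_l R p 0 mu) tau_basis).
Qed.

Lemma QtildeE (w : VL R p) : Qtilde w = exp_mode p (- p%:R^-1) 0 0 0 w.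
Proof.
have := linext_basis (fun b => normal_mode p (- p%:R^-1) 0 b.1 (enum_mset b.2) 0 w) 0 mset0.
by rewrite /= enum_mset0.
Qed.

Definition Qtildec : {linear M -> M} := exp_mode p (- p%:R^-1) 0 0 0.

Lemma Qtilde_tau (w : VL R p) : Qtilde (tau R p w) = tau R p (Qtilde w).
Proof.
rewrite !QtildeE.
apply: (@linear_eqP R (Qtildec \o tauc)%FUN (tauc \o Qtildec)%FUN) => n A /=.
rewrite -[tau R p _]/(tauc ('e n A)) tau_basis.
rewrite -[exp_mode _ _ _ _ _ _]/(Qtildec (_ *: _)) (linearZZ Qtildec) /=.
rewrite exp_mode_basis -[X in signz K X]add0r; apply/esym.
exact: (T_exp_series_basis (@latspace_ind R) (hsc_relations R p) (@hsc0 R p) hsN_basis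
  hsP_basis (@shiftc_basis R) tau_basis).
Qed.

Lemma Qtilde_vertex : Qtilde ('e (-1) mset0 : VL R p) = 0.
Proof.
rewrite QtildeE exp_mode_basis; apply: (screening_vertex (@shc R) (hsc_relations R p) hsP_basis).
have p0 : p%:R != 0 :> rat by rewrite pnatr_eq0 -lt0n.
rewrite /weight addr0 natrM (_ : _ - _ = - 3) ?oppr_lt0//.
by field.
Qed.

End LatticeInstance.

(** * Twisted modules over the triplet algebra *)

Section PartialLinear.
Variables (K : numFieldType) (M : lmodType K) (W : set M) (s : M -> M).
Hypothesis W0 : W 0.
Hypothesis sP : forall c u v, W u -> W v -> s (c *: u + v) = c *: s u + s v.

Lemma partial_linear0 : s 0 = 0.
Proof.
have := sP 1 W0 W0; rewrite !scale1r addr0 => /eqP.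
by rewrite -[X in X == _]addr0 (inj_eq (addrI _)) => /eqP.
Qed.

Lemma partial_linearZ c u : W u -> s (c *: u) = c *: s u.
Proof. by move=> Wu; rewrite -[c *: u]addr0 sP// partial_linear0 !addr0. Qed.
End PartialLinear.

Lemma scalerN1_neq (K : numFieldType) (M : lmodType K) (v : M) : v != 0 -> -1 *: v != v.
Proof.
rewrite scaleN1r; apply: contra_neq => /eqP; rewrite eq_sym -subr_eq0 opprK -mulr2n -scaler_nat scaler_eq0.
by rewrite pnatr_eq0 /= => /eqP.
Qed.

Section TwistedModule.
Variables (R : realType) (p j : nat).
Hypothesis p_gt0 : (0 < p)%N.
Local Notation K := R[i].
Local Notation V := (VL R p).
Local Notation mu := (Rj_weight p j).

Lemma Rj_weightE : (2 * p)%:R * mu = (3 * p)%:R - j%:R - 2^-1 :> rat.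
Proof.
have p0 : p%:R != 0 :> rat by rewrite pnatr_eq0 -lt0n.
by rewrite /Rj_weight [(2 * p)%:R]natrM; field.
Qed.

Lemma Rj_weight_half : 2 * ((2 * p)%:R * mu) \is a Num.int.
Proof.
rewrite Rj_weightE mulrBr divff ?pnatr_eq0// rpredB ?rpredM ?rpredB ?natr_int//.
Qed.

Lemma integral_mode_half (r : nat) (m : rat) :
  (integral_mode p mu (- r%:Z) m : Prop) <-> m - r%:R / 2%:R \is a Num.int.
Proof.
rewrite /integral_mode Rj_weightE.
have -> : m + (- r%:Z)%:~R * ((3 * p)%:R - j%:R - 2^-1) =
    m - r%:R / 2%:R + (r%:R - r%:R * ((3 * p)%:R - j%:R)) :> rat.
  by rewrite intrN -[r%:Z%:~R]/(r%:R); field.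
by rewrite rpredDr// rpredB ?rpredM ?rpredB ?natr_int.
Qed.

Lemma twisted_module_of_parity (W : set V) (g s : V -> V) (t : nat) :
  is_endomorphism W g -> has_order W g t ->
  (forall (c : K) u v, W u -> W v -> s (c *: u + v) = c *: s u + s v) ->
  (forall u v n, W u -> W v -> s (vmode u n v) = vmode (s u) n (s v)) ->
  s (vvac V) = vvac V ->
  (forall u r, W u -> eigenvector g t r u -> exists r' : int,
    tau R p (s u) = (-1) ^ r' *: s u /\
    forall m, (integral_mode p mu r' m : Prop) <-> m - r%:R / t%:R \is a Num.int) ->
  twisted_module W g t (twist s (Rj R p j)).
Proof.
move=> Hg Ho sP sM s1 Hpar; split; first exact: conj Hg Ho.
split.
- split=> [c u v n w Wu Wv|c u n w w' Wu]; rewrite /twist /Rj.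
    rewrite sP//; exact: lattice_mode_linear_l.
  exact: lattice_mode_linear_r.
- by move=> u w _; apply: lattice_mode_trunc.
- move=> u r n w Wu /Hpar[//|r' [Hr Hm]] /negP Hn.
  by apply: (lattice_mode_eq0 p_gt0 _ Rj_weight_half Hr) => /Hm.
- by move=> n w; rewrite /twist s1; apply: lattice_mode_vacuum.
move=> u v w r l k n Wu Wv /Hpar[//|r' [Hr Hm]] m.
have Hm' : integral_mode p mu r' m by apply/Hm; rewrite /m addrAC subrr add0r intr_int.
have J := VL_twisted_jacobi p_gt0 (s v) w l n Rj_weight_half Hr Hm'.
suff: ssum (fun i => ratr (gbinom m i) *:
    lattice_mode p 0 mu (s (vmode u (l + i%:Z) v)) (m + n - i%:R) w) =
  ssum (fun i => ((-1) ^+ i * gbinom (l%:~R : K) i) *: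
    (lattice_mode p 0 mu (s u) (m + l%:~R - i%:R) (lattice_mode p 0 mu (s v) (n + i%:R) w)
     - (-1) ^ l *: lattice_mode p 0 mu (s v) (n + l%:~R - i%:R)
         (lattice_mode p 0 mu (s u) (m + i%:R) w))) by [].
refine (etrans (eq_ssum _) J) => i.
exact: (congr1 (fun x => ratr (gbinom m i) *: lattice_mode p 0 mu x (m + n - i%:R) w)
  (sM u v _ Wu Wv)).
Qed.

End TwistedModule.

Section Triplet.
Variables (R : realType) (p : nat).
Hypothesis p_gt0 : (0 < p)%N.
Local Notation K := R[i].
Local Notation V := (VL R p).
Local Notation W := (triplet R p).
Variable sigma : automorphism W (omega R p).

Lemma triplet0 : W 0.
Proof. exact: (etrans (QtildeE _) (linear0 (Qtildec R p))). Qed.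

Lemma triplet_tau v : W v -> W (tau R p v).
Proof.
move=> Wv; apply: (etrans (Qtilde_tau p_gt0 v)).
exact: (etrans (congr1 (tau R p) Wv) (linear0 (tauc R p))).
Qed.

Lemma tau_endomorphism : is_endomorphism W (tau R p).
Proof.
split.
- exact: triplet_tau.
- by move=> c u v _ _; exact: tau_linear.
- have := tau_basis R p_gt0 0 mset0; rewrite /signz expr0z scale1r; exact.
- by move=> u v n _ _; exact: tau_lattice_mode.
Qed.

Lemma comp_endomorphism (f g : V -> V) : is_endomorphism W f -> is_endomorphism W g ->
  is_endomorphism W (f \o g).
Proof.
move=> [f1 f2 f3 f4] [g1 g2 g3 g4]; split => /=.
- by move=> v /g1/f1.
- move=> c u v Wu Wv.
  exact: (etrans (congr1 f (g2 c u v Wu Wv)) (f2 c _ _ (g1 _ Wu) (g1 _ Wv))).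
- exact: (etrans (congr1 f g3) f3).
- move=> u v n Wu Wv.
  exact: (etrans (congr1 f (g4 u v n Wu Wv)) (f4 _ _ n (g1 _ Wu) (g1 _ Wv))).
Qed.

Let g := aut_inv sigma \o tau R p \o sigma.

Lemma aut_scale (c : K) u : W u -> sigma (c *: u) = c *: sigma u.
Proof.
have [_ sP _ _] := aut_endo sigma.
exact: (partial_linearZ triplet0 sP).
Qed.

Lemma aut_mem u : W u -> W (sigma u).
Proof. by have [s1 _ _ _] := aut_endo sigma; exact: s1. Qed.

Lemma aut_inv_mem u : W u -> W (aut_inv sigma u).
Proof. by have [s1 _ _ _] := aut_inv_endo sigma; exact: s1. Qed.

Lemma tau_aut (c : K) u : W u -> g u = c *: u -> tau R p (sigma u) = c *: sigma u.
Proof.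
move=> Wu gu; have E := aut_invK sigma (triplet_tau (aut_mem Wu)).
exact: (etrans (esym E) (etrans (congr1 sigma gu) (aut_scale c Wu))).
Qed.

Lemma tau_tau (v : V) : tau R p (tau R p v) = v.
Proof.
apply: (@linear_eqP R (tauc R p \o tauc R p)%FUN idfun) => n A /=.
rewrite -[tau R p (lattice_vector _ _ _)]/(tauc R p _) tau_basis// -[tau R p _]/(tauc R p _).
by rewrite (linearZZ (tauc R p)) tau_basis// scalerA signz_sqr scale1r.
Qed.

Lemma triplet_vertex : W (lattice_vector R (-1) mset0).
Proof. exact: Qtilde_vertex. Qed.

Lemma lattice_vector_neq0 n A : lattice_vector R n A != 0.
Proof.
apply/eqP => /(congr1 (mcoeff (n, A))); rewrite mcoeff_lattice_vector eqxx mcoeff0.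
by move/eqP; rewrite oner_eq0.
Qed.

Lemma conjugate_order : has_order W g 2.
Proof.
split=> [//|v Wv|[//|[|//]] _].
  have E := aut_invK sigma (triplet_tau (aut_mem Wv)).
  exact: (etrans (congr1 (fun x => aut_inv sigma (tau R p x)) E)
    (etrans (congr1 (aut_inv sigma) (tau_tau _)) (autK sigma Wv))).
pose v0 : V := lattice_vector R (-1) mset0.
have Wv : W v0 := triplet_vertex.
have Wv' := aut_inv_mem Wv; exists (aut_inv sigma v0); first exact: Wv'.
have [_ iP _ _] := aut_inv_endo sigma; have [_ sP _ _] := aut_endo sigma.
have tv : tau R p v0 = -1 *: v0.
  have sN1 : signz K (-1) = -1 by rewrite /signz exprzN1.
  by have := tau_basis R p_gt0 (-1) mset0; rewrite sN1.
have gv0 : g (aut_inv sigma v0) = -1 *: aut_inv sigma v0.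
  apply: (etrans (congr1 (fun x => aut_inv sigma (tau R p x)) (aut_invK sigma Wv))).
  apply: (etrans (congr1 (aut_inv sigma) tv)).
  exact: partial_linearZ triplet0 iP _ _ Wv.
have v0_neq0 : aut_inv sigma v0 != 0.
  apply/eqP => v00; move/eqP: (lattice_vector_neq0 (-1) mset0); apply.
  exact: (etrans (esym (aut_invK sigma Wv)) (etrans (congr1 sigma v00) (partial_linear0 triplet0 sP))).
apply/eqP => E; move/eqP: (scalerN1_neq v0_neq0); apply.
exact: etrans (esym gv0) E.
Qed.

Lemma conjugate_endomorphism : is_endomorphism W g.
Proof.
apply: comp_endomorphism (aut_endo sigma).
exact: comp_endomorphism (aut_inv_endo sigma) tau_endomorphism.
Qed.

End Triplet.

Theorem proposition4p1 (R : realType) (p j : nat)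
    (sigma : automorphism (triplet R p) (omega R p)) :
  (2 <= p)%N -> (1 <= j <= 2 * p)%N ->
  let g := aut_inv sigma \o tau R p \o sigma in
  twisted_module (triplet R p) g 2 (twist sigma (Rj R p j)) /\
  (forall W0 : set (VL R p),
      is_subalgebra W0 -> W0 `<=` triplet R p ->
      (forall v, W0 v -> g v = v) ->
      untwisted_module W0 (twist sigma (Rj R p j))).
Proof.
move=> p2 _ g; have p0 : (0 < p)%N by exact: ltnW.
have [s1 s2 s3 s4] := aut_endo sigma.
split.
  apply: (twisted_module_of_parity p0 (conjugate_endomorphism p0 sigma)
    (conjugate_order p0 sigma) s2 s4 s3) => u r Wu gu.
  exists (- r%:Z); split; last by move=> m; exact: integral_mode_half.
  apply: (tau_aut p0 Wu); apply: (etrans gu); congr (_ *: u).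
  rewrite -cexp_int_pi; congr (cexp (_ +i* _)%C).
  by rewrite intrN -[r%:Z%:~R]/(r%:R); field.
move=> W0 [[_ _] W0v W0m] W0W W0g.
have id_end : is_endomorphism W0 idfun by split.
have id_order : has_order W0 idfun 1 by split=> // -[|k].
apply: (twisted_module_of_parity p0 id_end id_order
  (fun c u v Wu Wv => s2 c u v (W0W u Wu) (W0W v Wv))
  (fun u v n Wu Wv => s4 u v n (W0W u Wu) (W0W v Wv)) s3) => u r W0u _.
exists 0; split; last first.
  by move=> m; rewrite /integral_mode mul0r addr0 divr1 rpredBr ?natr_int.
apply: (tau_aut p0 (W0W u W0u)); apply: (etrans (W0g u W0u)).
by rewrite expr0z scale1r.
Qed.
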